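(* There exist absolute constants $c_-,c_+>0$ such that the following holds. Let $\varepsilon'\in(0,\frac12)$, let $H$ satisfy Assumption G, and let $\mu,\nu$ be macro states with $d_\mu,d_\nu>\max\{166,\,4|\log_2(\varepsilon'/\sqrt2)|\}$. Then with probability at least $1-\varepsilon'$, $$M_{\mu\nu}\ge\Bigl(\sqrt{\varepsilon' C_\sigma}\,\frac{\max\{d_\mu,d_\nu\}}{D}\Bigr)^{16}\min\Bigl\{1,\frac{d_\nu}{d_\mu}\Bigr\},\qquad C_\sigma=\frac{c_-\sigma_-}{c_+\sigma_++C_{H_0}}.$$
   Context: Setting: $\mathcal H=\mathbb C^D$ with standard basis $|1\rangle,\dots,|D\rangle$; $[D]$ is partitioned into $m\ge2$ consecutive blocks $I_\nu=\{d_1+\dots+d_{\nu-1}+1,\dots,d_1+\dots+d_\nu\}$, $\nu=1,\dots,m$ (''macro states''); the macro space $\mathcal H_\nu$ is spanned by $\{|j\rangle:j\in I_\nu\}$, $d_\nu=\dim\mathcal H_\nu$, $P_\nu$ is the orthogonal projection onto $\mathcal H_\nu$. For a Hermitian $H$ with spectral decomposition $H=\sum_{e\in\mathcal E}e\,\Pi_e$ ($\mathcal E$ the set of distinct eigenvalues, $\Pi_e$ the eigenprojections) and a $D\times D$ matrix $B$: $M_{\mu B}=\frac1{d_\mu}\sum_{e}\mathrm{tr}(P_\mu\Pi_eB\Pi_e)$ and $M_{\mu\nu}=M_{\mu P_\nu}$. Assumption G: $H=H_0+V$, where $H_0$ is a deterministic Hermitian $D\times D$ matrix and $V=\frac1{\sqrt2}(A+A^*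 )$, where $A=(a_{ij})$ is a random $D\times D$ matrix whose real and imaginary parts $\mathrm{Re}\,a_{ij},\mathrm{Im}\,a_{ij}$, $i,j\in[D]$, are all independent with $\mathrm{Re}\,a_{ij},\mathrm{Im}\,a_{ij}\sim\mathcal N(0,\sigma_{ij}^2/2)$ for some $\sigma_{ij}=\sigma_{ji}>0$. Put $\sigma_-=\min_{i,j}\sigma_{ij}$, $\sigma_+=\max_{i,j}\sigma_{ij}$, $C_{H_0}=D^{-1/2}\max\{\|\mathrm{Re}\,H_0\|,\|\mathrm{Im}\,H_0\|\}$ (operator norms of the entrywise real/imaginary parts). *)

(* Defs.v *)
From HB Require Import structures.
From mathcomp Require Import all_boot all_order all_algebra.
From mathcomp Require Import complex.
From mathcomp Require Import all_classical all_reals all_analysis.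
Set Implicit Arguments. Unset Strict Implicit. Unset Printing Implicit Defensive.
Import Order.TTheory GRing.Theory Num.Theory.
Local Open Scope ring_scope.
Local Open Scope classical_set_scope.

Definition block_start (m : nat) (d : 'I_m -> nat) (nu : 'I_m) : nat :=
  (\sum_(k < m | (k < nu)%N) d k)%N.

Definition in_block (m : nat) (d : 'I_m -> nat) (nu : 'I_m) (j : nat) : bool :=
  (block_start d nu <= j < block_start d nu + d nu)%N.

Definition macro_proj (R : realType) (D m : nat) (d : 'I_m -> nat) (nu : 'I_m)
  : 'M[R[i]]_D :=
  \matrix_(i < D, j < D) ((i == j) && in_block d nu i)%:R.

Definition adjmx (R : realType) (D : nat) (A : 'M[R[i]]_D) : 'M[R[i]]_D :=
  \matrix_(i < D, j < D) (A j i)^*.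

Definition is_hermitian (R : realType) (D : nat) (A : 'M[R[i]]_D) : Prop :=
  adjmx A = A.

Definition eigvals (R : realType) (D : nat) (H : 'M[R[i]]_D) : seq R[i] :=
  undup [seq spectral_diag H 0 i | i <- enum 'I_D].

(* Eigenprojection Pi_e: orthogonal projection (acting on column vectors)
   onto ker (H - e).  MathComp works with row vectors: the row space
   eigenspace H^T e is { v | v H^T = e v } = { x^T | H x = e x }, and
   proj_ortho gives the row-convention orthogonal projector onto it; its
   transpose is the column-convention projector. *)
Definition eigenproj (R : realType) (D : nat) (H : 'M[R[i]]_D) (e : R[i])
  : 'M[R[i]]_D :=
  (proj_ortho (eigenspace H^T e))^T.

Definition M_B (R : realType) (D m : nat) (d : 'I_m -> nat) (H : 'M[R[i]]_D)
  (mu : 'I_m) (B : 'M[R[i]]_D) : R[i] :=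
  ((d mu)%:R)^-1 * \sum_(e <- eigvals H)
     \tr (macro_proj R D d mu *m eigenproj H e *m B *m eigenproj H e).

Definition M_mn (R : realType) (D m : nat) (d : 'I_m -> nat) (H : 'M[R[i]]_D)
  (mu nu : 'I_m) : R[i] :=
  M_B d H mu (macro_proj R D d nu).

Definition opnorm (R : realType) (D : nat) (A : 'M[R]_D) : R :=
  sup [set Num.sqrt (\sum_(i < D) ((A *m v) i 0) ^+ 2) |
        v in [set v : 'cV[R]_D | \sum_(i < D) (v i 0) ^+ 2 <= 1]].

Definition C_H0 (R : realType) (D : nat) (H0 : 'M[R[i]]_D) : R :=
  (Num.sqrt (D%:R))^-1 *
  Num.max (opnorm (map_mx (@complex.Re R) H0)) (opnorm (map_mx (@complex.Im R) H0)).

Definition sigma_min (R : realType) (D : nat) (s : 'I_D -> 'I_D -> R) : R :=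
  inf [set s p.1 p.2 | p in [set: 'I_D * 'I_D]].
Definition sigma_max (R : realType) (D : nat) (s : 'I_D -> 'I_D -> R) : R :=
  sup [set s p.1 p.2 | p in [set: 'I_D * 'I_D]].

Definition log2 (R : realType) (x : R) : R := ln x / ln 2.

Definition mutually_independent (R : realType) (d : measure_display)
  (T : measurableType d) (P : probability T R) (I : finType)
  (Z : I -> {RV P >-> R}) : Prop :=
  forall (J : {set I}) (B : I -> set R), (forall k, measurable (B k)) ->
    P [set w | forall k, k \in J -> B k (Z k w)] =
    (\prod_(k in J) P (Z k @^-1` B k))%E.

(* X has the normal distribution N(0, s^2)  (s = standard deviation) *)
Definition is_normal0 (R : realType) (d : measure_display)
  (T : measurableType d) (P : probability T R) (X : {RV P >-> R}) (s : R) : Prop :=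
  forall A : set R, measurable A -> distribution P X A = normal_prob 0 s A.

Definition randA (R : realType) (D : nat) (d : measure_display)
  (T : measurableType d) (P : probability T R)
  (X : 'I_D * 'I_D * bool -> {RV P >-> R}) (w : T) : 'M[R[i]]_D :=
  \matrix_(i < D, j < D) Complex (X (i, j, false) w) (X (i, j, true) w).

Definition randH (R : realType) (D : nat) (d : measure_display)
  (T : measurableType d) (P : probability T R) (H0 : 'M[R[i]]_D)
  (X : 'I_D * 'I_D * bool -> {RV P >-> R}) (w : T) : 'M[R[i]]_D :=
  H0 + (Complex (Num.sqrt 2)^-1 0) *: (randA X w + adjmx (randA X w)).

(* Main.v *)
Require Import Defs.
From HB Require Import structures.
From mathcomp Require Import all_boot all_order all_algebra.
From mathcomp Require Import complex ring lra zify.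
From mathcomp Require Import all_classical all_reals all_analysis.
From mathcomp Require Import measurable_realfun.
Import Order.TTheory GRing.Theory Num.Theory.
Import numFieldNormedType.Exports.
Local Open Scope ring_scope.
Local Open Scope classical_set_scope.
Local Open Scope sesquilinear_scope.
Set Implicit Arguments. Unset Strict Implicit. Unset Printing Implicit Defensive.

(** Let [rad = rho sqrt D], with [rho = 15 sigma_max + 2 C_H0], bound the norm
of [H] off an exponentially unlikely event.  If every eigenvector [v] of [H]
satisfies [|P v| >= eta |v|] for the projection [P] onto the larger of the two
blocks, then [M_mu_nu >= eta^2 min (1, d_nu / d_mu)], because
[tr (P_mu Pi_e P_nu Pi_e)] is a sum of values [|P_mu Pi_e e_j|^2].

An eigenvector with [|P v| < eta |v|] makes the columns of [H - lam] outside the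
block nearly dependent, for some [lam] in a finite grid.  Such an event is
excluded in two stages.  Let [I2] be the block without [2 m] of its indices.  The
rows outside [I2] show that fewer than [k] singular values are small: otherwise
some column would be close to the span of the others, although its conditional
distance to that span is at least that of a Gaussian vector to a subspace of
codimension [2 m].  The small singular directions then span a space of dimension
below [k], which has a net of [(16/theta)^(2k)] points, and the rows in [I2],
whose entries in the columns outside the block are still independent of all
this, are unlikely to annihilate any of them.

Laplace transforms [E exp (- s |x|^2)] replace densities throughout, and
conditioning is expressed by resampling a set of coordinates. *)

(** Why two stages: a net of all vectors supported off the block has exponent [2 (D - d)], but only
    about [d / 2] fresh rows pay for it, which fails when [D] is much larger than [d]. The first
    stage leaves fewer than [k] directions with [4 k <= d2], so two fresh rows pay for one net
    factor [16 / th]. The [2 m] indices taken from the block are the surplus of rows over columns in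
    the first stage: [m] coordinates are integrated out, and the other [m] keep the trace of the
    projection large.

    Why the power 16: put [om = a d / D] with [a = sigma_min / rho]. The first stage loses
    [(D / d)^3 / a^2], and [th] of order [om^2] makes [th^2] beat this with a factor [om] to spare.
    One factor [th] separates small singular values from [rad], a second makes the tested vector
    close to the small directions; so [eta] is of order [th^2], that is [om^4], and [eta^2] is the
    16th power of a square root.

    A separate obstacle is that the event must be measurable although eigenprojections jump when
    eigenvalues merge. [dephase] writes the sum of the [Pi_e B Pi_e] as a limit of iterated double
    commutators, whose entries are measurable. *)

Definition coords (R : realType) (I : finType) : Type := I -> R.

HB.instance Definition _ (R : realType) (I : finType) := gen_eqMixin (coords R I).
HB.instance Definition _ (R : realType) (I : finType) := gen_choiceMixin (coords R I).
HB.instance Definition _ (R : realType) (I : finType) :=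
  isPointed.Build (coords R I) (fun=> 0).

(** A pi-system generating the product sigma-algebra, made of the sets whose probability mutual
    independence prescribes. *)
Definition rectangles (R : realType) (I : finType) : set (set (coords R I)) :=
  [set A | exists2 B : I -> set R, (forall k, measurable (B k)) &
           A = [set f | forall k, B k (f k)]].

Arguments rectangles : clear implicits.

Notation state R I := (g_sigma_algebraType (rectangles R I)).

Definition mix (R : realType) (I : finType) (K : {set I}) (y x : state R I) :
  state R I := fun k => if k \in K then x k else y k.

(** * Resampling independent coordinates *)

Section mixing.
Context {R : realType} {I : finType}.
Local Notation state := (state R I).
Local Notation rectangles := (rectangles R I).

Lemma rectangles_setI : setI_closed rectangles.
Proof.
move=> _ _ [B mB ->] [B' mB' ->]; exists (fun k => B k `&` B' k).
  by move=> k; exact: measurableI.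
apply/seteqP; split => f /=; first by move=> [h1 h2] k; split.
by move=> h; split => k; case: (h k).
Qed.

Lemma rectanglesT : rectangles setT.
Proof. by exists (fun=> setT) => //; apply/seteqP; split. Qed.

Lemma measurable_coord (k : I) : measurable_fun [set: state] (fun f : state => f k).
Proof.
move=> _ B mB; rewrite setTI; apply: sub_sigma_algebra.
exists (fun j => if j == k then B else setT).
  by move=> j; case: ifP.
apply/seteqP; split => f /=; first by move=> fB j; case: ifP => // /eqP ->.
by move=> /(_ k); rewrite eqxx.
Qed.

Lemma measurable_state {d} {T : measurableType d} (F : T -> state) :
  (forall k, measurable_fun setT (fun t => F t k)) -> measurable_fun setT F.
Proof.
move=> mF; apply: (@measurability _ _ T state setT F rectangles) => //.
move=> _ [_ [B mB ->] <-].
rewrite setTI (_ : _ @^-1` _ =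
    \big[setI/setT]_(k in I) ((fun t => F t k) @^-1` B k)); last first.
  apply/seteqP; split => t /=.
    by rewrite -bigcap_seq => h k /= _; exact: h.
  by rewrite -bigcap_seq => h k; apply: h => /=; rewrite mem_index_enum.
apply: bigsetI_measurable => k _.
by rewrite -[X in measurable X]setTI; apply: mF.
Qed.

Context {d} {T : measurableType d} {P : probability T R}
  (X : I -> {RV P >-> R}) (indX : mutually_independent X).

Lemma measurable_RVs : measurable_fun [set: T] (fun w => (X^~ w : state)).
Proof. by apply: measurable_state => k; exact: (measurable_funPT (X k)). Qed.

Lemma measurable_mix (K : {set I}) :
  measurable_fun [set: T * T] (fun p => (mix K (X^~ p.1) (X^~ p.2) : state)).
Proof.
apply: measurable_state => k; rewrite /mix.
have mX := measurable_funPT (X k).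
by case: (k \in K); [exact: measurableT_comp mX measurable_snd|
                     exact: measurableT_comp mX measurable_fst].
Qed.

(** On rectangles, independence splits the probability into a factor for [K] and one for its
    complement; uniqueness of measures on a pi-system extends the equality. *)
Lemma mix_law (K : {set I}) (A : set state) : measurable A ->
  (P \x P)%E ((fun p => (mix K (X^~ p.1) (X^~ p.2) : state)) @^-1` A) =
  P ((fun w => (X^~ w : state)) @^-1` A).
Proof.
move=> mA.
have mX := measurable_RVs; have mm := measurable_mix K.
pose fX (w : T) : state := X^~ w.
pose fm (p : T * T) : state := mix K (X^~ p.1) (X^~ p.2).
have mfX : measurable_fun setT fX := mX.
have mfm' : measurable_fun setT fm := mm.
pose aX := isMeasurableFun.Build _ _ _ _ _ mfX.
pose am := isMeasurableFun.Build _ _ _ _ _ mfm'.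
pose FX : {mfun T >-> state} := HB.pack fX aX.
pose Fm : {mfun (T * T)%type >-> state} := HB.pack fm am.
pose M1 : {measure set state -> \bar R} := distribution (P \x P)%E Fm.
pose M2 : {measure set state -> \bar R} := distribution P FX.
suff : M1 A = M2 A by [].
apply: (@measure_unique _ R state rectangles (fun=> setT) _ _ _ _ M1 M2) => //.
- exact: rectangles_setI.
- by move=> _; exact: rectanglesT.
- by rewrite bigcup_const.
- move=> _ [B mB ->].
  rewrite /M1 /M2 /= /distribution /pushforward /=.
  pose C (J : {set I}) := [set w : T | forall k, k \in J -> B k (X k w)].
  have mC J : measurable (C J).
    rewrite (_ : C J = \big[setI/setT]_(k in J) (X k @^-1` B k)); last first.
      apply/seteqP; split => w; rewrite -bigcap_seq_cond /=.
        by move=> h k /andP[_ kJ]; exact: h.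
      by move=> h k kJ; apply: h; rewrite /= mem_index_enum.
    apply: bigsetI_measurable => k _; rewrite -[X in measurable X]setTI.
    exact: measurable_funPT.
  have -> : fm @^-1` [set f | forall k, B k (f k)] = C (~: K) `*` C K.
    apply/seteqP; split => -[w' w] /=.
      move=> h; split=> k kK; move: (h k); rewrite /fm /mix.
        by move: kK; rewrite inE => /negbTE ->.
      by rewrite kK.
    by move=> [h1 h2] k; rewrite /fm /mix; case: ifPn => kK; [exact: h2|apply: h1; rewrite inE].
  have -> : fX @^-1` [set f | forall k, B k (f k)] = C (finset predT).
    by apply/seteqP; split => w h k; [move=> _; exact: h|apply: h; rewrite finset.inE].
  rewrite product_measure1E//.
  have PC J : P (C J) = (\prod_(k in J) P (X k @^-1` B k))%E := indX J mB.
  rewrite [RHS]PC [RHS](bigID (mem K)) /= muleC.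
  by congr (_ * _)%E; apply: (etrans (PC _)); apply: eq_bigl => k; rewrite !finset.inE /=.
- by move=> k; rewrite (le_lt_trans (probability_le1 _ _))// ?ltry.
Qed.

Lemma mixing (K : {set I}) (f : state -> \bar R) :
  measurable_fun setT f -> (forall x, 0 <= f x)%E ->
  (\int[P]_w f (X^~ w) = \int[P]_w' \int[P]_w f (mix K (X^~ w') (X^~ w)))%E.
Proof.
move=> mf f0.
have mX := measurable_RVs; have mm := measurable_mix K.
rewrite -(@fubini_tonelli1 _ _ _ _ _ P P (fun p => f (mix K (X^~ p.1) (X^~ p.2)))) //; last first.
  exact: measurableT_comp mf mm.
rewrite -(ge0_integral_pushforward mX P measurableT) // -(ge0_integral_pushforward mm _ measurableT) //.
apply: eq_measure_integral => A mA _.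
exact/esym/mix_law.
Qed.

(** The working form of conditioning: a bound valid for every frozen [y] is integrated over [y]. The
    factor [g] keeps what still depends on [y], so the lemma can be applied again to [g] and
    coordinates leave one at a time. *)
Lemma resampling_le (K : {set I}) (f g : state -> R) (c : R) :
  measurable_fun setT f -> (forall x, 0 <= f x) ->
  measurable_fun setT g -> (forall x, 0 <= g x) -> 0 <= c ->
  (forall y, \int[P]_w (f (mix K y (X^~ w)))%:E <= (c * g y)%:E)%E ->
  (\int[P]_w (f (X^~ w))%:E <= c%:E * \int[P]_w (g (X^~ w))%:E)%E.
Proof.
move=> mf f0 mg g0 c0 h.
rewrite (mixing K (f := EFin \o f)) //; last exact/measurable_EFinP.
rewrite -ge0_integralZl//; last 2 first.
- by apply/measurable_EFinP; exact: measurableT_comp mg measurable_RVs.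
- by move=> x _; rewrite lee_fin.
apply: ge0_le_integral => //.
- by move=> w' _; apply: integral_ge0 => w _; rewrite lee_fin.
- apply: (@measurable_fun_fubini_tonelli_F _ _ _ _ _ P
    (fun p => (f (mix K (X^~ p.1) (X^~ p.2)))%:E)) => //.
    by apply/measurable_EFinP; exact: measurableT_comp mf (measurable_mix K).
  by move=> p; rewrite lee_fin.
- apply/measurable_EFinP; apply: measurable_funM => //.
  exact: measurableT_comp mg measurable_RVs.
by move=> w _; exact: h.
Qed.
End mixing.

(** * Gaussian integrals *)

Section normal_expectations.
Context {R : realType}.
Local Notation mu := (@lebesgue_measure R).

(** The explicit density agrees almost everywhere with the Radon-Nikodym derivative, both having the
    same integral over every measurable set. *)
Lemma ge0_integral_normal_prob (m s : R) (f : R -> \bar R) :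
  measurable_fun setT f -> (forall x, 0 <= f x)%E ->
  (\int[normal_prob m s]_x f x = \int[mu]_x (f x * (normal_pdf m s x)%:E))%E.
Proof.
move=> mf f0; have dom := normal_prob_dominates m s.
rewrite -(Radon_Nikodym_SigmaFinite.change_of_variables dom)//.
have mRN := measurable_int _ (Radon_Nikodym_SigmaFinite.f_integrable dom).
have mpdf : measurable_fun [set: R] (fun x => (normal_pdf m s x)%:E).
  by apply/measurable_EFinP; exact: measurable_normal_pdf.
apply: ae_eq_integral => //; [exact: emeasurable_funM|exact: emeasurable_funM|].
apply: ae_eqe_mul2l; apply: integral_ae_eq => //.
  exact: Radon_Nikodym_SigmaFinite.f_integrable.
by move=> E _ mE; rewrite -Radon_Nikodym_SigmaFinite.f_integral.
Qed.

Context {d} {T : measurableType d} {P : probability T R}.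

Lemma ge0_integral_normal0 (X : {RV P >-> R}) (s : R) (g : R -> R) :
  is_normal0 X s -> measurable_fun setT g -> (forall x, 0 <= g x) ->
  (\int[P]_w (g (X w))%:E = \int[mu]_x (g x * normal_pdf 0 s x)%:E)%E.
Proof.
move=> nX mg g0.
have mX : measurable_fun (U := measurableTypeR R) setT X := measurable_funPT X.
have mEg : measurable_fun (T := measurableTypeR R) setT (EFin \o g).
  by apply/measurable_EFinP; exact: mg.
have Eg0 x : (0 <= (EFin \o g) x)%E by rewrite lee_fin.
transitivity (\int[pushforward P (X : T -> measurableTypeR R)]_x (EFin \o g) x)%E.
  by rewrite (ge0_integral_pushforward mX)//; move=> x _; exact: Eg0.
transitivity (\int[normal_prob 0 s]_x (EFin \o g) x)%E.
  by apply: eq_measure_integral => A mA _; exact: (nX A mA).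
by rewrite ge0_integral_normal_prob.
Qed.

Lemma integral_expR_normal0 (X : {RV P >-> R}) (s a : R) : 0 < s ->
  is_normal0 X s ->
  (\int[P]_w (expR (a * X w))%:E = (expR (a ^+ 2 * s ^+ 2 / 2))%:E)%E.
Proof.
move=> s0 nX.
rewrite (ge0_integral_normal0 (g := fun x => expR (a * x)) nX); last 2 first.
- by apply: measurableT_comp => //; exact: measurable_funM.
- by move=> x; exact: expR_ge0.
(* Exponential tilting moves the mean of the density to [a * s ^+ 2]; what remains integrates to
   1. *)
have -> : (fun x => (expR (a * x) * normal_pdf 0 s x)%:E) =
    (fun x => (expR (a ^+ 2 * s ^+ 2 / 2))%:E * (normal_pdf (a * s ^+ 2) s x)%:E)%E.
  apply/funext => x; rewrite -EFinM; congr EFin.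
  rewrite !normal_pdfE ?gt_eqF// /normal_fun mulrCA [RHS]mulrCA -!expRD.
  congr (_ * expR _); rewrite subr0; field; exact: lt0r_neq0.
rewrite ge0_integralZl//; last 2 first.
- by apply/measurable_EFinP; exact: measurable_normal_pdf.
- by move=> x _; rewrite lee_fin normal_pdf_ge0.
by rewrite integral_normal_pdf mule1.
Qed.

Lemma integral_expRNsqr_normal0 (X : {RV P >-> R}) (s g c : R) : 0 < s -> 0 <= g ->
  is_normal0 X s ->
  (\int[P]_w (expR (- (g * (X w + c) ^+ 2)))%:E =
  ((Num.sqrt (1 + 2 * g * s ^+ 2))^-1 *
   expR (- (g * c ^+ 2 / (1 + 2 * g * s ^+ 2))))%:E)%E.
Proof.
move=> s0 g0 nX; set k := 1 + 2 * g * s ^+ 2.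
have k0 : 0 < k by rewrite /k ltr_pwDl //; apply: mulr_ge0; [apply: mulr_ge0|exact: sqr_ge0].
have sk0 : 0 < Num.sqrt k by rewrite sqrtr_gt0.
rewrite (ge0_integral_normal0 (g := fun x => expR (- (g * (x + c) ^+ 2))) nX); last 2 first.
- apply: measurableT_comp => //; apply: measurableT_comp => //; apply: measurable_funM => //.
  by apply: measurable_funX; exact: measurable_funD.
- by move=> x; exact: expR_ge0.
(* Completing the square: the integrand is proportional to the normal density with mean [m] and
   deviation [s']. *)
pose s' := s / Num.sqrt k; pose m := - (2 * g * c * s ^+ 2 / k).
have s'0 : 0 < s' by rewrite divr_gt0.
have -> : (fun x => (expR (- (g * (x + c) ^+ 2)) * normal_pdf 0 s x)%:E) =
    (fun x => ((Num.sqrt k)^-1 * expR (- (g * c ^+ 2 / k)))%:E * (normal_pdf m s' x)%:E)%E.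
  apply/funext => x; rewrite -EFinM; congr EFin.
  rewrite !normal_pdfE ?gt_eqF// /normal_fun mulrCA [RHS]mulrACA -!expRD.
  congr (_ * expR _).
    rewrite /normal_peak /s' expr_div_n sqr_sqrtr ?ltW//.
    have -> : s ^+ 2 / k * pi *+ 2 = (s ^+ 2 * pi *+ 2) / k by rewrite -mulrnAl; ring.
    rewrite sqrtrM ?mulrn_wge0 ?mulr_ge0 ?sqr_ge0 ?pi_ge0 ?ltW//.
    by rewrite sqrtrV ?ltW// invfM invrK mulrCA mulVf ?mulr1// gt_eqF.
  rewrite subr0 /s' /m expr_div_n sqr_sqrtr ?ltW//; move: (lt0r_neq0 k0).
  by rewrite /k => kn0; field; rewrite kn0 lt0r_neq0.
rewrite ge0_integralZl//; last 2 first.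
- by apply/measurable_EFinP; exact: measurable_normal_pdf.
- by move=> x _; rewrite lee_fin normal_pdf_ge0.
by rewrite integral_normal_pdf mule1.
Qed.

End normal_expectations.

Section independent_coordinates.
Context {R : realType} {I : finType} {d} {T : measurableType d}
  {P : probability T R} (X : I -> {RV P >-> R}) (indX : mutually_independent X).
Local Notation state := (state R I).

Lemma measurable_mix_state (K : {set I}) (y : state) :
  measurable_fun [set: T] (fun w => (mix K y (X^~ w) : state)).
Proof.
apply: measurable_state => k; rewrite /mix.
by case: (k \in K); [exact: measurable_funPT|exact: measurable_cst].
Qed.

Lemma chernoff (S : set T) (f : T -> R) (c : R) : 0 < c ->
  measurable S -> measurable_fun setT f -> (forall w, 0 <= f w) ->
  (forall w, S w -> c <= f w) ->
  (P S <= c^-1%:E * \int[P]_w (f w)%:E)%E.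
Proof.
move=> c0 mS mf f0 cf.
have h : (c%:E * P S <= \int[P]_w (f w)%:E)%E.
  rewrite -integral_cst//; apply: (@le_trans _ _ (\int[P]_(w in S) (f w)%:E)%E).
    apply: ge0_le_integral => //.
    - by move=> w _; rewrite lee_fin ltW.
    - by apply/measurable_EFinP; exact: measurable_funTS.
  apply: ge0_subset_integral => //; first exact/measurable_EFinP.
  by move=> w _; rewrite lee_fin.
rewrite -[leLHS]mul1e -(mulVf (lt0r_neq0 c0)) EFinM -muleA.
by apply: lee_wpmul2l => //; rewrite lee_fin invr_ge0 ltW.
Qed.

(** [resampling_le] for an indicator, with the constant 1 as [g]. *)
Lemma conditioning_le (K : {set I}) (A : set state) (c : R) : 0 <= c ->
  measurable A ->
  (forall y, (P ((fun w => (mix K y (X^~ w) : state)) @^-1` A) <= c%:E)%E) ->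
  (P ((fun w => (X^~ w : state)) @^-1` A) <= c%:E)%E.
Proof.
move=> c0 mA h.
have iE (S : set T) : measurable S -> (\int[P]_w (\1_S w)%:E = P S)%E.
  by move=> mS; rewrite integral_indic// setIT.
have mX := measurable_RVs X.
have := @resampling_le R I d T P X indX K (\1_A) (fun=> 1) c.
have -> : (\int[P]_w (\1_A (X^~ w))%:E)%E = P ((fun w => (X^~ w : state)) @^-1` A).
  rewrite -iE; last by rewrite -[X in measurable X]setTI; exact: mX.
  by apply: eq_integral => w _; rewrite !indicE.
have -> : (\int[P]_w (1%R)%:E = 1)%E.
  by rewrite integral_cst// mul1e; exact: probability_setT.
rewrite mule1; apply => //.
move=> y; rewrite mulr1; apply: le_trans (h y).
rewrite -iE; last first.
  by rewrite -[X in measurable X]setTI; exact: measurable_mix_state.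
by rewrite le_eqVlt; apply/orP; left; apply/eqP/eq_integral => w _; rewrite !indicE.
Qed.

(** The square roots coming from the real and the imaginary part multiply, so that a complex
    coordinate costs a rational factor. *)
Lemma integral_expRNsqr_pair_le (k l : I) (s g a b : R) : k != l -> 0 < s -> 0 <= g ->
  is_normal0 (X k) s -> is_normal0 (X l) s ->
  (\int[P]_w (expR (- (g * ((X k w + a) ^+ 2 + (X l w + b) ^+ 2))))%:E <=
   ((1 + 2 * g * s ^+ 2)^-1 *
     expR (- (g * (a ^+ 2 + b ^+ 2) / (1 + 2 * g * s ^+ 2))))%:E)%E.
Proof.
move=> kl s0 g0 nk nl; set K := 1 + 2 * g * s ^+ 2.
have K0 : 0 < K by rewrite /K ltr_pwDl //; apply: mulr_ge0; [apply: mulr_ge0|exact: sqr_ge0].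
pose f (x : state) := expR (- (g * ((x k + a) ^+ 2 + (x l + b) ^+ 2))).
pose h (x : state) := expR (- (g * (x l + b) ^+ 2)).
pose c := (Num.sqrt K)^-1 * expR (- (g * a ^+ 2 / K)).
have mk j e : measurable_fun [set: state] (fun x : state => (x j + e) ^+ 2).
  by apply: measurable_funX; apply: measurable_funD => //; exact: measurable_coord.
have mf : measurable_fun setT f.
  apply: measurableT_comp => //; apply: measurableT_comp => //.
  by apply: measurable_funM => //; exact: measurable_funD.
have mh : measurable_fun setT h.
  apply: measurableT_comp => //; apply: measurableT_comp => //.
  exact: measurable_funM.
have c0 : 0 <= c by rewrite mulr_ge0 ?expR_ge0// invr_ge0 sqrtr_ge0.
have := @resampling_le R I d T P X indX [set k]%SET f h c mf
  (fun=> expR_ge0 _) mh (fun=> expR_ge0 _) c0.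
move=> /(_ _)/le_trans; apply.
  move=> y; rewrite /f /h /mix !finset.inE eqxx eq_sym (negbTE kl) /c.
  under eq_integral do rewrite mulrDr opprD expRD mulrC EFinM.
  rewrite ge0_integralZl//; last first.
  - apply/measurable_EFinP; apply: measurableT_comp => //; apply: measurableT_comp => //.
    by apply: measurable_funM => //; apply: measurable_funX; exact: measurable_funD.
  by rewrite (integral_expRNsqr_normal0 _ s0 g0 nk) -EFinM mulrC.
rewrite /h (integral_expRNsqr_normal0 _ s0 g0 nl) -/K -EFinM lee_fin /c.
rewrite mulrACA -expRD -invfM -expr2 (sqr_sqrtr (ltW K0)).
by rewrite mulrDr mulrDl opprD.
Qed.

End independent_coordinates.

(** * Complex vectors, projections and spectral splitting *)

Section complex_vectors.
Context {R : realType}.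
Local Notation C := R[i].
Implicit Types (z w : C) (m n p : nat).

Definition nsq z : R := complex.Re z ^+ 2 + complex.Im z ^+ 2.

Lemma conjCE z : z^* = Complex (complex.Re z) (- complex.Im z).
Proof. by case: z. Qed.

Lemma nsq_ge0 z : 0 <= nsq z.
Proof. by rewrite addr_ge0 ?sqr_ge0. Qed.

Lemma nsq_eq0 z : (nsq z == 0) = (z == 0).
Proof. by case: z => a b; rewrite /nsq paddr_eq0 ?sqr_ge0// !sqrf_eq0 eq_complex. Qed.

Lemma nsq0 : nsq 0 = 0.
Proof. by rewrite /nsq /= expr0n addr0. Qed.

Lemma nsqM z w : nsq (z * w) = nsq z * nsq w.
Proof. by case: z w => a b [e f]; rewrite /nsq /=; ring. Qed.

Lemma nsq_conj z : nsq z^* = nsq z.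
Proof. by rewrite conjCE /nsq /= sqrrN. Qed.

Lemma nsqN z : nsq (- z) = nsq z.
Proof. by case: z => a b; rewrite /nsq /= !sqrrN. Qed.

Lemma nsq_real (x : R) : nsq (Complex x 0) = x ^+ 2.
Proof. by rewrite /nsq /= expr0n addr0. Qed.

Lemma nsqE z : Complex (nsq z) 0 = z^* * z.
Proof. by case: z => a b; rewrite conjCE /nsq; congr Complex; rewrite /=; ring. Qed.

Lemma ReM_conj z w : complex.Re (z^* * w) =
  complex.Re z * complex.Re w + complex.Im z * complex.Im w.
Proof. by case: z w => a b [e f]; rewrite conjCE /=; ring. Qed.

Lemma ReD z w : complex.Re (z + w) = complex.Re z + complex.Re w.
Proof. by case: z w => a b [e f]. Qed.

Lemma ImD z w : complex.Im (z + w) = complex.Im z + complex.Im w.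
Proof. by case: z w => a b [e f]. Qed.

Lemma Re_sum (I : Type) (r : seq I) (Q : pred I) (F : I -> C) :
  complex.Re (\sum_(i <- r | Q i) F i) = \sum_(i <- r | Q i) complex.Re (F i).
Proof. by apply: (big_morph _ ReD). Qed.

Lemma Im_sum (I : Type) (r : seq I) (Q : pred I) (F : I -> C) :
  complex.Im (\sum_(i <- r | Q i) F i) = \sum_(i <- r | Q i) complex.Im (F i).
Proof. by apply: (big_morph _ ImD). Qed.

Definition n2 n (v : 'cV[C]_n) : R := \sum_i nsq (v i 0).

Definition nv n (v : 'cV[C]_n) : R := Num.sqrt (n2 v).

(** The Euclidean product of [C^n] seen as a real space of dimension [2 n]; it keeps norm expansions
    and Cauchy-Schwarz inside [R]. *)
Definition ip n (u v : 'cV[C]_n) : R := \sum_i complex.Re ((u i 0)^* * v i 0).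

Lemma n2_ge0 n (v : 'cV[C]_n) : 0 <= n2 v.
Proof. by apply: sumr_ge0 => i _; exact: nsq_ge0. Qed.

Lemma nv_ge0 n (v : 'cV[C]_n) : 0 <= nv v.
Proof. exact: sqrtr_ge0. Qed.

Lemma sqr_nv n (v : 'cV[C]_n) : nv v ^+ 2 = n2 v.
Proof. by rewrite sqr_sqrtr ?n2_ge0. Qed.

Lemma n20 n : n2 (0 : 'cV[C]_n) = 0.
Proof. by rewrite /n2 big1// => i _; rewrite mxE nsq0. Qed.

Lemma n2_eq0 n (v : 'cV[C]_n) : (n2 v == 0) = (v == 0).
Proof.
apply/idP/eqP => [|->]; last by rewrite n20.
rewrite psumr_eq0 => [/allP h|i _]; last exact: nsq_ge0.
apply/colP => i; rewrite mxE; apply/eqP; rewrite -nsq_eq0.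
exact: h (mem_index_enum i).
Qed.

Lemma n2_gt0 n (v : 'cV[C]_n) : (0 < n2 v) = (v != 0).
Proof. by rewrite lt_def n2_ge0 andbT n2_eq0. Qed.

Lemma n2E n (v : 'cV[C]_n) : (v ^t* *m v) 0 0 = Complex (n2 v) 0.
Proof.
rewrite mxE; under eq_bigr do rewrite !mxE -nsqE.
rewrite /n2; elim/big_rec2: _ => // i x y _ ->.
by apply/eqP; rewrite eq_complex /= addr0 !eqxx.
Qed.

Lemma n2Z n (a : C) (v : 'cV[C]_n) : n2 (a *: v) = nsq a * n2 v.
Proof. by rewrite /n2 mulr_sumr; apply: eq_bigr => i _; rewrite mxE nsqM. Qed.

Lemma n2N n (v : 'cV[C]_n) : n2 (- v) = n2 v.
Proof. by apply: eq_bigr => i _; rewrite mxE nsqN. Qed.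

Lemma nvN n (v : 'cV[C]_n) : nv (- v) = nv v.
Proof. by rewrite /nv n2N. Qed.

Lemma n2D n (u v : 'cV[C]_n) : n2 (u + v) = n2 u + 2 * ip u v + n2 v.
Proof.
rewrite /n2 /ip mulr_sumr -!big_split; apply: eq_bigr => i _.
by rewrite mxE ReM_conj /nsq ReD ImD /=; ring.
Qed.

Lemma ipZr n (a : R) (u v : 'cV[C]_n) : ip u (Complex a 0 *: v) = a * ip u v.
Proof.
rewrite /ip mulr_sumr; apply: eq_bigr => i _; rewrite mxE !ReM_conj.
by case: (v i 0) => x y /=; ring.
Qed.

Lemma ipC n (u v : 'cV[C]_n) : ip u v = ip v u.
Proof. by apply: eq_bigr => i _; rewrite !ReM_conj mulrC [in X in _ + X]mulrC. Qed.

Lemma ip_sqr_le n (u v : 'cV[C]_n) : ip u v ^+ 2 <= n2 u * n2 v.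
Proof.
have [v0|v0] := eqVneq v 0.
  by rewrite v0 ipC /ip big1 ?expr0n ?mulr_ge0 ?n2_ge0// => i _; rewrite mxE ReM_conj /= !mul0r addr0.
have := n2_ge0 (Complex (n2 v) 0 *: u + Complex (- ip u v) 0 *: v).
rewrite n2D !n2Z !nsq_real ipZr [ip (_ *: _) _]ipC ipZr [ip v u]ipC => h.
have v1 : 0 < n2 v by rewrite n2_gt0.
rewrite -subr_ge0 -(pmulr_rge0 _ v1); apply: le_trans h _.
by rewrite le_eqVlt; apply/orP; left; apply/eqP; ring.
Qed.

Lemma ip_le n (u v : 'cV[C]_n) : ip u v <= nv u * nv v.
Proof.
rewrite -sqrtrM ?n2_ge0//; apply: le_trans (ler_norm _) _.
by rewrite -sqrtr_sqr ler_sqrt ?mulr_ge0 ?n2_ge0// ip_sqr_le.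
Qed.

Lemma nvD_le n (u v : 'cV[C]_n) : nv (u + v) <= nv u + nv v.
Proof.
rewrite -ler_sqr ?nnegrE ?addr_ge0 ?nv_ge0// sqr_nv n2D.
rewrite sqrrD !sqr_nv lerD2r lerD2l -[leRHS]mulr_natl.
by apply: ler_wpM2l => //; exact: ip_le.
Qed.

Lemma nvB_le n (u v : 'cV[C]_n) : nv (u - v) <= nv u + nv v.
Proof. by rewrite -[nv v]nvN nvD_le. Qed.

Lemma nvZ n (a : C) (v : 'cV[C]_n) : nv (a *: v) = Num.sqrt (nsq a) * nv v.
Proof. by rewrite /nv n2Z sqrtrM ?nsq_ge0. Qed.

Lemma nvZ_real n (a : R) (v : 'cV[C]_n) : nv (Complex a 0 *: v) = `|a| * nv v.
Proof. by rewrite nvZ nsq_real sqrtr_sqr. Qed.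

Lemma nsq_sum_le (I : finType) (f g : I -> C) :
  nsq (\sum_i f i * g i) <= (\sum_i nsq (f i)) * \sum_i nsq (g i).
Proof.
set z := \sum_i _.
have [->|z0] := eqVneq z 0; first by rewrite nsq0 mulr_ge0 ?sumr_ge0// => i _; exact: nsq_ge0.
have z1 : 0 < nsq z by rewrite lt_def nsq_ge0 nsq_eq0 z0.
(* The factor [z], the value of the sum, rotates it to the positive real axis: [ip u v] is [nsq z],
   so the real inequality suffices. *)
pose u : 'cV[C]_#|I| := \col_i (z * (f (enum_val i))^*).
pose v : 'cV[C]_#|I| := \col_i (g (enum_val i)).
have reind (F : I -> R) : \sum_(i < #|I|) F (enum_val i) = \sum_i F i.
  by rewrite -(big_enum_val (A := I) (idx := 0) F); apply: eq_bigl.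
have uv : ip u v = nsq z.
  transitivity (complex.Re (z^* * z)); last by rewrite -nsqE.
  rewrite {2}/z mulr_sumr Re_sum /ip -reind; apply: eq_bigr => i _.
  by rewrite !mxE rmorphM /= conjCK mulrA.
have nu : n2 u = nsq z * \sum_i nsq (f i).
  rewrite mulr_sumr -reind; apply: eq_bigr => i _.
  by rewrite mxE nsqM nsq_conj.
have nvv : n2 v = \sum_i nsq (g i).
  by rewrite -reind; apply: eq_bigr => i _; rewrite mxE.
have := ip_sqr_le u v; rewrite uv nu nvv => h.
by rewrite -(ler_pM2l z1) mulrA -expr2.
Qed.

Definition fro m n (A : 'M[C]_(m, n)) : R := Num.sqrt (\sum_i \sum_j nsq (A i j)).

Lemma fro_ge0 m n (A : 'M[C]_(m, n)) : 0 <= fro A.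
Proof. exact: sqrtr_ge0. Qed.

Lemma nv_mulmx_le m n (A : 'M[C]_(m, n)) (v : 'cV[C]_n) : nv (A *m v) <= fro A * nv v.
Proof.
rewrite -sqrtrM; last by apply: sumr_ge0 => i _; apply: sumr_ge0 => j _; exact: nsq_ge0.
apply: ler_wsqrtr; rewrite mulr_suml; apply: ler_sum => i _.
by rewrite mxE; exact: (nsq_sum_le (fun j => A i j) (fun j => v j 0)).
Qed.

Lemma n2_unitary n (U : 'M[C]_n) (v : 'cV[C]_n) :
  U ^t* *m U = 1%:M -> n2 (U *m v) = n2 v.
Proof.
move=> UU; have : Complex (n2 (U *m v)) 0 = Complex (n2 v) 0 by
  rewrite -!n2E trmx_mul map_mxM mulmxA -(mulmxA _ _ U) UU mulmx1.
by case.
Qed.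

End complex_vectors.

(** * Orthogonal projections and their deflation *)

Section projections.
Context {R : realType}.
Local Notation C := R[i].
Implicit Types (n : nat).

Definition orthoproj n (P : 'M[C]_n) : Prop := P ^t* = P /\ P *m P = P.

Definition coordproj n (Q : {pred 'I_n}) : 'M[C]_n :=
  \matrix_(i, j) ((i == j) && (i \in Q))%:R.

Lemma CompM (a b : R) : Complex a 0 * Complex b 0 = Complex (a * b) 0 :> C.
Proof. by apply/eqP; rewrite eq_complex /= !mulr0 !mul0r subr0 addr0 !eqxx. Qed.

Lemma CompD (a b : R) : Complex a 0 + Complex b 0 = Complex (a + b) 0 :> C.
Proof. by apply/eqP; rewrite eq_complex /= addr0 !eqxx. Qed.

Lemma nsq_bool (b : bool) : nsq (b%:R : C) = b%:R.
Proof. by case: b; rewrite /nsq /= ?expr0n ?expr1n /= addr0. Qed.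

Lemma mul_coordproj n (Q : {pred 'I_n}) p (A : 'M[C]_(n, p)) i j :
  (coordproj Q *m A) i j = (i \in Q)%:R * A i j.
Proof.
rewrite mxE (bigD1 i)//= mxE eqxx /= big1 ?addr0// => k ki.
by rewrite mxE eq_sym (negbTE ki) mul0r.
Qed.

Lemma orthoproj_coordproj n (Q : {pred 'I_n}) : orthoproj (coordproj Q).
Proof.
split; apply/matrixP => i j.
  rewrite !mxE eq_sym; have [->|_] := eqVneq i j; first by rewrite conjC_nat.
  by rewrite /= conjC0.
by rewrite mul_coordproj !mxE; case: (i \in Q); rewrite ?mul1r ?mul0r ?andbF.
Qed.

Lemma n2_coordproj n (Q : {pred 'I_n}) (v : 'cV[C]_n) :
  n2 (coordproj Q *m v) = \sum_(i in Q) nsq (v i 0).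
Proof.
rewrite /n2 [RHS]big_mkcond; apply: eq_bigr => i _.
by rewrite mul_coordproj nsqM nsq_bool; case: ifP; rewrite ?mul1r ?mul0r.
Qed.

Lemma n2_coordproj_split n (Q : {pred 'I_n}) (v : 'cV[C]_n) :
  n2 v = n2 (coordproj Q *m v) + n2 (coordproj [predC Q] *m v).
Proof. by rewrite !n2_coordproj /n2 (bigID (mem Q)). Qed.

Lemma n2_coordproj_le n (Q : {pred 'I_n}) (v : 'cV[C]_n) : n2 (coordproj Q *m v) <= n2 v.
Proof. by rewrite [leRHS](n2_coordproj_split Q) lerDl n2_ge0. Qed.

Lemma nv_coordproj_le n (Q : {pred 'I_n}) (v : 'cV[C]_n) : nv (coordproj Q *m v) <= nv v.
Proof. exact/ler_wsqrtr/n2_coordproj_le. Qed.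

Lemma mxtrace_coordproj n (Q : {pred 'I_n}) : \tr (coordproj Q) = #|Q|%:R.
Proof.
rewrite /mxtrace; under eq_bigr do rewrite mxE eqxx /=.
by rewrite -sum1_card natr_sum [RHS]big_mkcond; apply: eq_bigr => i _; case: (i \in Q).
Qed.

Lemma n2_orthoproj n (P : 'M[C]_n) (h : 'cV[C]_n) : orthoproj P ->
  Complex (n2 (P *m h)) 0 = (h ^t* *m P *m h) 0 0.
Proof.
by case=> Ph PP; rewrite -n2E trmx_mul map_mxM Ph mulmxA -(mulmxA _ P P) PP.
Qed.

Lemma orthoproj_diag n (P : 'M[C]_n) i : orthoproj P ->
  P i i = Complex (n2 (P *m delta_mx i 0)) 0.
Proof.
move=> pP; rewrite n2_orthoproj// trmx_delta map_delta_mx -rowE.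
by rewrite mxE (bigD1 i)//= !mxE !eqxx mulr1 big1 ?addr0// => j ji; rewrite !mxE (negbTE ji) mulr0.
Qed.

(** [P'] is [P] minus the projection onto the line of [P a]; the last clause is Pythagoras for that
    line. *)
Lemma orthoproj_deflate n (P : 'M[C]_n) (a : 'cV[C]_n) : orthoproj P -> P *m a != 0 ->
  exists P' : 'M[C]_n, [/\ orthoproj P', P' *m P = P', P' *m a = 0,
    \tr P' = \tr P - 1 &
    forall h, n2 (P *m h) = n2 (P' *m h) + nsq ((a ^t* *m P *m h) 0 0) / n2 (P *m a)].
Proof.
move=> [Ph PP] b0; set b := P *m a.
have B0 : 0 < n2 b by rewrite n2_gt0.
pose k : C := Complex (n2 b)^-1 0.
have kb : k * Complex (n2 b) 0 = 1.
  by rewrite CompM mulVf ?gt_eqF.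
have kc : k^* = k by rewrite conjCE /k /= oppr0.
have bP : b ^t* *m P = b ^t* by rewrite /b trmx_mul map_mxM Ph -mulmxA PP.
have Pb : P *m b = b by rewrite /b mulmxA PP.
have bb : b ^t* *m b = (Complex (n2 b) 0)%:M by rewrite [LHS]mx11_scalar n2E.
have ab : b ^t* *m a = (Complex (n2 b) 0)%:M.
  by rewrite -bP -mulmxA -/b bb.
pose P' := P - k *: (b *m b ^t*).
have P'P : P' *m P = P' by rewrite mulmxBl PP -scalemxAl -mulmxA bP.
have P'b : P' *m b = 0.
  by rewrite mulmxBl Pb -scalemxAl -mulmxA bb mul_mx_scalar scalerA kb scale1r subrr.
have P'h : P' ^t* = P'.
  rewrite /P' linearB /= map_mxB Ph linearZ /= map_mxZ /= kc trmx_mul map_mxM.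
  by rewrite trmxCK.
have pP' : orthoproj P'.
  by split => //; rewrite {2}/P' mulmxBr P'P -scalemxAr mulmxA P'b mul0mx scaler0 subr0.
exists P'; split => //.
- by rewrite -P'P -mulmxA -/b.
- rewrite raddfB /= mxtraceZ mxtrace_mulC bb mxtrace_scalar.
  by rewrite mulr1n kb.
- move=> h; have pP : orthoproj P by [].
  suff : Complex (n2 (P *m h)) 0 =
     Complex (n2 (P' *m h) + nsq ((a ^t* *m P *m h) 0 0) / n2 b) 0 by case.
  rewrite n2_orthoproj// -[P in LHS](subrK (k *: (b *m b ^t*))) -/P'.
  rewrite mulmxDr mulmxDl mxE -n2_orthoproj//.
  rewrite -scalemxAr -scalemxAl mxE mulmxA -(mulmxA (h ^t* *m b)).
  have -> : a ^t* *m P = b ^t* by rewrite /b trmx_mul map_mxM Ph.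
  set z := (b ^t* *m h) 0 0.
  have zE : b ^t* *m h = z%:M by rewrite [LHS]mx11_scalar.
  have -> : h ^t* *m b = (z^*)%:M.
    have -> : h ^t* *m b = (b ^t* *m h) ^t* by rewrite trmx_mul map_mxM trmxCK.
    by rewrite zE tr_scalar_mx map_scalar_mx.
  rewrite zE -scalar_mxM mxE eqxx mulr1n -nsqE.
  by rewrite CompM CompD mulrC.
Qed.

(** Deflate along each vector in turn; one that is already annihilated costs nothing. The trace
    stands for the dimension, so this is the count of codimensions. *)
Lemma orthoproj_kill n (P : 'M[C]_n) (s : seq 'cV[C]_n) : orthoproj P ->
  exists P' : 'M[C]_n, [/\ orthoproj P', P' *m P = P',
    (forall a, a \in s -> P' *m a = 0) &
    complex.Re (\tr P) - (size s)%:R <= complex.Re (\tr P')].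
Proof.
move=> pP; elim: s => [|a s [P' [pP' P'P P's trP']]].
  by exists P; split => //; [case: pP|rewrite subr0].
have [a0|a0] := eqVneq (P' *m a) 0.
  exists P'; split => //.
    by move=> b; rewrite inE => /orP[/eqP ->//|/P's].
  by apply: le_trans trP'; rewrite lerD2l lerN2 ler_nat /=.
have [P'' [pP'' P''P' P''a trP'' _]] := orthoproj_deflate pP' a0.
exists P''; split => //.
- by rewrite -P''P' -mulmxA P'P.
- move=> b; rewrite inE => /orP[/eqP ->//|/P's bs].
  by rewrite -P''P' -mulmxA bs mulmx0.
- rewrite trP'' ReD /= -natr1 opprD addrA lerD2r//.
Qed.

Lemma orthoproj_diag_large n (P : 'M[C]_n) (t : R) : orthoproj P ->
  0 < t -> t <= complex.Re (\tr P) -> exists i, t / n%:R <= complex.Re (P i i).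
Proof.
move=> pP t0 tP; case: n P pP tP => [|n] P pP tP.
  by move: tP; rewrite /mxtrace big_ord0 /= leNgt t0.
apply/not_existsP => h.
have : complex.Re (\tr P) < t.
  rewrite /mxtrace Re_sum.
  have -> : t = \sum_(i < n.+1) t / n.+1%:R.
    by rewrite sumr_const card_ord -[RHS]mulr_natr divfK// pnatr_eq0.
  apply: ltr_sum => [|i _]; first by apply/hasP; exists ord0 => //; rewrite mem_index_enum.
  by rewrite ltNge; apply/negP/h.
by rewrite ltNge tP.
Qed.

End projections.

(** * Spectral decomposition and splitting at a threshold *)

Section spectral.
Context {R : realType}.
Local Notation C := R[i].
Implicit Types (n : nat).

Lemma realC_Re (z : C) : z \is Num.real -> z = Complex (complex.Re z) 0.
Proof. by case: z => a b; rewrite complex_real => /eqP ->. Qed.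

Definition eigval n (H : 'M[C]_n) (l : 'I_n) : R := complex.Re (spectral_diag H 0 l).

Lemma hermitian_spectral n (H : 'M[C]_n) (U := (spectralmx H) ^t*) : H ^t* = H ->
  [/\ U ^t* *m U = 1%:M, U *m U ^t* = 1%:M,
      H = U *m diag_mx (\row_l Complex (eigval H l) 0) *m U ^t* &
      forall l, spectral_diag H 0 l = Complex (eigval H l) 0].
Proof.
move=> Hh; have Hs : H \is hermsymmx.
  by apply/is_hermitianmxP; rewrite expr0 scale1r Hh.
have uS := spectral_unitarymx H; have := uS => /unitarymxP UU.
have V := invmx_unitary uS.
have UU' : U *m spectralmx H = 1%:M by rewrite /U -V mulVmx// spectral_unit.
have spE l : spectral_diag H 0 l = Complex (eigval H l) 0.
  by apply: realC_Re; have /mxOverP := hermitian_spectral_diag_real Hs; apply.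
split; rewrite /U ?trmxCK //.
have /orthomx_spectralP {1}-> := hermitian_normalmx Hs.
have dE : \row_l Complex (eigval H l) 0 = spectral_diag H :> 'rV_n.
  by apply/rowP => l; rewrite mxE spE.
by rewrite dE V.
Qed.

Lemma hermitian_eigvec n (H : 'M[C]_n) (U := (spectralmx H) ^t*) l : H ^t* = H ->
  H *m col l U = Complex (eigval H l) 0 *: col l U.
Proof.
move=> Hh; have [UU _ HE _] := hermitian_spectral Hh.
rewrite colE mulmxA {1}HE -(mulmxA _ (U ^t*) U) UU mulmx1 -!colE.
by apply/colP => i; rewrite [LHS]mxE mul_mx_diag !mxE mulrC.
Qed.

Lemma hermitian_qf n (H : 'M[C]_n) (U := (spectralmx H) ^t*) (c : 'cV[C]_n) : H ^t* = H ->
  ((U *m c) ^t* *m H *m (U *m c)) 0 0 = Complex (\sum_l eigval H l * nsq (c l 0)) 0.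
Proof.
move=> Hh; have [UU _ HE _] := hermitian_spectral Hh.
rewrite {1}HE trmx_mul map_mxM !mulmxA -(mulmxA _ _ (spectralmx H ^t*)) UU mulmx1.
rewrite -(mulmxA _ (U ^t*) U) UU mulmx1 mxE.
rewrite (big_morph (fun x : R => Complex x 0 : C) (id1 := 0) (op1 := +%R)) //; last first.
  by move=> x y; rewrite -CompD.
apply: eq_bigr => l _; rewrite mul_mx_diag !mxE -CompM mulrAC -nsqE.
by rewrite mulrC.
Qed.

(** A substitute for the singular value decomposition of [T], with [L] indexing the singular values
    below [k]. The kernel of [T ^t* *m T] contains everything supported off [J]; adding [k ^+ 2]
    times the projection off [J] lifts these vectors to the eigenvalue [k ^+ 2], so the eigenvectors
    below it live on [J]. *)
Lemma spectral_split n (T : 'M[C]_n) (J : {pred 'I_n}) (k : R) : 0 < k ->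
  T *m coordproj J = T ->
  exists (U : 'M[C]_n) (L : {set 'I_n}),
  [/\ U ^t* *m U = 1%:M, U *m U ^t* = 1%:M,
    forall l i, l \in L -> i \notin J -> U i l = 0,
    forall c : 'cV[C]_n, (forall l, l \notin L -> c l 0 = 0) ->
      n2 (T *m (U *m c)) <= k ^+ 2 * n2 c &
    forall y, coordproj J *m y = y ->
      k ^+ 2 * (\sum_(l | l \notin L) nsq ((U ^t* *m y) l 0)) <= n2 (T *m y)].
Proof.
move=> k0 TJ; set PJ := coordproj J in TJ *.
have [PJh PJJ] : orthoproj PJ by exact: orthoproj_coordproj.
pose Pc := coordproj [predC J] : 'M[C]_n.
have [Pch PcPc] : orthoproj Pc by exact: orthoproj_coordproj.
pose kk : C := Complex (k ^+ 2) 0.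
pose G := T ^t* *m T + kk *: Pc.
have Gh : G ^t* = G.
  rewrite /G linearD /= map_mxD trmx_mul map_mxM trmxCK linearZ /= map_mxZ Pch.
  by congr (_ + _ *: _); rewrite -[LHS]/(kk^* ) conjCE /kk /= oppr0.
pose U := (spectralmx G) ^t*.
have [UU UU' _ _] := hermitian_spectral Gh.
have PcJ : Pc *m PJ = 0.
  apply/matrixP => i j; rewrite mul_coordproj !mxE inE /=.
  by case: (i \in J); rewrite ?mul0r// andbF mulr0.
have PJT : Pc *m T ^t* = 0.
  by rewrite -TJ trmx_mul map_mxM PJh mulmxA PcJ mul0mx.
have qf c : n2 (T *m (U *m c)) + k ^+ 2 * n2 (Pc *m (U *m c)) =
    \sum_l eigval G l * nsq (c l 0).
  suff : Complex (n2 (T *m (U *m c)) + k ^+ 2 * n2 (Pc *m (U *m c))) 0 =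
    Complex (\sum_l eigval G l * nsq (c l 0)) 0 :> C by case.
  rewrite -hermitian_qf// -CompD -CompM -/U (n2_orthoproj (P := Pc))// -n2E.
  rewrite /G mulmxDr mulmxDl [RHS]mxE; congr (_ + _).
    by rewrite [in LHS]trmx_mul map_mxM !mulmxA.
  by rewrite -scalemxAr -scalemxAl [RHS]mxE.
have g0 l : 0 <= eigval G l.
  have := qf (delta_mx l 0).
  rewrite (bigD1 l)//= big1 => [|j jl]; last by rewrite mxE (negbTE jl) /= nsq0 mulr0.
  rewrite mxE !eqxx addr0 (nsq_bool true) mulr1 => <-.
  by apply: addr_ge0; [exact: n2_ge0|apply: mulr_ge0; [exact: sqr_ge0|exact: n2_ge0]].
(* Strict, since vectors supported off [J] have eigenvalue exactly [k ^+ 2]. *)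
pose L := [set l | eigval G l < k ^+ 2]%SET.
exists U, L; split => //.
- move=> l i; rewrite inE => lk iJ.
  have := hermitian_eigvec l Gh; rewrite -/U => /(congr1 (mulmx Pc)).
  rewrite {1}/G mulmxA mulmxDr mulmxA PJT mul0mx add0r -scalemxAr PcPc.
  rewrite -scalemxAl -scalemxAr.
  have : (Pc *m col l U) i 0 = U i l by rewrite mul_coordproj inE /= iJ mul1r mxE.
  move: (Pc *m col l U) => w wi e.
  have : kk * w i 0 = Complex (eigval G l) 0 * w i 0.
    by have /colP/(_ i) := e; rewrite !mxE.
  rewrite wi => /eqP.
  rewrite -subr_eq0 -mulrBl mulf_eq0 => /orP[|/eqP//].
  by rewrite subr_eq0 /kk => /eqP[] E; move: lk; rewrite E ltxx.
- move=> c cL; apply: (@le_trans _ _ (\sum_l eigval G l * nsq (c l 0))).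
    by rewrite -qf lerDl; apply: mulr_ge0; [exact: sqr_ge0|exact: n2_ge0].
  rewrite /n2 mulr_sumr; apply: ler_sum => l _.
  have [lL|lL] := boolP (l \in L); last by rewrite cL// nsq0 !mulr0.
  by rewrite ler_wpM2r ?nsq_ge0//; move: lL; rewrite inE => /ltW.
- move=> y yJ; have yE : y = U *m (U ^t* *m y) by rewrite mulmxA UU' mul1mx.
  have := qf (U ^t* *m y); rewrite -yE.
  have -> : Pc *m y = 0 by rewrite -yJ mulmxA PcJ mul0mx.
  rewrite n20 mulr0 addr0 => ->.
  rewrite mulr_sumr [leRHS](bigID (mem L)) /= -[leLHS]add0r; apply: lerD.
    by apply: sumr_ge0 => l _; rewrite mulr_ge0 ?nsq_ge0.
  apply: ler_sum => l; rewrite inE -leNgt => h.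
  by rewrite ler_wpM2r ?nsq_ge0.
Qed.

End spectral.

(** * Macro projections and eigenprojections *)

Section eigenprojections.
Context {R : realType}.
Local Notation C := R[i].

Lemma adjmxE n (A : 'M[C]_n) : adjmx A = A ^t*.
Proof. by apply/matrixP => i j; rewrite !mxE. Qed.

Lemma macro_projE n m (d : 'I_m -> nat) (nu : 'I_m) :
  macro_proj R n d nu = coordproj [pred i : 'I_n | in_block d nu i].
Proof. by apply/matrixP => i j; rewrite !mxE. Qed.

Lemma card_block n m (d : 'I_m -> nat) (nu : 'I_m) : (\sum_k d k)%N = n ->
  #|[pred i : 'I_n | in_block d nu i]| = d nu.
Proof.
move=> sn; have le_n : (block_start d nu + d nu <= n)%N.
  rewrite -sn /block_start [leqRHS](bigID (fun k : 'I_m => k < nu)%N)/= leq_add2l.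
  by rewrite (bigD1 nu) ?ltnn//= leq_addr.
rewrite -sum1_card; under eq_bigl do rewrite inE.
rewrite -(big_mkord (fun i => in_block d nu i) (fun=> 1%N)).
rewrite /in_block; set s := block_start d nu in le_n *.
rewrite (big_cat_nat (n := s)) ?(leq_trans (leq_addr _ _) le_n)//=.
rewrite (big_cat_nat (m := s) (n := s + d nu)) ?leq_addr//=.
rewrite big_nat_cond big1 ?add0n; last by lia.
rewrite [X in (_ + X)%N]big_nat_cond [X in (_ + X)%N]big1 ?addn0; last by lia.
rewrite big_nat_cond (eq_bigl (fun i => s <= i < s + d nu)%N); last by move=> i; rewrite andbb.
by rewrite -big_nat sum_nat_const_nat addKn muln1.
Qed.

Lemma eigenproj_id n (H : 'M[C]_n) e (v : 'cV[C]_n) : H *m v = e *: v -> eigenproj H e *m v = v.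
Proof.
move=> Hv; apply: trmx_inj; rewrite trmx_mul trmxK; apply: proj_ortho_id.
by apply/eigenspaceP; rewrite -trmx_mul Hv linearZ.
Qed.

Lemma mul_eigenproj n (H : 'M[C]_n) e : H *m eigenproj H e = e *: eigenproj H e.
Proof.
apply: trmx_inj; rewrite trmx_mul trmxK linearZ /= trmxK.
by apply/eigenspaceP; rewrite proj_orthoE.
Qed.

(** The range of [1 - P] is orthogonal to that of [P]; hence [P] is [P] times its own adjoint, which
    is self-adjoint. *)
Lemma orthoproj_eigenproj n (H : 'M[C]_n) e : orthoproj (eigenproj H e).
Proof.
set U := eigenspace H^T e.
have h : proj_ortho U *m (1%:M - proj_ortho U) ^t* = 0.
  apply/eqP; rewrite -orthomx1E orthomx_sym.
  have := proj_ortho_compl_sub U (1%:M : 'M[C]_n); rewrite mul1mx => /submx_trans; apply.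
  by rewrite submx_ortho proj_orthoE.
have Ph : (proj_ortho U) ^t* = proj_ortho U.
  have : proj_ortho U = proj_ortho U *m (proj_ortho U) ^t*.
    move: h; rewrite linearB /= map_mxB trmx1 map_mx1 mulmxBr mulmx1 => /eqP.
    by rewrite subr_eq0 => /eqP.
  move=> e1; rewrite e1 trmx_mul map_mxM trmxCK; exact: esym.
split; last by rewrite /eigenproj -trmx_mul proj_ortho_proj.
by rewrite /eigenproj -{2}Ph trmxK map_trmx trmxK.
Qed.

Variables (n : nat) (H : 'M[C]_n).
Hypothesis Hh : H ^t* = H.

Lemma eigvals_real e : e \in eigvals H -> e = Complex (complex.Re e) 0.
Proof.
have [_ _ _ sp] := hermitian_spectral Hh.
by rewrite mem_undup => /mapP[l _ ->]; rewrite {1}sp.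
Qed.

Lemma eigenproj_mul e : e \in eigvals H -> eigenproj H e *m H = e *: eigenproj H e.
Proof.
move=> eH; have [Eh _] := orthoproj_eigenproj H e.
rewrite -[LHS]trmxCK trmx_mul map_mxM Hh Eh mul_eigenproj linearZ /= map_mxZ Eh.
congr (_ *: _); rewrite -[LHS]/(e^* ) conjCE [in LHS](eigvals_real eH) /= oppr0.
exact/esym/eigvals_real.
Qed.

(** Tested on the orthonormal eigenbasis: a basis vector is fixed by the projection of its own
    eigenvalue, listed once in [eigvals], and killed by all others. *)
Lemma sum_eigenproj : \sum_(e <- eigvals H) eigenproj H e = 1%:M.
Proof.
have [UU UU' _ sp] := hermitian_spectral Hh.
set U := (spectralmx H) ^t* in UU UU'.
suff h : (\sum_(e <- eigvals H) eigenproj H e) *m U = U.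
  by rewrite -[LHS]mulmx1 -UU' mulmxA h.
suff hu l : (\sum_(e <- eigvals H) eigenproj H e) *m col l U = col l U.
  apply/matrixP => i l; set S := \sum_(e <- _) _ in hu *.
  have e : col l (S *m U) = col l U by rewrite colE -mulmxA -colE hu.
  by transitivity (col l (S *m U) i 0); [rewrite [RHS]mxE|rewrite e mxE].
set u := col l U.
have Hu : H *m u = spectral_diag H 0 l *: u by rewrite sp hermitian_eigvec.
rewrite mulmx_suml.
have lH : spectral_diag H 0 l \in eigvals H.
  by rewrite mem_undup; apply: map_f; rewrite mem_enum.
rewrite (bigD1_seq _ lH) /=; last exact: undup_uniq.
rewrite [X in X + _](_ : _ = u); last exact: eigenproj_id.
rewrite -[RHS]addr0; congr (_ + _).
rewrite big_seq_cond big1 //.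
move=> e /andP[eH ne]; apply/eqP.
have : eigenproj H e *m H *m u = spectral_diag H 0 l *: (eigenproj H e *m u).
  by rewrite -mulmxA Hu scalemxAr.
rewrite eigenproj_mul// -scalemxAl => /eqP.
by rewrite -subr_eq0 -scalerBl scaler_eq0 subr_eq0 (negbTE ne).
Qed.

Lemma mxtrace_coordproj_mul (Q : {pred 'I_n}) (A : 'M[C]_n) :
  \tr (coordproj Q *m A) = \sum_(j in Q) A j j.
Proof.
rewrite /mxtrace [RHS]big_mkcond; apply: eq_bigr => j _; rewrite mul_coordproj.
by case: ifP; rewrite ?mul1r ?mul0r.
Qed.

(** Cyclicity turns the trace into a sum over [B] of diagonal entries of [E P_A E], which are
    squared norms. *)
Lemma mxtrace_sandwich (A B : {pred 'I_n}) (E : 'M[C]_n) : orthoproj E ->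
  \tr (coordproj A *m E *m coordproj B *m E) =
  Complex (\sum_(j in B) n2 (coordproj A *m (E *m delta_mx j 0))) 0.
Proof.
move=> [Eh EE]; rewrite -mulmxA mxtrace_mulC -!mulmxA mxtrace_coordproj_mul.
rewrite (big_morph (fun x : R => Complex x 0 : C) (id1 := 0) (op1 := +%R)) //; last first.
  by move=> x y; rewrite -CompD.
apply: eq_bigr => j _; rewrite n2_orthoproj; last exact: orthoproj_coordproj.
rewrite trmx_mul map_mxM Eh trmx_delta map_delta_mx -!mulmxA -rowE.
rewrite !mulmxA -colE; set X := _ *m E; by rewrite [RHS]mxE [RHS]mxE.
Qed.

End eigenprojections.

(** * Macroscopic transition coefficients *)

Section macro_dynamics.
Context {R : realType}.
Local Notation C := R[i].
Variables (n : nat) (H : 'M[C]_n).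
Hypothesis Hh : H ^t* = H.

Lemma CompN (a : R) : - Complex a 0 = Complex (- a) 0 :> C.
Proof. by apply/eqP; rewrite eq_complex /= oppr0 !eqxx. Qed.

Lemma Comp_sum (I : Type) (r : seq I) (Q : pred I) (F : I -> R) :
  Complex (\sum_(i <- r | Q i) F i) 0 = \sum_(i <- r | Q i) Complex (F i) 0 :> C.
Proof. by apply: (big_morph (fun x : R => Complex x 0 : C)) => // x y; rewrite CompD. Qed.

Lemma Comp_nat (k : nat) : (k%:R : C) = Complex k%:R 0.
Proof. by elim: k => [//|k IH]; rewrite -natr1 -[in RHS]natr1 IH CompD. Qed.

Lemma Comp_natV (k : nat) : (k%:R : C)^-1 = Complex (k%:R)^-1 0.
Proof.
case: k => [|k]; first by rewrite !invr0.
have k0 : (k.+1%:R : C) != 0 by rewrite pnatr_eq0.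
by apply: (mulfI k0); rewrite mulfV// Comp_nat CompM mulfV ?pnatr_eq0.
Qed.

(* Since tr (P_A E P_B E) = sum_(j in B) |P_A E e_j|^2 and the E e_j are
   eigenvectors, the eigenvector bound on A transfers to the trace. *)
Lemma sum_mxtrace_sandwich_ge (A B : {pred 'I_n}) (delta : R) :
  (forall (e : C) (v : 'cV[C]_n), H *m v = e *: v -> delta * n2 v <= n2 (coordproj A *m v)) ->
  Complex (delta * #|B|%:R) 0 <= \sum_(e <- eigvals H)
    \tr (coordproj A *m eigenproj H e *m coordproj B *m eigenproj H e).
Proof.
move=> h; under eq_bigr => e _ do rewrite (mxtrace_sandwich _ _ (orthoproj_eigenproj H e)).
rewrite -Comp_sum lecR.
apply: (@le_trans _ _ (\sum_(e <- eigvals H) \sum_(j in B) delta * n2 (eigenproj H e *m delta_mx j 0))).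
  rewrite exchange_big /= -sum1_card natr_sum mulr_sumr; apply: ler_sum => j _.
  rewrite -mulr_sumr le_eqVlt; apply/orP; left; apply/eqP; congr (_ * _).
  have : Complex (\sum_(e <- eigvals H) n2 (eigenproj H e *m delta_mx j 0)) 0 = 1 :> C.
    rewrite Comp_sum.
    under eq_bigr => e _ do rewrite -(orthoproj_diag _ (orthoproj_eigenproj H e)).
    by rewrite -summxE sum_eigenproj// mxE eqxx.
  by case=> ->.
apply: ler_sum => e _; apply: ler_sum => j _; apply: h.
by rewrite mulmxA mul_eigenproj -scalemxAl.
Qed.

Lemma mxtrace_sandwichC (A B E : 'M[C]_n) : \tr (A *m E *m B *m E) = \tr (B *m E *m A *m E).
Proof. by rewrite -mulmxA mxtrace_mulC mulmxA. Qed.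

(** Cyclicity makes the trace symmetric in the two blocks, so the larger one can serve as the block
    seen by the eigenvectors. The size of the smaller one divided by [d mu] is the minimum. *)
Lemma M_mn_lower m (d : 'I_m -> nat) (mu nu : 'I_m) (delta : R) :
  (\sum_k d k)%N = n -> (0 < d mu)%N -> 0 <= delta ->
  (forall (e : C) (v : 'cV[C]_n), H *m v = e *: v ->
     delta * n2 v <= n2 (coordproj
       [pred i : 'I_n | in_block d (if (d nu <= d mu)%N then mu else nu) i] *m v)) ->
  Complex (delta * Num.min 1 ((d nu)%:R / (d mu)%:R)) 0 <= M_mn d H mu nu.
Proof.
move=> sd d0 delta0; rewrite /M_mn /M_B !macro_projE Comp_natV.
have dmu : 0 < (d mu)%:R :> R by rewrite ltr0n.
set S := \sum_(_ <- _) _.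
have main (x : R) : Complex (delta * x * (d mu)%:R) 0 <= S ->
    Complex (delta * x) 0 <= Complex (d mu)%:R^-1 0 * S.
  move=> xS; have -> : Complex (delta * x) 0 =
      Complex (d mu)%:R^-1 0 * Complex (delta * x * (d mu)%:R) 0 :> C.
    by rewrite CompM [in RHS]mulrC mulfK// gt_eqF.
  by apply: ler_wpM2l => //; rewrite ler0c invr_ge0 ltW.
case: leqP => le_d h; apply: main.
  rewrite (min_idPr _); last by rewrite ler_pdivrMr// mul1r ler_nat.
  rewrite -mulrA divfK ?gt_eqF// -(card_block nu sd).
  exact: sum_mxtrace_sandwich_ge.
rewrite (min_idPl _); last by rewrite ler_pdivlMr// mul1r ler_nat ltnW.
rewrite mulr1 -(card_block mu sd) /S.
under eq_bigr do rewrite mxtrace_sandwichC.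
exact: sum_mxtrace_sandwich_ge.
Qed.

(** Exceeds every squared gap between eigenvalues, as these are at most the Frobenius norm in
    modulus; the 1 keeps it positive when [H] is zero. *)
Definition commutator_bound : R := 1 + 4 * \sum_i \sum_j nsq (H i j).

(** A discrete heat flow for the double commutator with [H]. It damps the coherences between
    different eigenspaces without ever naming an eigenvalue, so each step depends measurably on
    [H]. *)
Fixpoint dephase (B : 'M[C]_n) (k : nat) : 'M[C]_n :=
  if k is k'.+1 then
    let X := dephase B k' in let Y := H *m X - X *m H in
    X - Complex commutator_bound^-1 0 *: (H *m Y - Y *m H)
  else B.

Definition dephase_rate (e f : C) : R :=
  1 - (complex.Re e - complex.Re f) ^+ 2 / commutator_bound.

Lemma commutator_bound_gt0 : 0 < commutator_bound.
Proof.
rewrite ltr_pwDl// mulr_ge0//; apply: sumr_ge0 => i _; apply: sumr_ge0 => j _.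
exact: nsq_ge0.
Qed.

Lemma commutator_sandwich (r e f : C) (E F B : 'M[C]_n) :
  H *m E = e *: E -> F *m H = f *: F ->
  H *m (r *: (E *m B *m F)) - (r *: (E *m B *m F)) *m H =
  (r * (e - f)) *: (E *m B *m F).
Proof.
move=> HE FH; rewrite -scalemxAr -scalemxAl -(mulmxA _ F H) FH !mulmxA HE.
by rewrite -!scalemxAl -scalemxAr !scalerA -scalerBl mulrBr.
Qed.

(** Each [Pi_e B Pi_f] is an eigenvector of the double commutator with eigenvalue [(e - f)^2], so a
    step multiplies it by [dephase_rate e f]. *)
Lemma dephaseE B k : dephase B k =
  \sum_(e <- eigvals H) \sum_(f <- eigvals H)
    Complex (dephase_rate e f ^+ k) 0 *: (eigenproj H e *m B *m eigenproj H f).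
Proof.
elim: k => [|k IH] /=.
  rewrite -[LHS]mul1mx -[LHS]mulmx1 -(sum_eigenproj Hh).
  rewrite mulmx_suml mulmx_suml; apply: eq_bigr => e _.
  rewrite mulmx_sumr; apply: eq_bigr => f _; by rewrite expr0 scale1r.
have comm (r : C -> C -> R) :
    let X := \sum_(e <- eigvals H) \sum_(f <- eigvals H)
      Complex (r e f) 0 *: (eigenproj H e *m B *m eigenproj H f) in
    H *m X - X *m H = \sum_(e <- eigvals H) \sum_(f <- eigvals H)
      Complex (r e f * (complex.Re e - complex.Re f)) 0 *: (eigenproj H e *m B *m eigenproj H f).
  rewrite /= mulmx_sumr mulmx_suml -sumrB big_seq [RHS]big_seq; apply: eq_bigr => e eH.
  rewrite mulmx_sumr mulmx_suml -sumrB big_seq [RHS]big_seq; apply: eq_bigr => f fH.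
  rewrite (commutator_sandwich _ _ (mul_eigenproj H e) (eigenproj_mul Hh fH)).
  have -> : e - f = Complex (complex.Re e - complex.Re f) 0.
    by rewrite {1}(eigvals_real Hh eH) {1}(eigvals_real Hh fH) CompN CompD.
  by rewrite CompM.
rewrite IH comm comm scaler_sumr -sumrB; apply: eq_bigr => e _.
rewrite scaler_sumr -sumrB; apply: eq_bigr => f _.
rewrite scalerA -scalerBl; congr (_ *: _).
by rewrite CompM CompN CompD exprS /dephase_rate; congr Complex; ring.
Qed.

Lemma n2_delta (l : 'I_n) : n2 (delta_mx l 0 : 'cV[C]_n) = 1.
Proof.
rewrite /n2 (bigD1 l)//= mxE !eqxx (nsq_bool true) big1 ?addr0// => j jl.
by rewrite mxE (negbTE jl) /= nsq0.
Qed.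

Lemma dephase_rate_lt1 e f : e \in eigvals H -> f \in eigvals H -> e != f ->
  0 <= dephase_rate e f < 1.
Proof.
move=> eH fH ef; have c0 := commutator_bound_gt0.
have Re_le g : g \in eigvals H -> `|complex.Re g| <= fro H.
  move=> gH; have [UU _ _ sp] := hermitian_spectral Hh.
  move: (gH); rewrite mem_undup => /mapP[l _ gl].
  have := hermitian_eigvec l Hh; set u := col l _ => Hu.
  have u1 : nv u = 1.
    by rewrite /nv /u colE n2_unitary// n2_delta sqrtr1.
  have := nv_mulmx_le H u; rewrite Hu nvZ_real u1 !mulr1.
  by rewrite gl sp.
have F0 := fro_ge0 H.
have F2 : fro H ^+ 2 = \sum_i \sum_j nsq (H i j).
  by rewrite sqr_sqrtr//; apply: sumr_ge0 => i _; apply: sumr_ge0 => j _; exact: nsq_ge0.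
have : (complex.Re e - complex.Re f) ^+ 2 <= 4 * fro H ^+ 2.
  have -> : 4 * fro H ^+ 2 = (fro H + fro H) ^+ 2 by ring.
  rewrite -[leLHS]ger0_norm ?sqr_ge0// normrX ler_sqr ?nnegrE ?addr_ge0//.
  by apply: le_trans (ler_normB _ _) _; apply: lerD; exact: Re_le.
rewrite F2 => le4.
have ne : complex.Re e - complex.Re f != 0.
  rewrite subr_eq0; apply: contra ef => /eqP h.
  by rewrite (eigvals_real Hh eH) (eigvals_real Hh fH) h.
rewrite /dephase_rate subr_ge0 ler_pdivrMr// mul1r gtrBl divr_gt0//; last by rewrite exprn_even_gt0.
by rewrite andbT /commutator_bound; apply: le_trans le4 _; rewrite lerDr.
Qed.

(** The rate is 1 for [e = f] and lies in [[0, 1)] otherwise, so only the diagonal blocks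
    survive. *)
Lemma dephase_cvg (A B : 'M[C]_n) :
  complex.Re (\tr (A *m dephase B k)) @[k --> \oo] -->
  complex.Re (\sum_(e <- eigvals H) \tr (A *m eigenproj H e *m B *m eigenproj H e)).
Proof.
pose t e f : C := \tr (A *m (eigenproj H e *m B *m eigenproj H f)).
have trE k : complex.Re (\tr (A *m dephase B k)) =
    \sum_(e <- eigvals H) \sum_(f <- eigvals H) dephase_rate e f ^+ k * complex.Re (t e f).
  rewrite dephaseE mulmx_sumr [\tr _]raddf_sum /= Re_sum; apply: eq_bigr => e _.
  rewrite mulmx_sumr [\tr _]raddf_sum /= Re_sum; apply: eq_bigr => f _.
  rewrite -scalemxAr mxtraceZ -/(t e f).
  by case: (t e f) => x y /=; rewrite mul0r subr0.
rewrite (_ : (fun k => _) = (fun k => \sum_(e <- eigvals H) \sum_(f <- eigvals H) dephase_rate e f ^+ k * complex.Re (t e f))); last exact/funext.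
have -> : complex.Re (\sum_(e <- eigvals H) \tr (A *m eigenproj H e *m B *m eigenproj H e)) =
    \sum_(e <- eigvals H) \sum_(f <- eigvals H) (e == f)%:R * complex.Re (t e f).
  rewrite Re_sum big_seq [RHS]big_seq; apply: eq_bigr => e eH.
  rewrite (bigD1_seq e) ?undup_uniq//= eqxx mul1r big1 ?addr0 /t ?mulmxA//.
  by move=> f; rewrite eq_sym => /negbTE ->; rewrite mul0r.
have cvs (g : C -> nat -> R) (l : C -> R) : (forall e, e \in eigvals H -> g e k @[k --> \oo] --> l e) ->
    \sum_(e <- eigvals H) g e k @[k --> \oo] --> \sum_(e <- eigvals H) l e.
  elim: (eigvals H) => [_|e s IH h].
    rewrite big_nil; under eq_fun do rewrite big_nil.
    exact: cvg_cst.
  rewrite big_cons; under eq_fun do rewrite big_cons.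
  apply: cvgD; first by apply: h; rewrite inE eqxx.
  by apply: IH => f fs; apply: h; rewrite inE fs orbT.

apply: (cvs) => e eH; apply: (cvs) => f fH.
apply: cvgMl.
have [->|ef] := eqVneq e f.
  rewrite /dephase_rate subrr expr0n /= mul0r subr0.
  by apply: cvg_near_cst; apply: nearW => k; rewrite expr1n.
apply: cvg_expr; have /andP[a b] := dephase_rate_lt1 eH fH ef.
by rewrite ger0_norm.
Qed.

End macro_dynamics.

(** * Nets *)

Section nets.
Context {R : realType}.

Lemma expR1_le4 : expR 1 <= 4 :> R.
Proof.
have h : expR (- (1 / 2)) >= 1 / 2 :> R.
  by apply: le_trans (expR_ge1Dx _); lra.
have e0 := @expR_gt0 R (1 / 2).
have h2 : expR (1 / 2) <= 2 :> R.
  have : expR (1 / 2) * expR (- (1 / 2)) = 1 :> R by rewrite -expRD subrr expR0.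
  nra.
have -> : (1 : R) = 1 / 2 + 1 / 2 by lra.
rewrite expRD; nra.
Qed.

Lemma geometric_expR_le (theta : R) k : 0 < theta <= 1 ->
  \sum_(m < k) expR (- (theta * m%:R)) <= 2 / theta.
Proof.
move=> /andP[t0 t1]; set r := expR (- theta).
have rle : r <= 1 - theta / 2.
  have h := expR_ge1Dx theta.
  have e0 := @expR_gt0 R theta.
  have re : r * expR theta = 1 by rewrite -expRD addNr expR0.
  have r0 : 0 < r by exact: expR_gt0.
  have : r * (1 + theta) <= 1 by rewrite -[leRHS]re; apply: ler_wpM2l; [exact: ltW|exact: h].
  nra.
have -> : \sum_(m < k) expR (- (theta * m%:R)) = \sum_(m < k) r ^+ m.
  by apply: eq_bigr => m _; rewrite /r -expRM_natl; congr expR; ring.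
have := subrX1 r k; set S := \sum_(m < k) _ => e.
have rk : 0 <= r ^+ k by rewrite exprn_ge0// expR_ge0.
rewrite ler_pdivlMr//.
have S0 : 0 <= S by apply: sumr_ge0 => i _; rewrite exprn_ge0// expR_ge0.
nra.
Qed.

(* Lattice points of step theta / sqrt |T|, obtained by rounding coordinates
   towards 0, so that the l1-norm of the integer vector is at most |T| / theta;
   they are counted with the generating function of exp (- theta * l1-norm). *)
Lemma real_net (T : finType) (theta : R) : 0 < theta <= 1 ->
  exists Z : seq (T -> R), (size Z)%:R <= (16 / theta) ^+ #|T| /\
    forall c : T -> R, \sum_i c i ^+ 2 <= 1 ->
      exists z : T -> R, [/\ List.In z Z, \sum_i (c i - z i) ^+ 2 <= theta ^+ 2 & \sum_i z i ^+ 2 <= 1].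
Proof.
move=> t01; have /andP[t0 t1] := t01.
have [T0|Tgt] := posnP #|T|.
  exists [:: fun=> 0]; split; first by rewrite T0 expr0.
  move=> c _; exists (fun=> 0); have noT (i : T) : False by have := fintype0 i; apply.
  by split; [left|rewrite big1 ?sqr_ge0// => i; case: (noT i)|rewrite big1 ?ler01// => i; case: (noT i)].
set n := #|T| in Tgt *.
have n0 : 0 < n%:R :> R by rewrite ltr0n.
have sn0 : 0 < Num.sqrt n%:R :> R by rewrite sqrtr_gt0.
pose h : R := theta / Num.sqrt n%:R.
have h0 : 0 < h by rewrite divr_gt0.
pose M := Num.truncn (h^-1).
pose val (p : bool * 'I_M.+1) : R := (-1) ^+ p.1 * (p.2%:R * h).
pose good : pred {ffun T -> bool * 'I_M.+1} := fun f => (\sum_i (f i).2%:R : R) <= n%:R / theta.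
pose pt (f : {ffun T -> bool * 'I_M.+1}) : T -> R := fun i => val (f i).
exists (map pt (enum good)); split.
  rewrite size_map -cardE -sum1_card natr_sum.
  (* Rankin's trick: a good point has weight [exp (n - theta * l1-norm)] at least 1, and the sum of
     the weights over all points factors over the coordinates. *)
  apply: (@le_trans _ _ (\sum_(f : {ffun T -> bool * 'I_M.+1})
      expR n%:R * \prod_i expR (- (theta * (f i).2%:R)))).
    rewrite [leLHS]big_mkcond; apply: ler_sum => f _.
    have e0 : 0 <= expR n%:R * \prod_i expR (- (theta * (f i).2%:R)) :> R.
      by rewrite mulr_ge0 ?expR_ge0// prodr_ge0// => i _; exact: expR_ge0.
    case: ifP => // gf.
    rewrite -expR_sum -expRD -[leLHS]expR0 ler_expR sumrN -mulr_sumr subr_ge0.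
    by move: gf; rewrite unfold_in /good ler_pdivlMr// mulrC.
  rewrite -mulr_sumr -(bigA_distr_bigA (fun i (p : bool * 'I_M.+1) => expR (- (theta * p.2%:R)))).
  rewrite prodr_const -/n -[n%:R]mulr1 expRM_natl -exprMn.
  apply: lerXn2r; rewrite ?nnegrE ?mulr_ge0 ?expR_ge0 ?invr_ge0 ?(ltW t0)//.
    by apply: sumr_ge0 => p _; exact: expR_ge0.
  have -> : \sum_(p : bool * 'I_M.+1) expR (- (theta * p.2%:R)) =
      \sum_(b : bool) \sum_(m < M.+1) expR (- (theta * m%:R)).
    by rewrite (pair_big predT predT (fun (b : bool) (m : 'I_M.+1) => expR (- (theta * m%:R)))).
  rewrite sumr_const card_bool.
  have g := geometric_expR_le M.+1 t01.
  have E0 : 0 <= \sum_(m < M.+1) expR (- (theta * m%:R)).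
    by apply: sumr_ge0 => p _; exact: expR_ge0.
  (* Per coordinate: [e <= 4], two signs, and a geometric sum of at most [2 / theta]. *)
  have -> : 16 / theta = 4 * ((2 / theta) *+ 2) by field; rewrite gt_eqF.
  apply: ler_pM; rewrite ?expR_ge0 ?mulrn_wge0//; first exact: expR1_le4.
  by rewrite lerMn2r g orbT.
move=> c c1.
have cle i : `|c i| <= 1.
  rewrite -(ler_pXn2r (n := 2)) ?nnegrE// expr1n real_normK ?num_real//.
  by apply: le_trans c1; rewrite (bigD1 i)//= lerDl sumr_ge0// => j _; exact: sqr_ge0.
have trB i : (Num.truncn (`|c i| / h) < M.+1)%N.
  by rewrite ltnS; apply: le_truncn; rewrite ler_pdivrMr// mulVf ?gt_eqF.
pose f := [ffun i => (c i < 0, Ordinal (trB i))].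
have fE i : val (f i) = (-1) ^+ (c i < 0)%R * ((Num.truncn (`|c i| / h))%:R * h).
  by rewrite /f ffunE.
have tle i : (Num.truncn (`|c i| / h))%:R * h <= `|c i|.
  by rewrite -ler_pdivlMr//; rewrite truncn_le divr_ge0// ltW.
have tge i : `|c i| < ((Num.truncn (`|c i| / h))%:R + 1) * h.
  by rewrite -ltr_pdivrMr// natr1; exact: truncnS_gt.
have t_ge0 i : 0 <= (Num.truncn (`|c i| / h))%:R * h by rewrite mulr_ge0// ltW.
have cE i : c i = (-1) ^+ (c i < 0)%R * `|c i|.
  by rewrite -realEsign ?num_real.
exists (pt f); split.
- apply/List.in_map_iff; exists f; split => //.
  suff : f \in enum good.
    by elim: (enum _) => // g s IH; rewrite inE => /orP[/eqP <-|/IH]; [left|right].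
  rewrite mem_enum unfold_in /good.
  apply: (@le_trans _ _ (\sum_i `|c i| / h)).
    by apply: ler_sum => i _; rewrite /f ffunE /= ler_pdivlMr// .
  rewrite -mulr_suml.
  have cs : \sum_i `|c i| <= Num.sqrt n%:R.
    set s := Num.sqrt n%:R in sn0 *.
    have ss : s * s = n%:R by rewrite -expr2 sqr_sqrtr// ltW.
    (* The arithmetic-geometric mean inequality in the role of Cauchy-Schwarz; each of the two
       summands contributes at most [s / 2] in total. *)
    apply: (@le_trans _ _ (\sum_i (s * c i ^+ 2 + s^-1) / 2)).
      apply: ler_sum => i _; rewrite -[c i ^+ 2]real_normK ?num_real//.
      have : 0 <= s * (`|c i| - s^-1) ^+ 2 by rewrite mulr_ge0 ?sqr_ge0// ltW.
      have -> : s * (`|c i| - s^-1) ^+ 2 = s * `|c i| ^+ 2 - 2 * `|c i| + s^-1.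
        by field; rewrite gt_eqF.
      lra.
    rewrite -mulr_suml big_split /= -mulr_sumr sumr_const -/n.
    have -> : s^-1 *+ n = s by rewrite -[LHS]mulr_natr -ss mulKf// gt_eqF.
    rewrite ler_pdivrMr// mulr_natr mulr2n lerD2r.
    by rewrite ger_pMr.
  apply: (@le_trans _ _ (Num.sqrt n%:R / h)); first by rewrite ler_pM2r ?invr_gt0.
  rewrite /h invf_div mulrA -expr2 sqr_sqrtr// ltW//.
- apply: (@le_trans _ _ (\sum_(i : T) h ^+ 2)).
    apply: ler_sum => i _; rewrite /pt fE {1}[c i]cE -mulrBr exprMn sqrr_sign mul1r.
    by apply: lerXn2r; rewrite ?nnegrE ?subr_ge0 ?(ltW h0)// lerBlDl; have := tge i; lra.
  rewrite sumr_const -/n /h expr_div_n sqr_sqrtr ?(ltW n0)//.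
  by rewrite -[leLHS]mulr_natr divfK// gt_eqF.
- apply: le_trans c1; apply: ler_sum => i _.
  rewrite /pt fE exprMn sqrr_sign mul1r [in leRHS]cE [leRHS]exprMn sqrr_sign mul1r.
  by apply: lerXn2r; rewrite ?nnegrE.
Qed.

Lemma complex_net (L : finType) (theta : R) : 0 < theta <= 1 ->
  exists Z : seq (L -> R[i]), (size Z)%:R <= (16 / theta) ^+ (2 * #|L|) /\
    forall c : L -> R[i], \sum_l nsq (c l) <= 1 ->
      exists z : L -> R[i], [/\ List.In z Z, \sum_l nsq (c l - z l) <= theta ^+ 2 &
        \sum_l nsq (z l) <= 1].
Proof.
move=> t01; have [Z [sZ hZ]] := @real_net (L * bool)%type theta t01.
pose cplx (z : L * bool -> R) (l : L) : R[i] := Complex (z (l, false)) (z (l, true)).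
exists (map cplx Z); split; first by rewrite size_map; move: sZ; rewrite card_prod card_bool mulnC.
have sumE (z : L * bool -> R) : \sum_p z p ^+ 2 = \sum_l nsq (cplx z l).
  transitivity (\sum_(p : L * bool) z (p.1, p.2) ^+ 2); first by apply: eq_bigr => -[].
  rewrite -(pair_bigA _ (fun l b => z (l, b) ^+ 2)) /=.
  apply: eq_bigr => l _; rewrite big_bool /= /nsq /= addrC //.
move=> c c1.
pose c' (p : L * bool) : R := if p.2 then complex.Im (c p.1) else complex.Re (c p.1).
have cE l : cplx c' l = c l by rewrite /cplx /c' /=; case: (c l).
have [|z [zZ cz z1]] := hZ c'.
  by rewrite sumE; under eq_bigr do rewrite cE.
exists (cplx z); split; [exact: List.in_map| |by rewrite -sumE].
rewrite sumE in cz; apply: le_trans cz; rewrite le_eqVlt; apply/orP; left; apply/eqP.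
by apply: eq_bigr => l _; rewrite -cE.
Qed.

End nets.

(** * Measurability of complex vectors and matrices *)

Section complex_measurability.
Context {R : realType} {d} {T : measurableType d}.
Local Notation C := R[i].

Lemma measurable_set_lt (f g : T -> R) : measurable_fun setT f -> measurable_fun setT g ->
  measurable [set x | f x < g x].
Proof.
move=> mf mg; have mh : measurable_fun setT (fun x => g x - f x) by exact: measurable_funB.
rewrite (_ : [set _ | _] = setT `&` (fun x => g x - f x) @^-1` `]0, +oo[).
  by apply: mh => //; exact: measurable_itv.
by rewrite setTI; apply/seteqP; split => x /=; rewrite in_itv /= andbT subr_gt0.
Qed.

Lemma measurable_set_le (f g : T -> R) : measurable_fun setT f -> measurable_fun setT g ->
  measurable [set x | f x <= g x].
Proof.
move=> mf mg; rewrite (_ : [set _ | _] = ~` [set x | g x < f x]).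
  by apply: measurableC; exact: measurable_set_lt.
by apply/seteqP; split => x /=; rewrite leNgt => /negP.
Qed.

Lemma measurable_sqrt : measurable_fun [set: R] (@Num.sqrt R).
Proof. by apply: continuous_measurable_fun; exact: sqrt_continuous. Qed.

Definition cmeasurable (f : T -> C) : Prop :=
  measurable_fun setT (fun x => complex.Re (f x)) /\
  measurable_fun setT (fun x => complex.Im (f x)).

Lemma cmeasurable_cst (c : C) : cmeasurable (fun=> c).
Proof. by split; exact: measurable_cst. Qed.

Lemma cmeasurable_real (f : T -> R) : measurable_fun setT f ->
  cmeasurable (fun x => Complex (f x) 0).
Proof. by move=> mf; split => //; exact: measurable_cst. Qed.

Lemma cmeasurableD (f g : T -> C) : cmeasurable f -> cmeasurable g ->
  cmeasurable (fun x => f x + g x).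
Proof.
move=> [a b] [a' b']; split.
  by under eq_fun do rewrite ReD; exact: measurable_funD.
by under eq_fun do rewrite ImD; exact: measurable_funD.
Qed.

Lemma cmeasurableM (f g : T -> C) : cmeasurable f -> cmeasurable g ->
  cmeasurable (fun x => f x * g x).
Proof.
move=> [a b] [a' b']; split.
  rewrite (_ : (fun _ => _) = (fun x => complex.Re (f x) * complex.Re (g x) -
    complex.Im (f x) * complex.Im (g x))).
    by apply: measurable_funB; exact: measurable_funM.
  by apply/funext => x; case: (f x) (g x) => ? ? [].
rewrite (_ : (fun _ => _) = (fun x => complex.Re (f x) * complex.Im (g x) +
    complex.Im (f x) * complex.Re (g x))).
  by apply: measurable_funD; exact: measurable_funM.
by apply/funext => x; case: (f x) (g x) => ? ? [].
Qed.

Lemma cmeasurable_conj (f : T -> C) : cmeasurable f -> cmeasurable (fun x => (f x)^*).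
Proof.
move=> [a b]; split.
  by under eq_fun do rewrite conjCE.
by under eq_fun do rewrite conjCE; exact: measurableT_comp.
Qed.

Lemma cmeasurable_sum (I : Type) (r : seq I) (Q : pred I) (f : I -> T -> C) :
  (forall i, cmeasurable (f i)) -> cmeasurable (fun x => \sum_(i <- r | Q i) f i x).
Proof.
move=> mf; elim: r => [|i r IH].
  by under eq_fun do rewrite big_nil; exact: cmeasurable_cst.
under eq_fun do rewrite big_cons.
by case: (Q i) => //; exact: cmeasurableD.
Qed.

Lemma measurable_nsq (f : T -> C) : cmeasurable f -> measurable_fun setT (fun x => nsq (f x)).
Proof. by move=> [a b]; apply: measurable_funD; exact: measurable_funX. Qed.

Definition mxmeasurable m n (M : T -> 'M[C]_(m, n)) : Prop :=
  forall i j, cmeasurable (fun x => M x i j).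

Lemma mxmeasurable_cst m n (M : 'M[C]_(m, n)) : mxmeasurable (fun=> M).
Proof. by move=> i j; exact: cmeasurable_cst. Qed.

Lemma mxmeasurableD m n (M N : T -> 'M[C]_(m, n)) : mxmeasurable M -> mxmeasurable N ->
  mxmeasurable (fun x => M x + N x).
Proof. by move=> mM mN i j; under eq_fun do rewrite mxE; exact: cmeasurableD. Qed.

Lemma mxmeasurableZ m n (f : T -> C) (N : T -> 'M[C]_(m, n)) : cmeasurable f -> mxmeasurable N ->
  mxmeasurable (fun x => f x *: N x).
Proof. by move=> mM mN i j; under eq_fun do rewrite mxE; exact: cmeasurableM. Qed.

Lemma mxmeasurableN m n (N : T -> 'M[C]_(m, n)) : mxmeasurable N ->
  mxmeasurable (fun x => - N x).
Proof.
move=> mN; under eq_fun do rewrite -scaleN1r.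
by apply: mxmeasurableZ => //; exact: cmeasurable_cst.
Qed.

Lemma mxmeasurableB m n (M N : T -> 'M[C]_(m, n)) : mxmeasurable M -> mxmeasurable N ->
  mxmeasurable (fun x => M x - N x).
Proof. by move=> mM mN; apply: mxmeasurableD => //; exact: mxmeasurableN. Qed.

Lemma mxmeasurableM m n p (M : T -> 'M[C]_(m, n)) (N : T -> 'M[C]_(n, p)) :
  mxmeasurable M -> mxmeasurable N -> mxmeasurable (fun x => M x *m N x).
Proof.
move=> mM mN i j; under eq_fun do rewrite mxE.
by apply: cmeasurable_sum => k; exact: cmeasurableM.
Qed.

Lemma mxmeasurable_mxtrace n (M : T -> 'M[C]_n) : mxmeasurable M -> cmeasurable (fun x => \tr (M x)).
Proof. by move=> mM; exact: cmeasurable_sum. Qed.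

Lemma measurable_n2 n (v : T -> 'cV[C]_n) : mxmeasurable v -> measurable_fun setT (fun x => n2 (v x)).
Proof. by move=> mv; apply: measurable_sum => i; exact: measurable_nsq. Qed.

Lemma measurable_nv n (v : T -> 'cV[C]_n) : mxmeasurable v -> measurable_fun setT (fun x => nv (v x)).
Proof. by move=> mv; apply: measurableT_comp measurable_sqrt _; exact: measurable_n2. Qed.

Definition ratvec n (q : {ffun 'I_n -> rat * rat}) : 'cV[C]_n :=
  \col_i Complex (ratr (q i).1) (ratr (q i).2).

Lemma ratvec_dense n (u : 'cV[C]_n) (e : R) : 0 < e -> exists q, nv (u - ratvec q) < e.
Proof.
move=> e0; pose eta := e / (2 * n.+1%:R).
have eta0 : 0 < eta by rewrite divr_gt0// mulr_gt0.
have appr (x : R) : exists q : rat, (x - ratr q) ^+ 2 <= eta ^+ 2.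
  have [|q] := @rat_in_itvoo R (x - eta) (x + eta); first by lra.
  rewrite in_itv /= => /andP[h1 h2]; exists q.
  by rewrite -(real_normK (num_real (x - _))) lerXn2r ?nnegrE ?(ltW eta0)// ler_norml; apply/andP; split; lra.
have /choice[q hq] (i : 'I_n) : exists q : rat * rat,
    nsq (u i 0 - Complex (ratr q.1) (ratr q.2)) <= 2 * eta ^+ 2.
  have [a ha] := appr (complex.Re (u i 0)); have [b hb] := appr (complex.Im (u i 0)).
  exists (a, b) => /=; move: ha hb; case: (u i 0) => x y /=; rewrite /nsq /=; lra.
exists (finfun q); rewrite -[e]gtr0_norm// -sqrtr_sqr ltr_sqrt ?exprn_gt0//.
apply: (@le_lt_trans _ _ (\sum_(i < n) 2 * eta ^+ 2)).
  by apply: ler_sum => i _; rewrite !mxE ffunE; exact: hq.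
rewrite sumr_const card_ord -[ltLHS]mulr_natr /eta expr_div_n exprMn.
have n1 : 1 <= n.+1%:R :> R by rewrite ler1n.
have -> : n%:R = n.+1%:R - 1 :> R by rewrite -natr1 addrK.
move: (n.+1%:R : R) n1 => x x1.
have x0 : 0 < x by apply: lt_le_trans x1.
have -> : 2 * (e ^+ 2 / (2 ^+ 2 * x ^+ 2)) * (x - 1) = e ^+ 2 * ((x - 1) / (2 * x ^+ 2)).
  by field; rewrite gt_eqF.
rewrite gtr_pMr ?exprn_gt0// ltr_pdivrMr ?mulr_gt0 ?exprn_gt0// mul1r.
nra.
Qed.

Lemma nv_sub_le n (u v : 'cV[C]_n) : nv u <= nv v + nv (u - v).
Proof. by rewrite -{1}(subrK v u) addrC nvD_le. Qed.

Lemma nvBC n (u v : 'cV[C]_n) : nv (u - v) = nv (v - u).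
Proof. by rewrite -nvN opprB. Qed.

(* By Lipschitz continuity in [u], rational vectors suffice. *)
Lemma measurable_exists_nv_lt m n p (M : T -> 'M[C]_(m, n)) (b : T -> 'cV[C]_m)
    (N : 'M[C]_(p, n)) (beta t : R) : mxmeasurable M -> mxmeasurable b -> 0 <= beta ->
  measurable [set x | exists u : 'cV[C]_n, nv (M x *m u + b x) < beta * nv (N *m u) + t].
Proof.
move=> mM mb beta0.
pose A q := [set x | nv (M x *m ratvec q + b x) < beta * nv (N *m (ratvec q : 'cV_n)) + t].
rewrite (_ : [set _ | _] = \bigcup_q A q).
  apply: countable_bigcupT_measurable => [|q]; first exact: countableP.
  apply: measurable_set_lt.
    apply: measurable_nv; apply: mxmeasurableD => //.
    by apply: mxmeasurableM => //; exact: mxmeasurable_cst.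
  exact: measurable_cst.
apply/seteqP; split => x; last by move=> [q _ h]; exists (ratvec q).
move=> [u hu] /=.
set gap := beta * nv (N *m u) + t - nv (M x *m u + b x).
have gap0 : 0 < gap by rewrite subr_gt0.
(* [K] exceeds the Lipschitz constant in [u] of the difference of the two sides; the 1 makes it
   positive. The strict inequality leaves the room [gap] for moving to a rational vector. *)
pose K := 1 + fro (M x) + beta * fro N.
have K0 : 0 < K by rewrite /K -addrA ltr_pwDl// addr_ge0 ?mulr_ge0 ?fro_ge0.
have [q hq] := ratvec_dense u (divr_gt0 gap0 K0).
exists q => //=; rewrite /A /=.
have e0 := nv_ge0 (u - ratvec q).
have h1 : nv (M x *m ratvec q + b x) <= nv (M x *m u + b x) + fro (M x) * nv (u - ratvec q).
  apply: le_trans (nv_sub_le _ (M x *m u + b x)) _; rewrite lerD2l nvBC.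
  rewrite opprD addrACA subrr addr0 -mulmxBr; exact: nv_mulmx_le.
have h2 : nv (N *m u) <= nv (N *m ratvec q) + fro N * nv (u - ratvec q).
  apply: le_trans (nv_sub_le _ (N *m ratvec q)) _; rewrite lerD2l.
  by rewrite -mulmxBr; exact: nv_mulmx_le.
have h3 := ler_wpM2l beta0 h2.
have h4 : (fro (M x) + beta * fro N) * nv (u - ratvec q) < gap.
  move: hq; rewrite ltr_pdivlMr// mulrC => hq; apply: le_lt_trans hq.
  by apply: ler_wpM2r => //; rewrite /K -addrA lerDr.
move: h4; rewrite /gap; lra.
Qed.

End complex_measurability.

(** * Small-ball estimates *)

Section gaussian_entries.
Context {R : realType} {D : nat}.
Local Notation C := R[i].
Local Notation pos := ('I_D * 'I_D)%type.
Local Notation I := (('I_D * 'I_D) * bool)%type.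
Local Notation state := (state R I).

Definition entry (p : pos) (x : state) : C := Complex (x (p, false)) (x (p, true)).

Lemma cmeasurable_entry (p : pos) : cmeasurable (fun x : state => entry p x).
Proof. by split; exact: measurable_coord. Qed.

Definition coordset (S : {set pos}) : {set I} := [set k | k.1 \in S]%SET.

Lemma entry_mix (S : {set pos}) (p : pos) (y x : state) :
  entry p (mix (coordset S) y x) = if p \in S then entry p x else entry p y.
Proof. by rewrite /entry /mix !inE /=; case: ifP. Qed.

Context {d : measure_display} {T : measurableType d} {P : probability T R}
  (X : I -> {RV P >-> R}) (sigma : 'I_D -> 'I_D -> R).
Hypothesis indX : mutually_independent X.
Hypothesis sigma_gt0 : forall i j, 0 < sigma i j.
Hypothesis normalX : forall i j (b : bool), is_normal0 (X (i, j, b)) (sigma i j / Num.sqrt 2).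

Lemma integral_cst_probability (c : R) : (\int[P]_t c%:E = c%:E)%E.
Proof. by rewrite integral_cst// -[RHS]mule1; congr (_ * _)%E; exact: probability_setT. Qed.

Lemma sqr_half_variance (s : R) : (s / Num.sqrt 2) ^+ 2 = s ^+ 2 / 2.
Proof. by rewrite expr_div_n sqr_sqrtr. Qed.

(** An independent Gaussian summand widens a Gaussian weight: [B] grows by [sigma^2 |u|^2] and the
    peak falls by the ratio of the widths. The halved variance of each real part makes the increment
    exactly this. *)
Lemma expectation_entry_le (p : pos) (u w : C) (B : R) : 0 < B ->
  (\int[P]_t (expR (- (nsq (entry p (X^~ t) * u + w) / B)))%:E <=
  (B / (B + sigma p.1 p.2 ^+ 2 * nsq u) *
    expR (- (nsq w / (B + sigma p.1 p.2 ^+ 2 * nsq u))))%:E)%E.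
Proof.
move=> B0; have [->|u0] := eqVneq u 0.
  rewrite nsq0 mulr0 addr0 divff ?gt_eqF// mul1r.
  under eq_integral do rewrite mulr0 add0r.
  by rewrite integral_cst_probability.
have nu0 : 0 < nsq u by rewrite lt_def nsq_ge0 nsq_eq0 u0.
case: p => i j /=; set s := sigma i j.
have s0 : 0 < s / Num.sqrt 2 by apply: divr_gt0; [exact: sigma_gt0|rewrite sqrtr_gt0].
pose g := nsq u / B; pose c := w / u.
have g0 : 0 <= g by rewrite divr_ge0 ?nsq_ge0// ltW.
have kl : ((i, j), false) != ((i, j), true) :> I by rewrite xpair_eqE andbF.
have := @integral_expRNsqr_pair_le R I d T P X indX _ _ _ g (complex.Re c) (complex.Im c) kl s0 g0
  (normalX _ _ _) (normalX _ _ _).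
rewrite sqr_half_variance -/s -/(nsq c).
have -> : 2 * g * (s ^+ 2 / 2) = g * s ^+ 2 by field.
have den : 1 + g * s ^+ 2 = (B + s ^+ 2 * nsq u) / B by rewrite /g; field; rewrite gt_eqF.
have ss : 0 <= s ^+ 2 * nsq u by rewrite mulr_ge0 ?sqr_ge0 ?nsq_ge0.
have den0 : 0 < B + s ^+ 2 * nsq u by rewrite ltr_pwDl.
have cw : nsq c = nsq w / nsq u.
  by apply: (mulIf (lt0r_neq0 nu0)); rewrite -nsqM divfK// divfK// gt_eqF.
have -> : g * nsq c / (1 + g * s ^+ 2) = nsq w / (B + s ^+ 2 * nsq u).
  by rewrite den cw /g; field; rewrite !gt_eqF.
have -> : (1 + g * s ^+ 2)^-1 = B / (B + s ^+ 2 * nsq u) by rewrite den invf_div.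
apply: le_trans; rewrite le_eqVlt; apply/orP; left; apply/eqP.
apply: eq_integral => t _; congr (expR (- _))%:E.
rewrite /g mulrAC; congr (_ / _).
have -> : entry (i, j) (X^~ t) * u + w = u * (entry (i, j) (X^~ t) + c).
  by rewrite mulrDr mulrC /c mulrCA divff// mulr1.
by rewrite nsqM; congr (_ * _); rewrite /nsq ReD ImD.
Qed.

Lemma expR_le1_integral (f : T -> R) : measurable_fun setT f -> (forall t, 0 <= f t) ->
  (\int[P]_t (expR (- f t))%:E <= 1)%E.
Proof.
move=> mf f0; apply: (@le_trans _ _ (\int[P]_t 1%:E)%E).
  apply: ge0_le_integral => //.
  - by apply/measurable_EFinP; apply: measurableT_comp => //; exact: measurableT_comp.
  - by move=> t _; rewrite lee_fin -expR0 ler_expR oppr_le0.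
by rewrite integral_cst_probability.
Qed.

(* One complex coordinate is integrated out at a time; this widens the
   variance [B] of its row. *)
Lemma expectation_rows_le (l : seq pos) (u : pos -> C) (c : 'I_D -> C) (B : 'I_D -> R) :
  uniq l -> (forall r, 0 < B r) ->
  (\int[P]_t (expR (- (\sum_r nsq (\sum_(p <- l | p.1 == r) entry p (X^~ t) * u p + c r) / B r)))%:E <=
   (\prod_r (B r / (B r + \sum_(p <- l | p.1 == r) sigma p.1 p.2 ^+ 2 * nsq (u p))))%:E)%E.
Proof.
elim: l B => [|p l IH] B /= => [_ B0|/andP[pl ul] B0].
  under eq_integral do under eq_bigr do rewrite big_nil add0r.
  rewrite [X in (_ <= X%:E)%E]big1 => [|r _]; last by rewrite big_nil addr0 divff// gt_eqF.
  apply: expR_le1_integral => //.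
  by move=> t; apply: sumr_ge0 => r _; rewrite divr_ge0 ?nsq_ge0// ltW.
pose w r (x : state) := \sum_(p <- l | p.1 == r) entry p x * u p + c r.
pose F (x : state) := expR (- (\sum_r nsq ((if p.1 == r then entry p x * u p else 0) + w r x) / B r)).
pose B' r := if p.1 == r then B r + sigma p.1 p.2 ^+ 2 * nsq (u p) else B r.
have B'0 r : 0 < B' r.
  rewrite /B'; case: ifP => // _; rewrite ltr_pwDl//.
  by apply: mulr_ge0; [exact: sqr_ge0|exact: nsq_ge0].
pose F' (x : state) := expR (- (\sum_r nsq (w r x) / B' r)).
have mw r : cmeasurable (w r).
  apply: cmeasurableD; last exact: cmeasurable_cst.
  apply: cmeasurable_sum => p'; apply: cmeasurableM; first exact: cmeasurable_entry.
  exact: cmeasurable_cst.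
have mF : measurable_fun setT F.
  apply: measurableT_comp => //; apply: measurableT_comp => //.
  apply: measurable_sum => r; apply: measurable_funM => //; apply: measurable_nsq.
  apply: cmeasurableD => //; case: (p.1 == r); last exact: cmeasurable_cst.
  by apply: cmeasurableM; [exact: cmeasurable_entry|exact: cmeasurable_cst].
have mF' : measurable_fun setT F'.
  apply: measurableT_comp => //; apply: measurableT_comp => //.
  by apply: measurable_sum => r; apply: measurable_funM => //; apply: measurable_nsq.
set r0 := p.1; pose k := B r0 / B' r0.
have k0 : 0 <= k by rewrite divr_ge0// ltW.
(* As [p] is not in [l], the rest of the sum does not see the resampled entry. *)
have w_mix r y x : w r (mix (coordset [set p]%SET) y x) = w r y.
  rewrite /w; congr (_ + _); rewrite big_seq_cond [RHS]big_seq_cond; apply: eq_bigr => p' /andP[p'l _].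
  rewrite entry_mix inE; case: eqP => // p'p; by move: pl; rewrite -p'p p'l.
have step := @resampling_le R I d T P X indX (coordset [set p]%SET) F F' k mF
  (fun=> expR_ge0 _) mF' (fun=> expR_ge0 _) k0.
have -> : (\int[P]_t (expR (- (\sum_r nsq (\sum_(p0 <- p :: l | p0.1 == r)
    entry p0 (X^~ t) * u p0 + c r) / B r)))%:E = \int[P]_t (F (X^~ t))%:E)%E.
  apply: eq_integral => t _; congr (expR (- _))%:E; apply: eq_bigr => r _.
  by rewrite big_cons; case: ifP => _; rewrite /w ?add0r// addrA.
apply: (@le_trans _ _ (k%:E * \int[P]_t (F' (X^~ t))%:E)%E).
  apply: step => y; pose G := expR (- (\sum_(r | r != r0) nsq (w r y) / B r)).
  have FE x : F (mix (coordset [set p]%SET) y x) = G * expR (- (nsq (entry p x * u p + w r0 y) / B r0)).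
    rewrite /F (bigD1 r0) //.
    rewrite w_mix eqxx entry_mix inE eqxx.
    rewrite opprD expRD mulrC.
    congr (expR (- _) * _).
    apply: eq_bigr => r rr; rewrite w_mix eq_sym (negbTE rr) add0r//.
  under eq_integral do rewrite FE EFinM.
  rewrite ge0_integralZl//; last 2 first.
  - apply/measurable_EFinP; apply: measurableT_comp => //; apply: measurableT_comp => //.
    apply: measurable_funM => //; apply: measurable_nsq; apply: cmeasurableD; last exact: cmeasurable_cst.
    by apply: cmeasurableM; [split; exact: measurable_funPT|exact: cmeasurable_cst].
  - by rewrite lee_fin expR_ge0.
  apply: (@le_trans _ _ (G%:E * (B r0 / B' r0 * expR (- (nsq (w r0 y) / B' r0)))%:E)%E).
    apply: lee_wpmul2l; first by rewrite lee_fin expR_ge0.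
    by have := expectation_entry_le p (u p) (w r0 y) (B0 r0); rewrite /B' eqxx.
  rewrite -EFinM lee_fin mulrCA /F' (bigD1 r0)//= opprD expRD -/k [expR _ * expR _]mulrC.
  rewrite le_eqVlt; apply/orP; left; apply/eqP; congr (_ * (expR (- _) * _)).
  by apply: eq_bigr => r rr; rewrite /B' eq_sym (negbTE rr).
have := IH B' ul B'0 => /(lee_wpmul2l (x := k%:E)); rewrite lee_fin => /(_ k0) /le_trans; apply.
rewrite -EFinM lee_fin (bigD1 r0)//= [leRHS](bigD1 r0)//= mulrA.
rewrite le_eqVlt; apply/orP; left; apply/eqP; congr (_ * _).
  have e : B r0 + sigma p.1 p.2 ^+ 2 * nsq (u p) = B' r0 by rewrite /B' eqxx.
  by rewrite big_cons eqxx addrA e /k mulrA divfK// gt_eqF.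
by apply: eq_bigr => r rr; rewrite big_cons /B' eq_sym (negbTE rr).
Qed.

End gaussian_entries.

Section gaussian_column.
Context {R : realType} {D : nat}.
Local Notation C := R[i].
Local Notation pos := ('I_D * 'I_D)%type.
Local Notation I := (('I_D * 'I_D) * bool)%type.
Local Notation state := (state R I).
Context {d : measure_display} {T : measurableType d} {P : probability T R}
  (X : I -> {RV P >-> R}) (sigma : 'I_D -> 'I_D -> R).
Hypothesis indX : mutually_independent X.
Hypothesis sigma_gt0 : forall i j, 0 < sigma i j.
Hypothesis normalX : forall i j (b : bool), is_normal0 (X (i, j, b)) (sigma i j / Num.sqrt 2).

Definition rsqrt2 : C := Complex (Num.sqrt 2)^-1 0.

Lemma nsq_rsqrt2 : nsq rsqrt2 = 1 / 2.
Proof. by rewrite nsq_real exprVn sqr_sqrtr// div1r. Qed.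

(** Position [(r, i)] of the Hamiltonian contains [entry (r, i)] and the conjugate of
    [entry (i, r)], both over [sqrt 2]. Only the first is fresh here; the second will be part of
    [c]. *)
Definition random_column (Q : {pred 'I_D}) (i : 'I_D) (c : 'cV[C]_D) (x : state) : 'cV[C]_D :=
  c + \col_r ((r \in Q)%:R * (entry (r, i) x * rsqrt2)).

Lemma mxmeasurable_random_column Q i c : mxmeasurable (random_column Q i c).
Proof.
apply: mxmeasurableD; first exact: mxmeasurable_cst.
move=> r j; under eq_fun do rewrite mxE.
apply: cmeasurableM; first exact: cmeasurable_cst.
by apply: cmeasurableM; [exact: cmeasurable_entry|exact: cmeasurable_cst].
Qed.

(* Greedy choice: some diagonal entry of the projection is at least the
   average; integrate out that coordinate and deflate the projection. *)
Lemma expectation_column_le (Q : {pred 'I_D}) (i : 'I_D) (c : 'cV[C]_D) (a s sm : R) (k : nat)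
    (Pm : 'M[C]_D) :
  orthoproj Pm -> (forall r, r \notin Q -> Pm *m delta_mx r 0 = 0 :> 'cV_D) ->
  0 < a -> 0 < s -> 0 < sm -> (forall r, sm <= sigma r i) ->
  a + k%:R <= complex.Re (\tr Pm) ->
  (\int[P]_t (expR (- (s * n2 (Pm *m random_column Q i c (X^~ t)))))%:E <=
   ((2 * D%:R / (s * sm ^+ 2 * a)) ^+ k)%:E)%E.
Proof.
move=> + + a0 s0 sm0 sml; elim: k Pm => [|k IH] Pm pP PQ trP.
  apply: expR_le1_integral => [|t]; last by rewrite mulr_ge0 ?n2_ge0// ltW.
  apply: measurable_funM => //.
  have := measurable_n2 (mxmeasurableM (mxmeasurable_cst Pm) (mxmeasurable_random_column Q i c)).
  by move=> /measurableT_comp; apply; exact: measurable_RVs.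
have ak0 : 0 < a + k.+1%:R by rewrite ltr_wpDr.
have [r hr] := orthoproj_diag_large pP ak0 trP.
have D0 : 0 < D%:R :> R by rewrite ltr0n; exact: leq_ltn_trans (leq0n r) (ltn_ord r).
(* [q] is also the squared length of [Pm e_r]. The margin [a] in the trace keeps it at least [a / D]
   in each of the [k] steps. *)
set q := complex.Re (Pm r r) in hr.
have Pq : Pm r r = Complex q 0 by rewrite /q orthoproj_diag.
have q_ge : a / D%:R <= q by apply: le_trans hr; rewrite ler_pM2r ?invr_gt0// lerDl.
have q0 : 0 < q by apply: lt_le_trans q_ge; rewrite divr_gt0.
have Pr0 : Pm *m delta_mx r 0 != 0 :> 'cV_D.
  by rewrite -n2_eq0; have := orthoproj_diag r pP; rewrite Pq => -[<-]; rewrite gt_eqF.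
have rQ : r \in Q by apply: contraT => /PQ h; rewrite h eqxx in Pr0.
have [P' [pP' P'P P'r trP' nP']] := orthoproj_deflate pP Pr0.
have nq : n2 (Pm *m delta_mx r 0 : 'cV_D) = q.
  by have := orthoproj_diag r pP; rewrite Pq => -[<-].
pose F (x : state) := expR (- (s * n2 (Pm *m random_column Q i c x))).
pose F' (x : state) := expR (- (s * n2 (P' *m random_column Q i c x))).
have mE (M : 'M[C]_D) : measurable_fun [set: state] (fun x => expR (- (s * n2 (M *m random_column Q i c x)))).
  apply: measurableT_comp => //; apply: measurableT_comp => //; apply: measurable_funM => //.
  by apply: measurable_n2; apply: mxmeasurableM; [exact: mxmeasurable_cst|exact: mxmeasurable_random_column].
set K := coordset [set (r, i)]%SET.
set kap := 2 * D%:R / (s * sm ^+ 2 * a).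
have kap0 : 0 <= kap by apply: divr_ge0; [exact: mulr_ge0|apply/ltW; rewrite !mulr_gt0// exprn_gt0].
apply: (@le_trans _ _ (kap%:E * \int[P]_t (F' (X^~ t))%:E)%E).
  apply: (@resampling_le R I d T P X indX K F F' kap (mE Pm) (fun=> expR_ge0 _) (mE P') (fun=> expR_ge0 _) kap0).
  move=> y; set h := random_column Q i c y.
  pose h0 := h - (entry (r, i) y * rsqrt2) *: delta_mx r 0.
  have hmix x : random_column Q i c (mix K y x) = h0 + (entry (r, i) x * rsqrt2) *: delta_mx r 0.
    rewrite /h0 /h /random_column -!addrA; congr (_ + _).
    apply/colP => j; rewrite !mxE entry_mix inE xpair_eqE eqxx !andbT.
    have [->|jr] := eqVneq j r; first by rewrite rQ !mul1r !mulr1 addrA addrN add0r.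
    by rewrite !mulr0 oppr0 !addr0.
  have P'mix x : P' *m random_column Q i c (mix K y x) = P' *m h.
    by rewrite hmix /h0 mulmxDr mulmxBr -!scalemxAr P'r !scaler0 subr0 addr0.
  pose w := (Pm *m h0) r 0.
  have FE x : F (mix K y x) = F' y * expR (- (nsq (entry (r, i) x * (rsqrt2 * Complex q 0) + w) / (q / s))).
    rewrite /F /F' nP' P'mix nq -expRD -opprD mulrDr; congr (expR (- (_ + _))).
    rewrite invf_div mulrCA; congr (_ * _).
    rewrite trmx_delta map_delta_mx -mulmxA -rowE mxE hmix mulmxDr mxE -/w addrC.
    rewrite -scalemxAr mxE; congr (nsq (_ + _)); rewrite -colE mxE Pq; ring.
  under eq_integral do rewrite FE EFinM.
  rewrite ge0_integralZl//; last 2 first.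
  - apply/measurable_EFinP; apply: measurableT_comp => //; apply: measurableT_comp => //.
    apply: measurable_funM => //; apply: measurable_nsq; apply: cmeasurableD; last exact: cmeasurable_cst.
    by apply: cmeasurableM; [split; exact: measurable_funPT|exact: cmeasurable_cst].
  - by rewrite lee_fin expR_ge0.
  rewrite -/(F' y) [(kap * _)]mulrC EFinM; apply: lee_wpmul2l; first by rewrite lee_fin expR_ge0.
  have qs0 : 0 < q / s by rewrite divr_gt0.
  apply: le_trans (expectation_entry_le indX sigma_gt0 normalX (r, i) (rsqrt2 * Complex q 0) w qs0) _.
  rewrite lee_fin nsqM nsq_rsqrt2 nsq_real /=.
  have den0 : 0 < sigma r i ^+ 2 * (1 / 2 * q ^+ 2).
    by rewrite !mulr_gt0// ?exprn_gt0// sigma_gt0.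
  have den1 : 0 < q / s + sigma r i ^+ 2 * (1 / 2 * q ^+ 2) by rewrite addr_gt0.
  apply: (@le_trans _ _ (q / s / (q / s + sigma r i ^+ 2 * (1 / 2 * q ^+ 2)))).
    apply: ler_piMr; first by apply: divr_ge0; apply: ltW.
    by rewrite -[leRHS]expR0 ler_expR oppr_le0; apply: divr_ge0; [exact: nsq_ge0|exact: (ltW den1)].
  rewrite ler_pdivrMr//.
  (* Dropping the width [q / s] from the denominator leaves at most [2 / (s sm^2 q)], and
     [q >= a / D] turns this into [kap]. *)
  apply: (@le_trans _ _ (kap * (sm ^+ 2 * (1 / 2 * q ^+ 2)))).
    have -> : kap * (sm ^+ 2 * (1 / 2 * q ^+ 2)) = (q / s) * (q / (a / D%:R)).
      by rewrite /kap; field; rewrite !gt_eqF.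
    by rewrite ler_peMr ?(ltW qs0)// ler_pdivlMr ?mul1r// divr_gt0.
  apply: ler_wpM2l => //; apply: (@le_trans _ _ (sigma r i ^+ 2 * (1 / 2 * q ^+ 2))); last first.
    by rewrite lerDr ltW.
  apply: ler_wpM2r; first by rewrite mulr_ge0 ?sqr_ge0.
  by rewrite lerXn2r ?nnegrE ?(ltW sm0) ?(ltW (sigma_gt0 _ _)).
have P'Q j : j \notin Q -> P' *m delta_mx j 0 = 0 :> 'cV_D.
  by move=> jQ; rewrite -P'P -mulmxA PQ// mulmx0.
have trP'k : a + k%:R <= complex.Re (\tr P').
  by rewrite trP' ReD /= lerBrDr -addrA natr1.
have := IH P' pP' P'Q trP'k => /(lee_wpmul2l (x := kap%:E)); rewrite lee_fin => /(_ kap0) /le_trans; apply.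
by rewrite -EFinM lee_fin -exprS.
Qed.

End gaussian_column.

(** * Norm of the Gaussian matrix *)

Section operator_norm_net.
Context {R : realType} {D : nat}.
Local Notation C := R[i].

Lemma ipDr n (u v w : 'cV[C]_n) : ip u (v + w) = ip u v + ip u w.
Proof. by rewrite /ip -big_split; apply: eq_bigr => i _; rewrite mxE mulrDr ReD. Qed.

Lemma ipDl n (u v w : 'cV[C]_n) : ip (u + v) w = ip u w + ip v w.
Proof. by rewrite ipC ipDr ipC [ip w v]ipC. Qed.

Lemma nv_le1 n (v : 'cV[C]_n) : (nv v <= 1) = (n2 v <= 1).
Proof. by rewrite -{1}sqrtr1 ler_sqrt. Qed.

Lemma ip_self n (v : 'cV[C]_n) : ip v v = n2 v.
Proof. by rewrite /ip; apply: eq_bigr => i _; rewrite -nsqE. Qed.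

Lemma ip_adj n (A : 'M[C]_n) (u v : 'cV[C]_n) : ip (A ^t* *m u) v = ip u (A *m v).
Proof.
have ipE (a b : 'cV[C]_n) : ip a b = complex.Re ((a ^t* *m b) 0 0).
  by rewrite mxE Re_sum; apply: eq_bigr => i _; rewrite !mxE.
by rewrite !ipE trmx_mul map_mxM trmxCK mulmxA.
Qed.

Lemma bilinear_le_of_net (A : 'M[C]_D) (Z : seq ('I_D -> C)) (tau : R) : 0 <= tau ->
  (forall c : 'I_D -> C, \sum_l nsq (c l) <= 1 ->
      exists z, [/\ List.In z Z, \sum_l nsq (c l - z l) <= (1 / 4) ^+ 2 & \sum_l nsq (z l) <= 1]) ->
  (forall z z', List.In z Z -> List.In z' Z -> \sum_l nsq (z l) <= 1 -> \sum_l nsq (z' l) <= 1 ->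
     ip (\col_i z i) (A *m \col_i z' i) <= tau) ->
  forall u v, nv u <= 1 -> nv v <= 1 -> ip u (A *m v) <= 2 * tau.
Proof.
move=> tau0 net hZ.
have approx (u : 'cV[C]_D) : nv u <= 1 -> exists z, [/\ List.In z Z, \sum_l nsq (z l) <= 1,
    nv (\col_i z i) <= 1 & nv (u - \col_i z i) <= 1 / 4].
  rewrite nv_le1 => /net[z [zZ uz z1]]; exists z.
  have -> : nv (\col_i z i) <= 1.
    by rewrite nv_le1 /n2; under eq_bigr do rewrite mxE.
  split => //; rewrite -[1 / 4]gtr0_norm// -sqrtr_sqr; apply: ler_wsqrtr.
  by rewrite /n2; under eq_bigr do rewrite !mxE.
have f0 := fro_ge0 A.
have scale (B : R) (u v : 'cV[C]_D) : (forall u v, nv u <= 1 -> nv v <= 1 -> ip u (A *m v) <= B) ->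
    nv u <= 1 -> nv v <= 1 / 4 -> ip u (A *m v) <= B / 4.
  move=> hB hu hv; have := hB u (Complex 4 0 *: v) hu.
  rewrite nvZ_real ger0_norm// -scalemxAr ipZr => h.
  have : 4 * nv v <= 1 by lra.
  move=> /h; lra.
have scale' (B : R) (u v : 'cV[C]_D) : (forall u v, nv u <= 1 -> nv v <= 1 -> ip u (A *m v) <= B) ->
    nv u <= 1 / 4 -> nv v <= 1 -> ip u (A *m v) <= B / 4.
  move=> hB hu hv; have := hB (Complex 4 0 *: u) v.
  rewrite nvZ_real ger0_norm// ipC ipZr [ip (_ *m _) _]ipC => h.
  have : 4 * nv u <= 1 by lra.
  move=> /h /(_ hv); lra.
have iter k : forall u v, nv u <= 1 -> nv v <= 1 -> ip u (A *m v) <= 2 * tau + fro A / 2 ^+ k.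
  elim: k => [|k IH] u v hu hv.
    rewrite expr0 divr1; apply: le_trans (ip_le _ _) _.
    have h1 := nv_mulmx_le A v; have h2 := nv_ge0 (A *m v).
    have h3 : nv (A *m v) <= fro A by apply: le_trans h1 _; rewrite ler_piMr.
    have h4 : nv u * nv (A *m v) <= nv (A *m v) by rewrite ler_piMl.
    lra.
  have [z [zZ z1 nz uz]] := approx u hu; have [z' [zZ' z1' nz' vz]] := approx v hv.
  set a := \col_i z i in nz uz *; set b := \col_i z' i in nz' vz *.
  have hab : ip a (A *m b) <= tau by exact: hZ.
  have h1 := scale _ _ _ IH nz vz.
  have h2 := scale' _ _ _ IH uz hv.
  have -> : ip u (A *m v) = ip a (A *m b) + ip a (A *m (v - b)) + ip (u - a) (A *m v).
    rewrite -ipDr -mulmxDr addrC [b + _]addrC subrK -ipDl addrC.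
    by rewrite [a + _]addrC subrK.
  have -> : fro A / 2 ^+ k.+1 = fro A / 2 ^+ k / 2 by rewrite exprSr invfM mulrA.
  lra.
move=> u v hu hv; apply/ler_addgt0Pr => e e0.
have [k hk] : exists k, fro A / 2 ^+ k <= e.
  exists (Num.truncn (fro A / e)).+1.
  set k := (Num.truncn _).+1.
  rewrite ler_pdivrMr ?exprn_gt0// mulrC -ler_pdivrMr//.
  apply: le_trans (ltW (truncnS_gt _)) _.
  by rewrite -natrX ler_nat ltnW// ltn_expl.
by apply: le_trans (iter k u v hu hv) _; rewrite lerD2l.
Qed.

Lemma nv_mulmx_le_of_bilinear (A : 'M[C]_D) (K : R) : 0 <= K ->
  (forall u v, nv u <= 1 -> nv v <= 1 -> ip u (A *m v) <= K) ->
  forall v, nv (A *m v) <= K * nv v.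
Proof.
move=> K0 h v; have [->|v0] := eqVneq v 0; first by rewrite mulmx0 /nv n20 sqrtr0 mulr0.
have [->|w0] := eqVneq (A *m v) 0; first by rewrite /nv n20 sqrtr0 mulr_ge0 ?sqrtr_ge0.
have nv0 : 0 < nv v by rewrite sqrtr_gt0 n2_gt0.
have nw0 : 0 < nv (A *m v) by rewrite sqrtr_gt0 n2_gt0.
have unit1 (u : 'cV[C]_D) : 0 < nv u -> nv (Complex (nv u)^-1 0 *: u) <= 1.
  by move=> u0; rewrite nvZ_real ger0_norm ?invr_ge0 ?(ltW u0)// mulVf ?gt_eqF.
have := h _ _ (unit1 _ nw0) (unit1 _ nv0).
rewrite -scalemxAr ipZr ipC ipZr ip_self -sqr_nv expr2 mulKf ?gt_eqF//.
by rewrite mulrC ler_pdivrMr.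
Qed.

Lemma nv_adjmx_le (A : 'M[C]_D) (K : R) : 0 <= K -> (forall v, nv (A *m v) <= K * nv v) ->
  forall v, nv (A ^t* *m v) <= K * nv v.
Proof.
move=> K0 h v; set w := A ^t* *m v.
have [->|w0] := eqVneq w 0; first by rewrite /nv n20 sqrtr0 mulr_ge0 ?sqrtr_ge0.
have nw0 : 0 < nv w by rewrite sqrtr_gt0 n2_gt0.
rewrite -(ler_pM2r nw0) -expr2 sqr_nv -ip_self {1}/w ip_adj.
apply: le_trans (ip_le _ _) _; have := h w => hw.
by rewrite -mulrA mulrCA; apply: ler_wpM2l => //; exact: nv_ge0.
Qed.

End operator_norm_net.

Section random_matrix_norm.
Context {R : realType} {D : nat}.
Local Notation C := R[i].
Local Notation pos := ('I_D * 'I_D)%type.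
Local Notation I := (('I_D * 'I_D) * bool)%type.
Local Notation state := (state R I).
Context {d : measure_display} {T : measurableType d} {P : probability T R}
  (X : I -> {RV P >-> R}) (sigma : 'I_D -> 'I_D -> R).
Hypothesis indX : mutually_independent X.
Hypothesis sigma_gt0 : forall i j, 0 < sigma i j.
Hypothesis normalX : forall i j (b : bool), is_normal0 (X (i, j, b)) (sigma i j / Num.sqrt 2).

Definition gmatrix (x : state) : 'M[C]_D := \matrix_(i, j) entry (i, j) x.

Lemma mxmeasurable_gmatrix : mxmeasurable gmatrix.
Proof. by move=> i j; under eq_fun do rewrite mxE; exact: cmeasurable_entry. Qed.

Lemma expectation_linear_le (l : seq I) (alpha : I -> R) : uniq l ->
  (\int[P]_t (expR (\sum_(k <- l) alpha k * X k t))%:E <=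
   (expR (\sum_(k <- l) alpha k ^+ 2 * sigma k.1.1 k.1.2 ^+ 2 / 4))%:E)%E.
Proof.
elim: l => [_|k l IH /= /andP[kl ul]].
  under eq_integral do rewrite big_nil.
  by rewrite integral_cst_probability big_nil.
pose F (x : state) := expR (alpha k * x k + \sum_(k <- l) alpha k * x k).
pose F' (x : state) := expR (\sum_(k <- l) alpha k * x k).
have mk j : measurable_fun [set: state] (fun x : state => alpha j * x j).
  by apply: measurable_funM => //; exact: measurable_coord.
have ms : measurable_fun [set: state] (fun x : state => \sum_(k <- l) alpha k * x k).
  exact: measurable_sum.
have mF : measurable_fun setT F.
  by apply: measurableT_comp => //; exact: measurable_funD.
have mF' : measurable_fun setT F' by apply: measurableT_comp.
pose c := expR (alpha k ^+ 2 * sigma k.1.1 k.1.2 ^+ 2 / 4).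
have -> : (\int[P]_t (expR (\sum_(k0 <- k :: l) alpha k0 * X k0 t))%:E = \int[P]_t (F (X^~ t))%:E)%E.
  by apply: eq_integral => t _; rewrite big_cons.
apply: (@le_trans _ _ (c%:E * \int[P]_t (F' (X^~ t))%:E)%E).
  apply: (@resampling_le R I d T P X indX [set k]%SET F F' c mF (fun=> expR_ge0 _) mF' (fun=> expR_ge0 _) (expR_ge0 _)).
  move=> y.
  have FE x : F (mix [set k]%SET y x) = F' y * expR (alpha k * x k).
    rewrite /F /F' /mix inE eqxx expRD mulrC; congr (expR _ * _).
    rewrite big_seq [RHS]big_seq; apply: eq_bigr => j jl; rewrite inE.
    by case: eqP => // jk; move: kl; rewrite -jk jl.
  under eq_integral do rewrite FE EFinM.
  rewrite ge0_integralZl//; last 2 first.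
  - apply/measurable_EFinP; apply: measurableT_comp => //.
    by apply: measurable_funM => //; exact: measurable_funPT.
  - by rewrite lee_fin expR_ge0.
  case: k @c kl {F mF FE} => -[i j] b c kl.
  have s0 : 0 < sigma i j / Num.sqrt 2 by apply: divr_gt0; [exact: sigma_gt0|rewrite sqrtr_gt0].
  rewrite (integral_expR_normal0 _ s0 (normalX i j b)) -EFinM lee_fin mulrC.
  rewrite sqr_half_variance le_eqVlt; apply/orP; left; apply/eqP; congr (expR _ * _).
  by rewrite /=; field.
have := IH ul => /(lee_wpmul2l (x := c%:E)); rewrite lee_fin => /(_ (expR_ge0 _)) /le_trans; apply.
by rewrite -EFinM lee_fin -expRD big_cons.
Qed.

Lemma sum_coords (F : I -> R) :
  \sum_k F k = \sum_i \sum_j (F (i, j, false) + F (i, j, true)).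
Proof.
transitivity (\sum_(k : I) F (k.1.1, k.1.2, k.2)); first by apply: eq_bigr => -[[i j] b].
rewrite -(pair_bigA _ (fun (p : pos) b => F (p.1, p.2, b))) /=.
rewrite -(pair_bigA _ (fun i j => \sum_b F (i, j, b))) /=.
by apply: eq_bigr => i _; apply: eq_bigr => j _; rewrite big_bool addrC.
Qed.

Lemma bilinear_tail (u v : 'cV[C]_D) (tau sp : R) : 0 < tau -> 0 < sp ->
  (forall i j, sigma i j <= sp) -> n2 u <= 1 -> n2 v <= 1 ->
  (P [set t | (tau <= ip u (gmatrix (X^~ t) *m v))%R] <= (expR (- (tau ^+ 2 / sp ^+ 2)))%:E)%E.
Proof.
(* [lam] minimizes the Chernoff exponent [lam^2 sp^2 / 4 - lam tau]. *)
move=> tau0 sp0 ssp u1 v1; pose lam := 2 * tau / sp ^+ 2.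
have lam0 : 0 < lam by rewrite !mulr_gt0// invr_gt0 exprn_gt0.
pose w (p : pos) : C := (u p.1 0)^* * v p.2 0.
pose alpha (k : I) : R := lam * (if k.2 then - complex.Im (w k.1) else complex.Re (w k.1)).
have ipE x : lam * ip u (gmatrix x *m v) = \sum_k alpha k * x k.
  rewrite sum_coords.
  rewrite mulr_sumr; apply: eq_bigr => i _; rewrite mxE mulr_sumr Re_sum mulr_sumr.
  apply: eq_bigr => j _; rewrite /alpha /= mxE /entry -/(w (i, j)).
  have -> : (u i 0)^* * (Complex (x (i, j, false)) (x (i, j, true)) * v j 0) =
    Complex (x (i, j, false)) (x (i, j, true)) * w (i, j) by rewrite /w mulrCA.
  by case: (w (i, j)) => a b /=; ring.
have mip : measurable_fun [set: state] (fun x => ip u (gmatrix x *m v)).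
  rewrite /ip; apply: measurable_sum => i.
  have := cmeasurableM (cmeasurable_cst (u i 0)^* ) (mxmeasurableM mxmeasurable_gmatrix (mxmeasurable_cst v) i 0).
  by case.
have mipX : measurable_fun [set: T] (fun t => ip u (gmatrix (X^~ t) *m v)).
  exact: measurableT_comp mip (measurable_RVs X).
have mS : measurable [set t | tau <= ip u (gmatrix (X^~ t) *m v)].
  exact: measurable_set_le.
apply: (@le_trans _ _ ((expR (lam * tau))^-1%:E * \int[P]_t (expR (lam * ip u (gmatrix (X^~ t) *m v)))%:E)%E).
  apply: chernoff => //; first exact: expR_gt0.
  - by apply: measurableT_comp => //; exact: measurable_funM.
  - by move=> t /= h; rewrite ler_expR ler_pM2l.
under eq_integral do rewrite ipE.
have e0 : (0 <= (expR (lam * tau))^-1%:E)%E by rewrite lee_fin invr_ge0 expR_ge0.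
apply: le_trans (lee_wpmul2l e0 (expectation_linear_le alpha (index_enum_uniq I))) _.
rewrite -EFinM lee_fin -expRN -expRD ler_expR.
have : \sum_k alpha k ^+ 2 * sigma k.1.1 k.1.2 ^+ 2 / 4 <= lam ^+ 2 * sp ^+ 2 / 4.
  apply: (@le_trans _ _ (\sum_(k : I) lam ^+ 2 * sp ^+ 2 / 4 * (alpha k / lam) ^+ 2)).
    apply: ler_sum => k _.
    have -> : lam ^+ 2 * sp ^+ 2 / 4 * (alpha k / lam) ^+ 2 = alpha k ^+ 2 * sp ^+ 2 / 4.
      by field; rewrite gt_eqF.
    rewrite ler_pM2r ?invr_gt0//; apply: ler_wpM2l; first exact: sqr_ge0.
    by rewrite lerXn2r ?nnegrE ?(ltW sp0) ?(ltW (sigma_gt0 _ _)).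
  rewrite -mulr_sumr ler_piMr//; first by rewrite divr_ge0// mulr_ge0 ?sqr_ge0.
  rewrite sum_coords.
  have -> : \sum_i \sum_j ((alpha (i, j, false) / lam) ^+ 2 + (alpha (i, j, true) / lam) ^+ 2) = n2 u * n2 v.
    rewrite mulr_suml; apply: eq_bigr => i _; rewrite mulr_sumr; apply: eq_bigr => j _.
    rewrite /alpha /= ![lam * _ / lam]mulrAC divff ?gt_eqF// !mul1r sqrrN.
    by rewrite -/(nsq (w (i, j))) nsqM nsq_conj.
  by rewrite mulr_ile1 ?n2_ge0.
have -> : lam ^+ 2 * sp ^+ 2 / 4 = tau ^+ 2 / sp ^+ 2 by rewrite /lam; field; rewrite gt_eqF.
have : lam * tau = 2 * (tau ^+ 2 / sp ^+ 2) by rewrite /lam; ring.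
by lra.
Qed.

End random_matrix_norm.

(** * Union bounds over lists *)

Section union_bound.

Lemma list_union_cons {T A : Type} (a : A) (s : seq A) (E : A -> set T) :
  [set t | exists2 b, List.In b (a :: s) & E b t] =
  E a `|` [set t | exists2 b, List.In b s & E b t].
Proof.
apply/seteqP; split => t /=.
  by move=> [b [<-|bs]]; [left|right; exists b].
by move=> [|[b bs]]; [exists a => //; left|exists b => //; right].
Qed.

Lemma measurable_list_union {d : measure_display} {T : measurableType d}
    (A : Type) (s : seq A) (E : A -> set T) :
  (forall a, List.In a s -> measurable (E a)) ->
  measurable [set t | exists2 a, List.In a s & E a t].
Proof.
elim: s => [|a s IH] mE.
  by rewrite (_ : [set t | _] = set0)//; apply/seteqP; split => t // [].
rewrite list_union_cons; apply: measurableU; first by apply: mE; left.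
by apply: IH => b bs; apply: mE; right.
Qed.

Context {R : realType} {d : measure_display} {T : measurableType d} (P : probability T R).

Lemma union_bound (A : Type) (s : seq A) (E : A -> set T) (c : R) :
  (forall a, List.In a s -> measurable (E a)) ->
  (forall a, List.In a s -> (P (E a) <= c%:E)%E) ->
  (P [set t | exists2 a, List.In a s & E a t] <= ((size s)%:R * c)%:E)%E.
Proof.
elim: s => [|a s IH] mE Ec.
  have -> : [set t | exists2 a, List.In a [::] & E a t] = set0 by apply/seteqP; split => t // [].
  by rewrite measure0 mul0r.
rewrite list_union_cons; apply: le_trans (measureU2 _ _ _) _.
- by apply: mE; left.
- by apply: measurable_list_union => b bs; apply: mE; right.
have -> : (size (a :: s))%:R * c = c + (size s)%:R * c by rewrite /= -natr1 mulrDl mul1r addrC.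
rewrite EFinD; apply: leeD; first by apply: Ec; left.
by apply: IH => b bs; [apply: mE|apply: Ec]; right.
Qed.

Lemma probability_le_preimage (A B : set T) (c : R) : measurable A -> measurable B ->
  A `<=` B -> (P B <= c%:E)%E -> (P A <= c%:E)%E.
Proof. by move=> mA mB AB; apply: le_trans; apply: le_measure; rewrite ?inE. Qed.

End union_bound.

(** * The random Hamiltonian and its norm *)

Section random_hamiltonian.
Context {R : realType} {D : nat}.
Local Notation C := R[i].
Local Notation pos := ('I_D * 'I_D)%type.
Local Notation I := (('I_D * 'I_D) * bool)%type.
Local Notation state := (state R I).
Context {d : measure_display} {T : measurableType d} {P : probability T R}
  (X : I -> {RV P >-> R}) (sigma : 'I_D -> 'I_D -> R) (H0 : 'M[C]_D).
Hypothesis indX : mutually_independent X.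
Hypothesis sigma_gt0 : forall i j, 0 < sigma i j.
Hypothesis normalX : forall i j (b : bool), is_normal0 (X (i, j, b)) (sigma i j / Num.sqrt 2).

Definition hamiltonian (x : state) : 'M[C]_D := H0 + rsqrt2 *: (gmatrix x + adjmx (gmatrix x)).

Lemma hamiltonianE x r j : hamiltonian x r j =
  H0 r j + rsqrt2 * (entry (r, j) x + (entry (j, r) x)^* ).
Proof. by rewrite !mxE. Qed.

Lemma randHE w : randH H0 X w = hamiltonian (X^~ w).
Proof. by []. Qed.

Lemma mxmeasurable_hamiltonian : mxmeasurable hamiltonian.
Proof.
apply: mxmeasurableD; first exact: mxmeasurable_cst.
apply: mxmeasurableZ; first exact: cmeasurable_cst.
apply: mxmeasurableD; first exact: mxmeasurable_gmatrix.
by move=> i j; under eq_fun do rewrite mxE; apply: cmeasurable_conj; exact: mxmeasurable_gmatrix.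
Qed.

Lemma hamiltonian_herm x : is_hermitian H0 -> (hamiltonian x) ^t* = hamiltonian x.
Proof.
move=> h; rewrite -adjmxE; apply/matrixP => i j.
have hij : (H0 j i)^* = H0 i j by rewrite -[in RHS]h mxE.
have r2 : rsqrt2^* = rsqrt2 :> C by rewrite conjCE /= oppr0.
rewrite mxE !hamiltonianE rmorphD rmorphM rmorphD /= conjCK hij r2.
by rewrite [X in _ * X]addrC.
Qed.

Lemma expR_ge_pow2 k : expR (- k%:R) <= (1 / 2) ^+ k :> R.
Proof.
rewrite -[k%:R]mulr1 -mulrN expRM_natl; apply: lerXn2r; rewrite ?nnegrE ?expR_ge0//.
have h := expR_ge1Dx (1 : R); have e : expR (-1) * expR 1 = 1 :> R by rewrite -expRD addNr expR0.
have := expR_ge0 (-1 : R); nra.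
Qed.

(** A net of mesh 1/4 has at most [64^(2 D) = 2^(12 D)] points, hence [2^(24 D)] pairs, against a
    tail [exp (- 25 D)] for each; this fixes the 5 in [tau]. The Gaussian matrix and its adjoint
    then have norm at most [10 sp sqrt D], and [20 / sqrt 2 <= 15]. *)
Lemma norm_event (sp : R) : 0 < sp -> (forall i j, sigma i j <= sp) -> (0 < D)%N ->
  exists G : set state, [/\ measurable G,
    (P ((fun w => (X^~ w : state)) @^-1` ~` G) <= ((1 / 2) ^+ D)%:E)%E &
    forall x, G x -> forall v, nv (rsqrt2 *: (gmatrix x + adjmx (gmatrix x)) *m v) <=
      15 * sp * Num.sqrt D%:R * nv v].
Proof.
move=> sp0 ssp D0; have D0' : 0 < D%:R :> R by rewrite ltr0n.
have sD0 : 0 < Num.sqrt D%:R :> R by rewrite sqrtr_gt0.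
have t01 : 0 < (1 / 4 : R) <= 1 by apply/andP; split; lra.
have [Z [sZ net]] := @complex_net R 'I_D (1 / 4) t01.
pose tau : R := 5 * Num.sqrt D%:R * sp.
have tau0 : 0 < tau by rewrite !mulr_gt0.
pose ok (p : ('I_D -> C) * ('I_D -> C)) := \sum_l nsq (p.1 l) <= 1 /\ \sum_l nsq (p.2 l) <= 1.
pose E p : set state := [set x | ok p /\ tau <= ip (\col_i p.1 i) (gmatrix x *m \col_i p.2 i)].
pose ZZ := List.list_prod Z Z.
have mE p : measurable (E p).
  have [okp|nok] := pselect (ok p); last first.
    by rewrite (_ : E p = set0)//; apply/seteqP; split => x // [].
  rewrite (_ : E p = [set x | tau <= ip (\col_i p.1 i) (gmatrix x *m \col_i p.2 i)]); last first.
    by apply/seteqP; split => x /= => [[]|].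
  apply: measurable_set_le => //; apply: measurable_sum => i.
  have := cmeasurableM (cmeasurable_cst ((\col_i p.1 i) i 0 : C)^* )
    (mxmeasurableM mxmeasurable_gmatrix (mxmeasurable_cst (\col_i p.2 i)) i 0).
  by case.
have mX := measurable_RVs X.
have mXE p : measurable ((fun w => (X^~ w : state)) @^-1` E p).
  by rewrite -[X in measurable X]setTI; exact: mX.
have PE p : (P ((fun w => (X^~ w : state)) @^-1` E p) <= ((1 / 2) ^+ (25 * D))%:E)%E.
  have [[u1 v1]|nok] := pselect (ok p); last first.
    rewrite (_ : _ @^-1` _ = set0); last by apply/seteqP; split => x // [].
    by rewrite measure0 lee_fin exprn_ge0.
  have n2c (z : 'I_D -> C) : n2 (\col_i z i) = \sum_l nsq (z l).
    by apply: eq_bigr => i _; rewrite mxE.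
  have /= := bilinear_tail indX sigma_gt0 normalX (u := \col_i p.1 i) (v := \col_i p.2 i) tau0 sp0 ssp.
  rewrite !n2c => /(_ u1 v1) bt.
  apply: (@le_trans _ _ (expR (- (tau ^+ 2 / sp ^+ 2)))%:E); last first.
    rewrite lee_fin; apply: le_trans (expR_ge_pow2 _); rewrite ler_expR lerN2.
    by rewrite /tau !exprMn sqr_sqrtr ?ler0n// mulfK ?gt_eqF ?exprn_gt0// natrM; lra.
  apply: le_trans bt; rewrite le_eqVlt; apply/orP; left; apply/eqP; congr (P _).
  by apply/seteqP; split => t /= => [[]|].
have PU := union_bound (s := ZZ) (fun p _ => mXE p) (fun p _ => PE p).
exists (~` [set x | exists2 p, List.In p ZZ & E p x]); split.
- by apply: measurableC; apply: measurable_list_union.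
- rewrite setCK; apply: le_trans (PU) _; rewrite lee_fin.
  have -> : (size ZZ)%:R = (size Z)%:R * (size Z)%:R :> R.
    by rewrite -natrM /ZZ -!(fun A => erefl : @List.length A = @size A) List.length_prod.
  have h : (size Z)%:R * (size Z)%:R <= 2 ^+ (24 * D) :> R.
    apply: (@le_trans _ _ ((16 / (1 / 4)) ^+ (2 * #|'I_D|) * (16 / (1 / 4)) ^+ (2 * #|'I_D|))).
      by apply: ler_pM.
    rewrite card_ord -exprD; have -> : 16 / (1 / 4) = 2 ^+ 6 :> R by field.
    by rewrite -exprM; rewrite (_ : 6 * (2 * D + 2 * D) = 24 * D)%N//; lia.
  apply: le_trans (ler_wpM2r _ h) _; first by rewrite exprn_ge0.
  rewrite (_ : 25 * D = 24 * D + D)%N; last by lia.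
  by rewrite exprD mulrA -exprMn mulrC (_ : 2 * (1 / 2) = 1 :> R) ?expr1n ?mulr1//; field.
- move=> x Gx.
  have hA : forall v, nv (gmatrix x *m v) <= 10 * sp * Num.sqrt D%:R * nv v.
    apply: nv_mulmx_le_of_bilinear; first by rewrite !mulr_ge0// ltW.
    move=> u v hu hv; apply: le_trans (_ : 2 * tau <= _); last by rewrite /tau; lra.
    apply: (bilinear_le_of_net (Z := Z)) => //; first exact: ltW.
    move=> z z' zZ zZ' z1 z1'; rewrite leNgt; apply/negP => /ltW h; apply: Gx.
    by exists (z, z'); [exact/List.in_prod|split].
  have K0 : 0 <= 10 * sp * Num.sqrt D%:R by rewrite !mulr_ge0// ltW.
  have hB := nv_adjmx_le K0 hA.
  move=> v; rewrite -scalemxAl nvZ nsq_rsqrt2 mulmxDl adjmxE.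
  have s1 : Num.sqrt (1 / 2 : R) <= 3 / 4.
    rewrite -[3 / 4]gtr0_norm// -sqrtr_sqr; apply: ler_wsqrtr; lra.
  apply: (@le_trans _ _ (3 / 4 * (10 * sp * Num.sqrt D%:R * nv v + 10 * sp * Num.sqrt D%:R * nv v))).
    apply: ler_pM; [exact: sqrtr_ge0|exact: nv_ge0|exact: s1|].
    by apply: le_trans (nvD_le _ _) _; apply: lerD.
  by rewrite le_eqVlt; apply/orP; left; apply/eqP; field.
Qed.

End random_hamiltonian.

(** * Nearly dependent columns *)

Section column_event.
Context {R : realType} {D : nat}.
Local Notation C := R[i].
Local Notation pos := ('I_D * 'I_D)%type.
Local Notation I := (('I_D * 'I_D) * bool)%type.
Local Notation state := (state R I).
Context {d : measure_display} {T : measurableType d} {P : probability T R}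
  (X : I -> {RV P >-> R}) (sigma : 'I_D -> 'I_D -> R) (H0 : 'M[C]_D).
Hypothesis indX : mutually_independent X.
Hypothesis sigma_gt0 : forall i j, 0 < sigma i j.
Hypothesis normalX : forall i j (b : bool), is_normal0 (X (i, j, b)) (sigma i j / Num.sqrt 2).

Local Notation hamiltonian := (hamiltonian H0).

Definition shifted (lam : C) (x : state) : 'M[C]_D := hamiltonian x - lam%:M.

Lemma shiftedE lam x r j : shifted lam x r j = hamiltonian x r j - lam *+ (r == j).
Proof. by rewrite /shifted [LHS]mxE [in X in _ + X = _]mxE [in X in _ - X = _]mxE. Qed.

Lemma mxmeasurable_shifted lam : mxmeasurable (shifted lam).
Proof.
by apply: mxmeasurableB; [exact: mxmeasurable_hamiltonian|exact: mxmeasurable_cst].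
Qed.

(* Column [i] of the rows [Q] is at distance less than [t] from the span of
   the columns [J]. *)
Definition column_event (Q J : {pred 'I_D}) (i : 'I_D) (lam : C) (t : R) : set state :=
  [set x | exists u : 'cV[C]_D,
     nv (coordproj Q *m shifted lam x *m coordproj J *m u +
         coordproj Q *m shifted lam x *m delta_mx i 0) < t].

Lemma measurable_column_event Q J i lam t : measurable (column_event Q J i lam t).
Proof.
have := @measurable_exists_nv_lt R _ state D D D
  (fun x => coordproj Q *m shifted lam x *m coordproj J)
  (fun x => coordproj Q *m shifted lam x *m delta_mx i 0) 0 0 t.
have -> : [set x | exists u : 'cV[C]_D,
     nv (coordproj Q *m shifted lam x *m coordproj J *m u +
         coordproj Q *m shifted lam x *m delta_mx i 0) < 0 * nv (0 *m u : 'cV_D) + t] =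
  column_event Q J i lam t.
  by apply/seteqP; split => x [u hu]; exists u; move: hu; rewrite mul0r add0r.
apply => //.
  apply: mxmeasurableM; last exact: mxmeasurable_cst.
  by apply: mxmeasurableM; [exact: mxmeasurable_cst|exact: mxmeasurable_shifted].
apply: mxmeasurableM; last exact: mxmeasurable_cst.
by apply: mxmeasurableM; [exact: mxmeasurable_cst|exact: mxmeasurable_shifted].
Qed.

Lemma expR_nat_le4 k : expR k%:R <= 4 ^+ k :> R.
Proof.
rewrite -[k%:R]mulr1 expRM_natl; apply: lerXn2r; rewrite ?nnegrE ?expR_ge0//.
exact: expR1_le4.
Qed.

Lemma orthoproj_n2_le n (Pm : 'M[C]_n) (v : 'cV[C]_n) : orthoproj Pm -> n2 (Pm *m v) <= n2 v.
Proof.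
move=> pP; have : 0 <= n2 (v - Pm *m v) by exact: n2_ge0.
have ipv : ip v (Pm *m v) = n2 (Pm *m v).
  case: (pP) => Ph PP; transitivity (ip (Pm ^t* *m v) (Pm *m v)).
    by rewrite ip_adj mulmxA PP.
  by rewrite Ph ip_self.
rewrite n2D n2N.
have -> : ip v (- (Pm *m v)) = - n2 (Pm *m v).
  by rewrite -ipv /ip -sumrN; apply: eq_bigr => i _; rewrite mxE !ReM_conj; case: ((Pm *m v) i 0) => a b /=; ring.
lra.
Qed.

Lemma coordproj_column_eq (Q : {pred 'I_D}) (A B : 'M[C]_D) j :
  (forall r, r \in Q -> A r j = B r j) ->
  coordproj Q *m A *m delta_mx j 0 = coordproj Q *m B *m delta_mx j 0 :> 'cV_D.
Proof.
move=> AB; apply/colP => r; rewrite -!mulmxA !mul_coordproj.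
have [rQ|_] := boolP (r \in Q); last by rewrite !mul0r.
by rewrite -!colE ![col j _ _ _]mxE AB.
Qed.

(** Because [i] is not in [Q], the fresh entries [(r, i)] with [r] in [Q] do not occur in the rows
    [Q] of any other column. With these frozen, a projection killing the columns in [J] still has
    trace at least [2 m], and the projected column [i] is no longer than the distance to their
    span. *)
Lemma probability_column_event (Q J : {pred 'I_D}) (i : 'I_D) (lam : C) (t sm : R) (m : nat) :
  i \notin Q -> i \notin J -> (2 * m + #|J| <= #|Q|)%N -> (0 < m)%N -> 0 < t -> 0 < sm ->
  (forall r, sm <= sigma r i) ->
  (P ((fun w => (X^~ w : state)) @^-1` column_event Q J i lam t) <=
   ((8 * D%:R * t ^+ 2 / (sm ^+ 2 * m%:R ^+ 2)) ^+ m)%:E)%E.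
Proof.
move=> iQ iJ cardQ m0 t0 sm0 sml.
have m0' : 0 < m%:R :> R by rewrite ltr0n.
have D0 : (0 < D)%N by exact: leq_ltn_trans (leq0n i) (ltn_ord i).
pose K := coordset [set p : pos | (p.1 \in Q) && (p.2 == i)]%SET.
apply: (@conditioning_le R I d T P X indX K).
- by apply: exprn_ge0; apply: divr_ge0; apply: mulr_ge0; rewrite ?sqr_ge0 ?mulr_ge0.
- exact: measurable_column_event.
move=> y.
have hmix x r j : r \in Q -> j != i -> hamiltonian (mix K y x) r j = hamiltonian y r j.
  move=> rQ ji; have ri : (r == i) = false by apply/negbTE; apply: contraNneq iQ => <-.
  by rewrite !hamiltonianE !entry_mix !inE /= (negbTE ji) ri !andbF.
have colQ x j : j != i -> coordproj Q *m shifted lam (mix K y x) *m delta_mx j 0 =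
    coordproj Q *m shifted lam y *m delta_mx j 0 :> 'cV_D.
  by move=> ji; apply: coordproj_column_eq => r rQ; rewrite !shiftedE hmix.
pose s := [seq coordproj Q *m shifted lam y *m delta_mx j 0 | j <- enum J] : seq 'cV[C]_D.
have [Pm [pPm PmQ Pms trPm]] := orthoproj_kill s (orthoproj_coordproj Q).
(* One [m] counts the coordinates to integrate out, the other is the margin [a] of
   [expectation_column_le]. *)
have trPm' : m%:R + m%:R <= complex.Re (\tr Pm).
  apply: le_trans trPm; rewrite mxtrace_coordproj size_map -cardE.
  have -> : complex.Re (#|Q|%:R : C) = #|Q|%:R by rewrite Comp_nat.
  by rewrite lerBrDr -!natrD ler_nat addnn -mul2n.
have PmQ0 r : r \notin Q -> Pm *m delta_mx r 0 = 0 :> 'cV_D.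
  move=> rQ; rewrite -PmQ -mulmxA (_ : coordproj Q *m delta_mx r 0 = 0) ?mulmx0//.
  apply/colP => j; rewrite mul_coordproj !mxE; case: eqP => [->|_]; last by rewrite mulr0.
  by rewrite (negbTE rQ) mul0r.
pose c : 'cV[C]_D := coordproj Q *m \col_r (H0 r i + rsqrt2 * (entry (i, r) y)^* ).
have colE' x : coordproj Q *m shifted lam (mix K y x) *m delta_mx i 0 = random_column Q i c x.
  apply/colP => r; rewrite -mulmxA mul_coordproj -colE [col _ _ _ _]mxE shiftedE hamiltonianE [RHS]mxE /c mul_coordproj [(\col_r0 _) r 0]mxE [X in _ = _ + X]mxE.
  have [rQ|_] := boolP (r \in Q); last by rewrite !mul0r addr0.
  have ri : (r == i) = false by apply/negbTE; apply: contraNneq iQ => <-.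
  rewrite ri !mul1r subr0 !entry_mix !inE /= rQ eqxx ri andbF /=.
  by rewrite mulrDr mulrC [in RHS]addrAC addrA.
set h := fun x : state => n2 (Pm *m random_column Q i c x).
have mh : measurable_fun setT h.
  by apply: measurable_n2; apply: mxmeasurableM; [exact: mxmeasurable_cst|exact: mxmeasurable_random_column].
have sub : (fun w => (mix K y (X^~ w) : state)) @^-1` column_event Q J i lam t `<=`
    [set w | h (X^~ w) <= t ^+ 2].
  move=> w /= [u]; rewrite colE' => hu; rewrite /h.
  set A := coordproj Q *m shifted lam _ in hu.
  have PA : Pm *m (A *m coordproj J *m u) = 0.
    rewrite -[A *m _ *m u]mulmxA.
    have -> : coordproj J *m u = \sum_(j in J) u j 0 *: delta_mx j 0.
      apply/colP => r; rewrite mul_coordproj summxE.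
      have [rJ|rJ] := boolP (r \in J).
        rewrite (bigD1 r)//= !mxE !eqxx mulr1 mul1r big1 ?addr0// => j /andP[_ jr].
        by rewrite !mxE eq_sym (negbTE jr) mulr0.
      rewrite mul0r big1// => j jJ; rewrite !mxE; case: eqP => [rj|_]; last by rewrite mulr0.
      by move: rJ; rewrite rj jJ.
    rewrite mulmx_sumr mulmx_sumr big1// => j jJ.
    rewrite -!scalemxAr /A colQ; last by apply: contraNneq iJ => <-.
    by rewrite Pms ?scaler0//; apply: map_f; rewrite mem_enum.
  have : n2 (Pm *m (A *m coordproj J *m u + random_column Q i c (X^~ w))) <= t ^+ 2.
    apply: le_trans (orthoproj_n2_le _ pPm) _; rewrite -sqr_nv.
    by rewrite lerXn2r ?nnegrE ?nv_ge0 ?(ltW t0)// ltW.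
  by rewrite mulmxDr PA add0r.
have mX := measurable_RVs X.
have mhX : measurable_fun [set: T] (fun w => h (X^~ w)) by exact: measurableT_comp mh mX.
have msub : measurable [set w | h (X^~ w) <= t ^+ 2] by exact: measurable_set_le.
apply: (probability_le_preimage _ msub sub).
  rewrite -[X in measurable X]setTI; apply: measurable_mix_state => //.
  exact: measurable_column_event.
(* At this rate the Markov factor is [exp m], a constant per integrated coordinate. *)
pose q := m%:R / t ^+ 2.
have t20 : 0 < t ^+ 2 by rewrite exprn_gt0.
have q0 : 0 < q by rewrite divr_gt0.
apply: (@le_trans _ _ ((expR (- m%:R))^-1%:E * \int[P]_w (expR (- (q * h (X^~ w))))%:E)%E).
  apply: chernoff; [exact: expR_gt0|exact: msub| |by move=> w; exact: expR_ge0|].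
  - apply: measurableT_comp => //; apply: measurableT_comp => //.
    by apply: measurable_funM.
  - move=> w /= hw; rewrite ler_expR lerN2.
    have -> : m%:R = q * t ^+ 2 by rewrite /q divfK ?gt_eqF.
    by rewrite ler_pM2l.
have e0 : (0 <= (expR (- m%:R))^-1%:E :> \bar R)%E by rewrite lee_fin invr_ge0 expR_ge0.
have := expectation_column_le indX sigma_gt0 normalX c pPm PmQ0 m0' q0 sm0 sml trPm'.
move=> /(lee_wpmul2l e0)/le_trans; apply.
rewrite -EFinM lee_fin -expRN opprK.
apply: (@le_trans _ _ (4 ^+ m * (2 * D%:R / (q * sm ^+ 2 * m%:R)) ^+ m)).
  apply: ler_wpM2r; last exact: expR_nat_le4.
  apply: exprn_ge0; apply: divr_ge0; first by rewrite mulr_ge0.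
  by rewrite mulr_ge0// mulr_ge0 ?sqr_ge0// ltW.
rewrite -exprMn le_eqVlt; apply/orP; left; apply/eqP; congr (_ ^+ _).
by rewrite /q; field; rewrite !gt_eqF.
Qed.

End column_event.

(** * Small singular directions *)

Section singular_vectors.
Context {R : realType} {D : nat}.
Local Notation C := R[i].

Lemma coordproj_predD1 (J : {pred 'I_D}) (i : 'I_D) (v : 'cV[C]_D) : i \in J -> v i 0 = 1 ->
  coordproj J *m v = coordproj [predD1 J & i] *m v + delta_mx i 0.
Proof.
move=> iJ vi; apply/colP => r; rewrite [RHS]mxE !mul_coordproj [delta_mx i 0 r 0]mxE inE /= andbT.
have [->|ri] /= := eqVneq r i; first by rewrite iJ vi mul1r mul0r add0r.
by rewrite addr0.
Qed.

(* If [k] directions supported on [J] are nearly annihilated, one of the [D]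
   coordinates carries a fraction [k/D] of their span. *)
Lemma small_column (M : 'M[C]_D) (Kp J : {pred 'I_D}) (kap : R) (U : 'M[C]_D) (L : {set 'I_D}) (k : nat) :
  let T := coordproj Kp *m M *m coordproj J in
  U ^t* *m U = 1%:M -> (forall l i : 'I_D, l \in L -> i \notin J -> U i l = 0) ->
  (forall c : 'cV[C]_D, (forall l, l \notin L -> c l 0 = 0) ->
     n2 (T *m (U *m c)) <= kap ^+ 2 * n2 c) ->
  (0 < k)%N -> (k <= #|L|)%N ->
  exists2 i, i \in J & exists u : 'cV[C]_D,
    k%:R * n2 (coordproj Kp *m M *m coordproj [predD1 J & i] *m u +
               coordproj Kp *m M *m delta_mx i 0) <= kap ^+ 2 * D%:R.
Proof.
move=> T UU UJ UL k0 kL.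
(* The squared length of the projection of [e_i] onto the span of the directions in [L]. *)
pose p i := \sum_(l in L) nsq (U i l).
have p_ge0 i : 0 <= p i by apply: sumr_ge0 => l _; exact: nsq_ge0.
have sump : \sum_i p i = #|L|%:R.
  rewrite /p exchange_big /= -sum1_card natr_sum; apply: eq_bigr => l lL.
  have : n2 (U *m delta_mx l 0) = 1.
    rewrite n2_unitary// /n2 (bigD1 l)//= mxE !eqxx big1 ?addr0 => [|j jl].
      by rewrite /nsq /= expr1n expr0n addr0.
    by rewrite mxE (negbTE jl) nsq0.
  by move=> <-; apply: eq_bigr => i _; rewrite -colE mxE.
have [i pi] : exists i, k%:R <= D%:R * p i.
  apply/existsP; rewrite -[X in is_true X]negbK; apply/negP => /existsPn h.
  have : D%:R * \sum_i p i < \sum_(i < D) k%:R.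
    rewrite mulr_sumr; have [i0 _] : exists i : 'I_D, true.
      have /card_gt0P[i iL] : (0 < #|L|)%N by exact: leq_trans k0 kL.
      by exists i.
    rewrite (bigD1 i0)//= [ltRHS](bigD1 i0)//=; apply: ltr_leD; first by rewrite ltNge.
    by apply: ler_sum => i _; rewrite leNgt; apply/negP => /ltW hh; move: (h i); rewrite hh.
  rewrite sump sumr_const card_ord -[k%:R *+ D]mulr_natl ltNge => /negP; apply.
  by rewrite ler_wpM2l// ler_nat.
have pi0 : 0 < p i.
  have : 0 < D%:R * p i by apply: lt_le_trans pi; rewrite ltr0n.
  by rewrite pmulr_rgt0// ltr0n; exact: leq_ltn_trans (leq0n i) (ltn_ord i).
have iJ : i \in J.
  apply: contraLR pi0 => iJ; rewrite -leNgt /p big1// => l lL.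
  by rewrite UJ// nsq0.
exists i => //.
(* [U c] is the projection of [e_i] onto the span, divided by [p i]: the shortest vector of the span
   whose coordinate [i] is 1. *)
pose c : 'cV[C]_D := \col_l (if l \in L then (U i l)^* * Complex (p i)^-1 0 else 0).
pose v := U *m c.
have vi : v i 0 = 1.
  rewrite mxE (bigID (mem L))/= [X in _ + X]big1 ?addr0 => [|l lL]; last by rewrite mxE (negbTE lL) mulr0.
  transitivity (Complex (p i) 0 * Complex (p i)^-1 0); last first.
    by rewrite CompM divff ?gt_eqF.
  rewrite /p Comp_sum mulr_suml; apply: eq_bigr => l lL.
  by rewrite mxE lL mulrA nsqE [U i l * _]mulrC.
have cJ : coordproj J *m v = v.
  apply/colP => r; rewrite mul_coordproj; have [rJ|rJ] := boolP (r \in J); first by rewrite mul1r.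
  rewrite mul0r mxE big1// => l _; rewrite mxE; case: ifPn => lL; last by rewrite mulr0.
  by rewrite (UJ l r)// mul0r.
have cn : n2 c = (p i)^-1.
  rewrite /n2 (bigID (mem L))/= [X in _ + X]big1 ?addr0 => [|l lL]; last by rewrite mxE (negbTE lL) nsq0.
  transitivity (\sum_(l in L) nsq (U i l) * (p i)^-1 ^+ 2).
    by apply: eq_bigr => l lL; rewrite mxE lL nsqM nsq_conj nsq_real.
  by rewrite -mulr_suml -/(p i) expr2 mulrA divff ?gt_eqF// mul1r.
exists v.
have -> : coordproj Kp *m M *m coordproj [predD1 J & i] *m v + coordproj Kp *m M *m delta_mx i 0 =
    T *m v.
  by rewrite /T -[_ *m coordproj J *m v]mulmxA (coordproj_predD1 iJ vi) mulmxDr mulmxA.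
have := UL c; rewrite cn => /(_ _)/wrap[|hT].
  by move=> l lL; rewrite mxE (negbTE lL).
have k0' : 0 < k%:R :> R by rewrite ltr0n.
apply: (@le_trans _ _ (k%:R * (kap ^+ 2 / p i))); first by rewrite ler_pM2l.
rewrite mulrCA ler_wpM2l ?sqr_ge0// ler_pdivrMr//.
Qed.

Lemma le_sqr_double (a th : R) : a <= 2 * th ^+ 2 -> a <= (2 * th) ^+ 2.
Proof. by move=> /le_trans; apply; rewrite exprMn ler_wpM2r ?sqr_ge0// expr2; lra. Qed.

Lemma quarter_le_sqr (a b th : R) : 1 <= a + b -> b <= 2 * th -> th <= 4^-1 -> 4^-1 <= a ^+ 2.
Proof. by move=> h1 h2 h3; nra. Qed.

Lemma three_theta (kap rad th : R) : 0 < th -> kap <= rad ->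
  th * kap + rad * (2 * th) <= 3 * th * rad.
Proof. by move=> h1 h2; nra. Qed.

(** Replaces an arbitrary nearly annihilated vector by one of finitely many. After normalization its
    coefficients outside [L] have mass at most [theta^2], since [T] would enlarge them; those in [L]
    are rounded by the net. In the rows [I2] the shift [lam] drops out, because [I2] does not meet
    [J]. *)
Lemma small_vector_of_net (Kp J I2 : {pred 'I_D}) (kap theta rad : R) (H : 'M[C]_D)
    (lam : C) (U : 'M[C]_D) (L : {set 'I_D}) (Z : seq ({l | l \in L} -> C)) (u : 'cV[C]_D) :
  let T := coordproj Kp *m (H - lam%:M) *m coordproj J in
  let vec (z : {l | l \in L} -> C) : 'cV[C]_D :=
    U *m \col_l (if insub l is Some l' then z l' else 0) in
  U ^t* *m U = 1%:M -> U *m U ^t* = 1%:M ->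
  (forall l i : 'I_D, l \in L -> i \notin J -> U i l = 0) ->
  (forall y : 'cV[C]_D, coordproj J *m y = y ->
     kap ^+ 2 * \sum_(l | l \notin L) nsq ((U ^t* *m y) l 0) <= n2 (T *m y)) ->
  (forall c : {l | l \in L} -> C, \sum_l nsq (c l) <= 1 ->
     exists z, [/\ List.In z Z, \sum_l nsq (c l - z l) <= theta ^+ 2 & \sum_l nsq (z l) <= 1]) ->
  (forall r, r \in I2 -> r \notin J) ->
  0 < kap -> kap <= rad -> 0 < theta -> theta <= 4^-1 ->
  (forall v : 'cV[C]_D, nv (H *m v) <= rad * nv v) ->
  nv ((H - lam%:M) *m coordproj J *m u) < theta * kap * nv (coordproj J *m u) ->
  exists2 z, List.In z Z & [/\ coordproj J *m vec z = vec z, 4^-1 <= n2 (vec z) &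
    nv (coordproj I2 *m H *m vec z) <= 3 * theta * rad].
Proof.
move=> T vec UU UU' UJ Ularge netZ I2J kap0 kaprad theta0 theta4 Hrad hu.
have nu0 : 0 < nv (coordproj J *m u).
  rewrite lt_neqAle nv_ge0 andbT; apply/eqP => e0; move: hu; rewrite -e0 mulr0 ltNge nv_ge0.
  by [].
pose s := Complex (nv (coordproj J *m u))^-1 0 : C.
pose y := s *: (coordproj J *m u).
have JJ : coordproj J *m coordproj J = coordproj J :> 'M[C]_D by case: (orthoproj_coordproj (R := R) J).
have Jy : coordproj J *m y = y by rewrite /y -scalemxAr mulmxA JJ.
have nvs (v : 'cV[C]_D) : nv (s *: v) = (nv (coordproj J *m u))^-1 * nv v.
  by rewrite nvZ_real ger0_norm// invr_ge0 nv_ge0.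
have nvy : nv y = 1 by rewrite nvs mulVf// gt_eqF.
have n2y : n2 y = 1 by rewrite -sqr_nv nvy expr1n.
have My : nv ((H - lam%:M) *m y) <= theta * kap.
  rewrite /y -scalemxAr nvs mulmxA mulrC ler_pdivrMr//; exact: ltW.
have Ty : n2 (T *m y) <= (theta * kap) ^+ 2.
  rewrite /T -[_ *m coordproj J *m y]mulmxA Jy -mulmxA.
  apply: le_trans (n2_coordproj_le _ _) _; rewrite -sqr_nv.
  by rewrite lerXn2r ?nnegrE ?nv_ge0// mulr_ge0 ?ltW.
pose c := U ^t* *m y.
have n2c : n2 c = 1.
  by rewrite /c n2_unitary// trmxCK.
have tail : \sum_(l | l \notin L) nsq (c l 0) <= theta ^+ 2.
  have := le_trans (Ularge y Jy) Ty; rewrite exprMn [X in _ <= X]mulrC ler_pM2l//.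
  by rewrite exprn_gt0.
have sumL (f : 'I_D -> R) : \sum_(l : {l | l \in L}) f (val l) = \sum_(l in L) f l.
  exact/esym/big_sub.
have cL : \sum_(l : {l | l \in L}) nsq (c (val l) 0) <= 1.
  rewrite (sumL (fun l => nsq (c l 0))) -n2c /n2 [leRHS](bigID (mem L))/= lerDl.
  by apply: sumr_ge0 => l _; exact: nsq_ge0.
have [z [zZ cz z1]] := netZ (fun l => c (val l) 0) cL.
exists z => //.
pose ext : 'cV[C]_D := \col_l (if insub l is Some l' then z l' else 0).
have extL (l : {l | l \in L}) : ext (val l) 0 = z l by rewrite mxE valK.
have extN l : l \notin L -> ext l 0 = 0 by move=> lL; rewrite mxE insubN.
have Jv : coordproj J *m vec z = vec z.
  apply/colP => r; rewrite mul_coordproj; have [rJ|rJ] := boolP (r \in J); first by rewrite mul1r.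
  rewrite mul0r /vec -/ext mxE big1// => l _.
  have [lL|lL] := boolP (l \in L); last by rewrite extN// mulr0.
  by rewrite UJ// mul0r.
have dist : n2 (y - vec z) <= 2 * theta ^+ 2.
  have -> : y - vec z = U *m (c - ext).
    by rewrite mulmxBr /c mulmxA UU' mul1mx.
  rewrite n2_unitary// /n2 (bigID (mem L))/= mulr_natl mulr2n lerD//.
    rewrite -(sumL (fun l => nsq ((c - ext) l 0))).
    rewrite (eq_bigr (fun l : {l : 'I_D | l \in L} => nsq (c (val l) 0 - z l))) => [//|l _].
    by rewrite [(c - ext) _ _]mxE [X in _ + X]mxE extL.
  apply: (le_trans _ tail); apply: ler_sum => l lL.
  by rewrite [(c - ext) _ _]mxE [X in _ + X]mxE extN// subr0.
have nvdist : nv (y - vec z) <= 2 * theta.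
  rewrite -(@ler_pXn2r _ 2)// ?nnegrE ?nv_ge0//; last by rewrite mulr_ge0// (ltW theta0).
  by rewrite sqr_nv; exact: le_sqr_double dist.
split => //.
  have : nv y <= nv (vec z) + nv (y - vec z).
    by apply: le_trans (nvD_le _ _); rewrite addrC subrK.
  by rewrite nvy -sqr_nv => h; exact: quarter_le_sqr h nvdist theta4.
have yJ r : r \notin J -> y r 0 = 0.
  by move=> rJ; rewrite -Jy mul_coordproj (negbTE rJ) mul0r.
have -> : coordproj I2 *m H *m vec z =
    coordproj I2 *m ((H - lam%:M) *m y) - coordproj I2 *m (H *m (y - vec z)).
  rewrite -mulmxBr -[LHS]mulmxA [H *m (y - _)]mulmxBr mulmxBl mul_scalar_mx.
  apply/colP => r; rewrite !mul_coordproj.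
  have [rI|_] := boolP (r \in I2); last by rewrite !mul0r.
  congr (_ * _).
  have E (a b : 'cV[C]_D) : (a - b) r 0 = a r 0 - b r 0 by rewrite mxE [X in _ + X]mxE.
  rewrite !E [(lam *: y) r 0]mxE yJ ?I2J// mulr0 subr0.
  by rewrite opprB addrC subrK.
apply: le_trans (nvB_le _ _) _.
have rad0 : 0 < rad := lt_le_trans kap0 kaprad.
have h1 := le_trans (nv_coordproj_le I2 ((H - lam%:M) *m y)) My.
have h2 := le_trans (nv_coordproj_le I2 (H *m (y - vec z))) (Hrad _).
have := lerD h1 (le_trans h2 (ler_wpM2l (ltW rad0) nvdist)); move/le_trans; apply.
exact: three_theta.
Qed.

End singular_vectors.

(** * Fresh rows applied to a fixed vector *)

Definition block_positions {D : nat} (I2 J : {pred 'I_D}) : seq ('I_D * 'I_D) :=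
  [seq p <- enum {: 'I_D * 'I_D} | (p.1 \in I2) && (p.2 \in J)].

Lemma sum_block_positions (V : nmodType) (D : nat) (I2 J : {pred 'I_D}) (r : 'I_D)
    (G : 'I_D * 'I_D -> V) :
  \sum_(p <- block_positions I2 J | p.1 == r) G p =
  if r \in I2 then \sum_(j in J) G (r, j) else 0.
Proof.
rewrite /block_positions big_filter_cond big_enum_cond /=.
have [rI|rI] := boolP (r \in I2); last first.
  by rewrite big1// => p /andP[/andP[pI _] /eqP pr]; move: rI; rewrite -pr pI.
rewrite (reindex_onto (fun j => (r, j)) snd) /=; last first.
  by move=> [a b] /= /andP[_ /eqP ->].
by apply: eq_bigl => j; rewrite rI !eqxx !andbT.
Qed.

Section small_image.
Context {R : realType} {D : nat}.
Local Notation C := R[i].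
Local Notation pos := ('I_D * 'I_D)%type.
Local Notation I := (('I_D * 'I_D) * bool)%type.
Local Notation state := (state R I).
Context {d : measure_display} {T : measurableType d} {P : probability T R}
  (X : I -> {RV P >-> R}) (sigma : 'I_D -> 'I_D -> R) (H0 : 'M[C]_D).
Hypothesis indX : mutually_independent X.
Hypothesis sigma_gt0 : forall i j, 0 < sigma i j.
Hypothesis normalX : forall i j (b : bool), is_normal0 (X (i, j, b)) (sigma i j / Num.sqrt 2).

Local Notation hamiltonian := (hamiltonian H0).

Definition block_coords (I2 J : {pred 'I_D}) : {set I} :=
  coordset [set p : pos | (p.1 \in I2) && (p.2 \in J)]%SET.

(** The mirrored position [(j, r)] is not resampled, as [I2] and [J] are disjoint; it only enters
    the constant. *)
Lemma hamiltonian_mix_block (I2 J : {pred 'I_D}) (x y : state) r j :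
  (forall r, r \in I2 -> r \notin J) -> r \in I2 -> j \in J ->
  hamiltonian (mix (block_coords I2 J) y x) r j =
  entry (r, j) x * rsqrt2 + (H0 r j + rsqrt2 * (entry (j, r) y)^* ).
Proof.
move=> I2J rI jJ; rewrite hamiltonianE !entry_mix !inE /= rI jJ /=.
rewrite (negbTE (I2J r rI)) andbF mulrDr addrCA; congr (_ + _); exact: mulrC.
Qed.

Lemma hamiltonian_mix_off (I2 J : {pred 'I_D}) (x y : state) r j :
  (forall r, r \in I2 -> r \notin J) -> r \notin I2 -> j \in J ->
  hamiltonian (mix (block_coords I2 J) y x) r j = hamiltonian y r j.
Proof.
move=> I2J rI jJ; rewrite !hamiltonianE !entry_mix !inE /= (negbTE rI) /=.
suff /negbTE -> : j \notin I2 by [].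
by apply/negP => /I2J; rewrite jJ.
Qed.

(** Each of the independent rows in [I2] has variance at least [sm^2 / 8], a half coming from
    [rsqrt2] and a quarter from [n2 w]. The 32 is this 8 times the bound 4 for [e]. *)
Lemma probability_small_image (I2 J : {pred 'I_D}) (y : state) (w : 'cV[C]_D) (t sm : R) :
  (forall r, r \in I2 -> r \notin J) -> coordproj J *m w = w -> 4^-1 <= n2 w ->
  0 < t -> 0 < sm -> (forall i j, sm <= sigma i j) -> (0 < #|I2|)%N ->
  let E := [set x : state | (nv (coordproj I2 *m hamiltonian x *m w) <= t)%R] in
  measurable E /\
  (P ((fun om => mix (block_coords I2 J) y (X^~ om) : state) @^-1` E) <=
   ((32 * t ^+ 2 / (sm ^+ 2 * #|I2|%:R)) ^+ #|I2|)%:E)%E.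
Proof.
move=> I2J Jw w4 t0 sm0 sml I20 E.
have mf : measurable_fun setT (fun x : state => nv (coordproj I2 *m hamiltonian x *m w)).
  apply: measurable_nv; apply: mxmeasurableM; last exact: mxmeasurable_cst.
  by apply: mxmeasurableM; [exact: mxmeasurable_cst|exact: mxmeasurable_hamiltonian].
have mE : measurable E by exact: measurable_set_le.
split=> //.
have d0 : 0 < #|I2|%:R :> R by rewrite ltr0n.
pose u (p : pos) := rsqrt2 * w p.2 0.
pose c r := if r \in I2 then \sum_(j in J) (H0 r j + rsqrt2 * (entry (j, r) y)^* ) * w j 0 else 0.
(* With this width the Markov factor is one [e] per row. *)
pose b : R := t ^+ 2 / #|I2|%:R.
have t20 : 0 < t ^+ 2 by rewrite exprn_gt0.
have b0 : 0 < b by rewrite divr_gt0.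
have wJ j : j \notin J -> w j 0 = 0.
  by move=> jJ; rewrite -Jw mul_coordproj (negbTE jJ) mul0r.
have n2wE : \sum_(j in J) nsq (w j 0) = n2 w.
  by rewrite -n2_coordproj Jw.
have rowE x r : (coordproj I2 *m hamiltonian (mix (block_coords I2 J) y x) *m w) r 0 =
    \sum_(p <- block_positions I2 J | p.1 == r) entry p x * u p + c r.
  rewrite sum_block_positions /c -mulmxA mul_coordproj.
  have [rI|rI] := boolP (r \in I2); last by rewrite mul0r addr0.
  rewrite mul1r mxE (bigID (mem J))/= [X in _ + X]big1 ?addr0 => [|j jJ]; last by rewrite wJ// mulr0.
  rewrite -big_split/=; apply: eq_bigr => j jJ.
  by rewrite hamiltonian_mix_block// mulrDl /u /= mulrA.
have key := @expectation_rows_le R D d T P X sigma indX sigma_gt0 normalX (block_positions I2 J) u c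
  (fun=> b) (filter_uniq _ (enum_uniq _)) (fun=> b0).
pose g := fun x : state => nv (coordproj I2 *m hamiltonian x *m w).
have fE om : \sum_r nsq (\sum_(p <- block_positions I2 J | p.1 == r) entry p (X^~ om) * u p + c r) / b =
    g (mix (block_coords I2 J) y (X^~ om)) ^+ 2 / b.
  rewrite -mulr_suml; congr (_ / _); rewrite /g sqr_nv /n2.
  by apply: eq_bigr => r _; rewrite rowE.
have mmix := @measurable_mix_state R I d T P X (block_coords I2 J) y.
have mg : measurable_fun [set: T] (fun om => g (mix (block_coords I2 J) y (X^~ om))).
  exact: measurableT_comp mf mmix.
apply: (@le_trans _ _ ((expR (- #|I2|%:R))^-1%:E * \int[P]_om
    (expR (- (g (mix (block_coords I2 J) y (X^~ om)) ^+ 2 / b)))%:E)%E).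
  apply: chernoff; [exact: expR_gt0| | |by move=> om; exact: expR_ge0|].
  - by rewrite -[X in measurable X]setTI; exact: mmix.
  - apply: measurableT_comp => //; apply: measurableT_comp => //.
    by apply: measurable_funM => //; exact: measurable_funX.
  - move=> om /= hom; rewrite ler_expR lerN2 ler_pdivrMr//.
    have -> : #|I2|%:R * b = t ^+ 2 by rewrite /b mulrC divfK ?gt_eqF.
    by rewrite lerXn2r ?nnegrE ?nv_ge0 ?(ltW t0).
have e0 : (0 <= (expR (- #|I2|%:R))^-1%:E :> \bar R)%E by rewrite lee_fin invr_ge0 expR_ge0.
under eq_integral do rewrite -fE.
apply: le_trans (lee_wpmul2l e0 key) _.
rewrite -EFinM lee_fin -expRN opprK.
apply: (@le_trans _ _ (4 ^+ #|I2| * (8 * t ^+ 2 / (sm ^+ 2 * #|I2|%:R)) ^+ #|I2|)).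
  apply: ler_pM; [exact: expR_ge0| |exact: expR_nat_le4|].
    apply: prodr_ge0 => r _; rewrite divr_ge0 ?(ltW b0)// addr_ge0 ?(ltW b0)//.
    by apply: sumr_ge0 => p _; rewrite mulr_ge0 ?sqr_ge0 ?nsq_ge0.
  rewrite (bigID (mem I2))/= [X in _ * X]big1 ?mulr1 => [|r rI]; last first.
    by rewrite sum_block_positions (negbTE rI) addr0 divff ?gt_eqF.
  rewrite -prodr_const; apply: ler_prod => r rI; rewrite sum_block_positions rI /=.
  have S8 : sm ^+ 2 / 8 <= \sum_(j in J) sigma r j ^+ 2 * nsq (u (r, j)).
    apply: (@le_trans _ _ (\sum_(j in J) sm ^+ 2 * (nsq (w j 0) / 2))).
      rewrite -mulr_sumr -mulr_suml n2wE ler_wpM2l ?sqr_ge0//; lra.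
    apply: ler_sum => j jJ; rewrite /u nsqM nsq_rsqrt2 /= div1r [X in _ <= _ * X]mulrC.
    apply: ler_wpM2r; first by rewrite divr_ge0 ?nsq_ge0.
    by rewrite lerXn2r ?nnegrE ?(ltW sm0) ?(ltW (sigma_gt0 _ _)).
  have s80 : 0 < sm ^+ 2 / 8 by rewrite divr_gt0 ?exprn_gt0.
  have S0 := lt_le_trans s80 S8.
  have bS0 := addr_gt0 b0 S0.
  rewrite divr_ge0 ?(ltW b0) ?(ltW bS0)//=.
  apply: (@le_trans _ _ (b / (sm ^+ 2 / 8))).
    rewrite ler_pM2l// lef_pV2 ?posrE//; apply: le_trans S8 _.
    by rewrite lerDr ltW.
  rewrite le_eqVlt; apply/orP; left; apply/eqP; rewrite /b; field.
  by rewrite !gt_eqF.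
rewrite -exprMn le_eqVlt; apply/orP; left; apply/eqP; congr (_ ^+ _).
field; by rewrite !gt_eqF.
Qed.

End small_image.

Lemma coordprojM_sub (R : realType) (D : nat) (Q K : {pred 'I_D}) :
  {subset Q <= K} -> coordproj Q *m coordproj K = coordproj Q :> 'M[R[i]]_D.
Proof.
move=> QK; apply/matrixP => r j; rewrite mul_coordproj !mxE.
have [rQ|rQ] := boolP (r \in Q); first by rewrite mul1r (QK r).
by rewrite mul0r andbF.
Qed.

Lemma coordproj_sandwich_eq (R : realType) (D : nat) (Q K : {pred 'I_D}) (A B : 'M[R[i]]_D) :
  (forall r j, r \in Q -> j \in K -> A r j = B r j) ->
  coordproj Q *m A *m coordproj K = coordproj Q *m B *m coordproj K.
Proof.
move=> AB; rewrite -!mulmxA; apply/matrixP => r j; rewrite !mul_coordproj.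
have [rQ|_] := boolP (r \in Q); last by rewrite !mul0r.
congr (_ * _); rewrite !mxE; apply: eq_bigr => l _.
have [lK|lK] := boolP (l \in K); first by rewrite AB.
by rewrite [coordproj K l j]mxE (negbTE lK) andbF !mulr0.
Qed.

Lemma InP (A : eqType) (a : A) (s : seq A) : reflect (List.In a s) (a \in s).
Proof.
apply: (iffP idP); elim: s => //= b s IH.
  by rewrite in_cons => /predU1P[->|/IH]; [left|right].
by rewrite in_cons => -[->|/IH ->]; rewrite ?eqxx ?orbT.
Qed.

(** * Probability that the columns off the block are nearly dependent *)

Section singular_event.
Context {R : realType} {D : nat}.
Local Notation C := R[i].
Local Notation pos := ('I_D * 'I_D)%type.
Local Notation I := (('I_D * 'I_D) * bool)%type.
Local Notation state := (state R I).
Context {d : measure_display} {T : measurableType d} {P : probability T R}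
  (X : I -> {RV P >-> R}) (sigma : 'I_D -> 'I_D -> R) (H0 : 'M[C]_D).
Hypothesis indX : mutually_independent X.
Hypothesis sigma_gt0 : forall i j, 0 < sigma i j.
Hypothesis normalX : forall i j (b : bool), is_normal0 (X (i, j, b)) (sigma i j / Num.sqrt 2).

Local Notation hamiltonian := (hamiltonian H0).
Local Notation shifted := (shifted H0).

Definition singular_event (J : {pred 'I_D}) (lam : C) (beta : R) : set state :=
  [set x | exists u : 'cV[C]_D,
     nv (shifted lam x *m coordproj J *m u) < beta * nv (coordproj J *m u)].

Lemma measurable_singular_event J lam beta : 0 <= beta -> measurable (singular_event J lam beta).
Proof.
move=> beta0.
have := @measurable_exists_nv_lt R _ state D D D
  (fun x => shifted lam x *m coordproj J) (fun=> 0) (coordproj J) beta 0.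
have -> : [set x | exists u : 'cV[C]_D,
     nv (shifted lam x *m coordproj J *m u + 0) < beta * nv (coordproj J *m u) + 0] =
  singular_event J lam beta.
  by apply/seteqP; split => x [u hu]; exists u; move: hu; rewrite !addr0.
apply; [|exact: (mxmeasurable_cst 0)|exact: beta0].
by apply: mxmeasurableM; [exact: mxmeasurable_shifted|exact: mxmeasurable_cst].
Qed.

(** Removing [i] from the rows as well as from the columns avoids the diagonal entry and leaves the
    surplus of rows over columns unchanged. *)
Definition column_events (I2 J : {pred 'I_D}) (lam : C) (t : R) : set state :=
  [set x | exists2 i, List.In i (enum J) &
     column_event H0 [pred r | (r \notin I2) && (r != i)] [predD1 J & i] i lam t x].

Lemma measurable_column_events I2 J lam t : measurable (column_events I2 J lam t).
Proof. by apply: measurable_list_union => i _; exact: measurable_column_event. Qed.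

Lemma probability_column_events (I2 J : {pred 'I_D}) (lam : C) (t sm : R) (m : nat) :
  (forall r, r \in I2 -> r \notin J) -> (2 * m + #|J| + #|I2| <= D)%N -> (0 < m)%N ->
  0 < t -> 0 < sm -> (forall i j, sm <= sigma i j) ->
  (P ((fun w => (X^~ w : state)) @^-1` column_events I2 J lam t) <=
   (D%:R * (8 * D%:R * t ^+ 2 / (sm ^+ 2 * m%:R ^+ 2)) ^+ m)%:E)%E.
Proof.
move=> I2J cardD m0 t0 sm0 sml.
set x1 := _ ^+ m.
have x10 : 0 <= x1.
  by apply: exprn_ge0; apply: divr_ge0; apply: mulr_ge0; rewrite ?sqr_ge0 ?mulr_ge0.
have mX := measurable_RVs X.
apply: (@le_trans _ _ ((size (enum J))%:R * x1)%:E); last first.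
  rewrite lee_fin ler_wpM2r// ler_nat -cardE; apply: leq_trans (max_card _) _.
  by rewrite card_ord.
apply: (@union_bound R d T P _ (enum J)
  (fun i => (fun w => (X^~ w : state)) @^-1` column_event H0 _ _ i lam t)).
  move=> i _; rewrite -[X in measurable X]setTI; apply: mX => //.
  exact: measurable_column_event.
move=> i /InP; rewrite mem_enum => iJ.
apply: (probability_column_event H0 indX sigma_gt0 normalX) => //; rewrite ?inE ?eqxx ?andbF//.
have -> : #|[predD1 J & i]| = #|J|.-1 by rewrite (cardD1 i J) iJ.
have -> : #|[pred r | (r \notin I2) && (r != i)]| = (D - #|I2|).-1.
  have iI2 : i \in [predC I2] by rewrite inE; apply/negP => /I2J; rewrite iJ.
  have -> : (D - #|I2|)%N = #|[predC I2]| by rewrite -(addKn #|I2| #|[predC I2]|) cardC card_ord.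
  rewrite (cardD1 i [predC I2]) iI2 /=.
  by apply: eq_card => r; rewrite !inE andbC.
have : (0 < #|J|)%N by apply/card_gt0P; exists i.
lia.
Qed.

(** With everything but the positions [I2 x J] frozen, the singular directions of the other rows are
    deterministic. If at least [k0] are small, [small_column] produces a column event, which is
    excluded; otherwise a net of their span is fixed before the fresh entries are drawn, and the
    union bound applies. *)
Lemma probability_singular_block (I2 J : {pred 'I_D}) (lam : C) (kap theta rad t sm : R) (k0 : nat)
    (G : set state) :
  (forall r, r \in I2 -> r \notin J) -> (0 < #|I2|)%N -> (0 < k0)%N ->
  0 < kap -> kap <= rad -> 0 < theta -> theta <= 4^-1 -> 0 < t -> 0 < sm ->
  (forall i j, sm <= sigma i j) -> kap ^+ 2 * D%:R < t ^+ 2 * k0%:R ->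
  measurable G -> (forall x, G x -> forall v, nv (hamiltonian x *m v) <= rad * nv v) ->
  (P ((fun w => (X^~ w : state)) @^-1`
      ((singular_event J lam (theta * kap) `&` G) `\` column_events I2 J lam t)) <=
   ((16 / theta) ^+ (2 * k0) *
    (32 * (3 * theta * rad) ^+ 2 / (sm ^+ 2 * #|I2|%:R)) ^+ #|I2|)%:E)%E.
Proof.
move=> I2J I20 k00 kap0 kaprad th0 th4 t0 sm0 sml hk mG Grad.
have rad0 : 0 < rad := lt_le_trans kap0 kaprad.
set x2 := _ ^+ #|I2|.
have x20 : 0 <= x2.
  by apply: exprn_ge0; apply: divr_ge0; apply: mulr_ge0; rewrite ?sqr_ge0.
have c0 : 0 <= (16 / theta) ^+ (2 * k0) * x2.
  by rewrite mulr_ge0// exprn_ge0// divr_ge0// ltW.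
have mA : measurable ((singular_event J lam (theta * kap) `&` G) `\` column_events I2 J lam t).
  apply: measurableD; last exact: measurable_column_events.
  by apply: measurableI => //; apply: measurable_singular_event; rewrite mulr_ge0// ltW.
apply: (@conditioning_le R I d T P X indX (block_coords I2 J)) => //.
move=> y.
have mmix := @measurable_mix_state R I d T P X (block_coords I2 J) y.
pose Tm x := coordproj [predC I2] *m shifted lam x *m coordproj J.
have TE om : Tm (mix (block_coords I2 J) y (X^~ om)) = Tm y.
  apply: coordproj_sandwich_eq => r j; rewrite inE => rI jJ.
  by rewrite !shiftedE hamiltonian_mix_off.
have TJ : Tm y *m coordproj J = Tm y.
  rewrite /Tm -mulmxA; congr (_ *m _).
  by have [_ ->] := orthoproj_coordproj (R := R) J.
have [U [L [UU UU' UJ Usmall Ularge]]] := spectral_split kap0 TJ.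
have [kL|Lk] := leqP k0 #|L|.
  rewrite (_ : _ @^-1` _ = set0) ?measure0 ?lee_fin//.
  apply/seteqP; split => // om /= [_]; apply.
  set x := mix _ _ _.
  have [|i iJ [u hu]] := @small_column R D (shifted lam x) [predC I2] J kap U L k0 UU UJ _ k00 kL.
    by move=> c cL; move: (Usmall c cL); rewrite -(TE om).
  exists i; first by apply/InP; rewrite mem_enum.
  exists u.
  set Q := [pred r | _].
  (* A column event also omits row [i], which only shortens the vector. *)
  have QK : {subset Q <= [predC I2]} by move=> r; rewrite !inE => /andP[].
  rewrite -(coordprojM_sub R QK) -!mulmxA -mulmxDr.
  apply: le_lt_trans (nv_coordproj_le _ _) _.
  rewrite -(@ltr_pXn2r _ 2)// ?nnegrE ?nv_ge0 ?(ltW t0)// sqr_nv.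
  have k0' : 0 < k0%:R :> R by rewrite ltr0n.
  rewrite -(ltr_pM2r k0') mulrC; apply: le_lt_trans hk.
  by move: hu; rewrite !mulmxA.
have th01 : 0 < theta <= 1 by rewrite th0 (le_trans th4)// invf_le1// ler1n.
have [Z [sizeZ netZ]] := @complex_net R {l : 'I_D | l \in L} theta th01.
pose vec (z : {l : 'I_D | l \in L} -> C) : 'cV[C]_D :=
  U *m \col_l (if insub l is Some l' then z l' else 0).
pose good z := (coordproj J *m vec z = vec z) /\ 4^-1 <= n2 (vec z).
pose E z := [set om | good z /\
   (nv (coordproj I2 *m hamiltonian (mix (block_coords I2 J) y (X^~ om)) *m vec z) <= 3 * theta * rad)%R].
have t30 : 0 < 3 * theta * rad by rewrite !mulr_gt0.
have EP z : measurable (E z) /\ (P (E z) <= x2%:E)%E.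
  have [gz|ngz] := pselect (good z); last first.
    rewrite /E (_ : [set om | _] = set0); last by apply/seteqP; split => // om /= [].
    by rewrite measure0 lee_fin; split.
  case: (gz) => Jz z4.
  have [mE PE] := probability_small_image H0 indX sigma_gt0 normalX y I2J Jz z4 t30 sm0 sml I20.
  rewrite /E (_ : [set om | _] = (fun om => mix (block_coords I2 J) y (X^~ om) : state) @^-1`
     [set x : state | (nv (coordproj I2 *m hamiltonian x *m vec z) <= 3 * theta * rad)%R]); last first.
    by apply/seteqP; split => om /= => [[]|].
  split; last exact: PE.
  by rewrite -[X in measurable X]setTI; apply: mmix.
have mU : measurable [set om | exists2 z, List.In z Z & E z om].
  by apply: measurable_list_union => z _; have [] := EP z.
have PU : (P [set om | exists2 z, List.In z Z & E z om] <= ((size Z)%:R * x2)%:E)%E.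
  by apply: union_bound => z _; have [] := EP z.
have Zle : (size Z)%:R * x2 <= (16 / theta) ^+ (2 * k0) * x2.
  rewrite ler_wpM2r//; apply: le_trans sizeZ _; rewrite card_sig ler_weXn2l//.
    by rewrite ler_pdivlMr// mul1r (le_trans th4)//; apply: (@le_trans _ _ 1); rewrite ?invf_le1// ler1n.
  by rewrite leq_pmul2l// ltnW //; apply: leq_ltn_trans Lk; rewrite (eq_card (B := mem L)).
refine (@probability_le_preimage _ _ _ P _ _ _ _ mU _ (le_trans PU _)).
- by rewrite -[X in measurable X]setTI; apply: mmix.
- move=> om /= [[[u hu] Gx] _].
  have [|z zZ [Jz z4 hz]] := @small_vector_of_net R D [predC I2] J I2 kap theta rad
    (hamiltonian (mix (block_coords I2 J) y (X^~ om))) lam U L Z u UU UU' UJ _ netZ I2J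
    kap0 kaprad th0 th4 (Grad _ Gx) hu.
    by move=> v Jv; move: (Ularge v Jv); rewrite -(TE om).
  by exists z.
by rewrite lee_fin.
Qed.

Lemma probability_singular_event (I2 J : {pred 'I_D}) (lam : C) (kap theta rad t sm : R) (k0 m : nat)
    (G : set state) :
  (forall r, r \in I2 -> r \notin J) -> (0 < #|I2|)%N -> (0 < k0)%N ->
  (2 * m + #|J| + #|I2| <= D)%N -> (0 < m)%N ->
  0 < kap -> kap <= rad -> 0 < theta -> theta <= 4^-1 -> 0 < t -> 0 < sm ->
  (forall i j, sm <= sigma i j) -> kap ^+ 2 * D%:R < t ^+ 2 * k0%:R ->
  measurable G -> (forall x, G x -> forall v, nv (hamiltonian x *m v) <= rad * nv v) ->
  (P ((fun w => (X^~ w : state)) @^-1` (singular_event J lam (theta * kap) `&` G)) <=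
   (D%:R * (8 * D%:R * t ^+ 2 / (sm ^+ 2 * m%:R ^+ 2)) ^+ m +
    (16 / theta) ^+ (2 * k0) *
    (32 * (3 * theta * rad) ^+ 2 / (sm ^+ 2 * #|I2|%:R)) ^+ #|I2|)%:E)%E.
Proof.
move=> I2J I20 k00 cardD m0 kap0 kaprad th0 th4 t0 sm0 sml hk mG Grad.
have h1 := probability_column_events lam I2J cardD m0 t0 sm0 sml.
have h2 := probability_singular_block lam I2J I20 k00 kap0 kaprad th0 th4 t0 sm0 sml hk mG Grad.
have mX := measurable_RVs X.
have mS : measurable (singular_event J lam (theta * kap) `&` G).
  by apply: measurableI => //; apply: measurable_singular_event; rewrite mulr_ge0// ltW.
have mC := measurable_column_events I2 J lam t.
have mpre (A : set state) : measurable A -> measurable ((fun w => (X^~ w : state)) @^-1` A).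
  by move=> mA; rewrite -[X in measurable X]setTI; exact: mX.
rewrite EFinD; apply: le_trans (leeD h1 h2).
apply: le_trans (measureU2 _ _ _); [|exact: mpre|by apply: mpre; exact: measurableD].
apply: le_measure; rewrite ?inE; [exact: mpre|by apply: measurableU; apply: mpre => //; exact: measurableD|].
move=> w /= Sw; have [Cw|nCw] := pselect (column_events I2 J lam t (X^~ w)); first by left.
by right.
Qed.

End singular_event.

(** * Numerical constants *)

Section failure_bound.
Context {R : realType}.

(** Up to constants the rate is [th^2 / (a^2 (d / D)^3)], and [th^2] is of order [a^4 (d / D)^4].
    One [a] is spent through [a <= 15^-1], and a factor [om] is left. *)
Lemma column_rate_le (D d k m : nat) (a om th : R) : (0 < d)%N -> (0 < D)%N -> 0 < a -> a <= 15^-1 ->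
  (d <= 9 * k)%N -> (d <= 5 * m)%N ->
  om = a * (d%:R / D%:R) -> th = (om / 40) ^+ 2 ->
  16 * D%:R ^+ 3 * th ^+ 2 / (a ^+ 2 * k%:R * m%:R ^+ 2) <= om / (100 * 100).
Proof.
move=> d0 D0 a0 a15 dk dm omE thE.
have d0' : 0 < d%:R :> R by rewrite ltr0n.
have D0' : 0 < D%:R :> R by rewrite ltr0n.
have dk' : d%:R / 9 <= k%:R :> R.
  by rewrite ler_pdivrMr// -natrM ler_nat mulnC.
have dm' : d%:R / 5 <= m%:R :> R.
  by rewrite ler_pdivrMr// -natrM ler_nat mulnC.
have d9 : 0 < d%:R / 9 :> R by rewrite divr_gt0.
have d5 : 0 < d%:R / 5 :> R by rewrite divr_gt0.
have k0 := lt_le_trans d9 dk'; have m0 := lt_le_trans d5 dm'.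
have om0 : 0 < om by rewrite omE mulr_gt0// divr_gt0.
apply: (@le_trans _ _ (16 * D%:R ^+ 3 * th ^+ 2 / (a ^+ 2 * (d%:R / 9) * (d%:R / 5) ^+ 2))).
  apply: ler_wpM2l; first by rewrite mulr_ge0 ?sqr_ge0// mulr_ge0// exprn_ge0.
  rewrite lef_pV2 ?posrE; last 2 first.
  - by rewrite !mulr_gt0// exprn_gt0.
  - by rewrite !mulr_gt0// exprn_gt0// mulr_gt0.
  apply: ler_pM; [by rewrite mulr_ge0 ?sqr_ge0 ?(ltW d9)|exact: sqr_ge0|by rewrite ler_wpM2l ?sqr_ge0|].
  by rewrite lerXn2r ?nnegrE ?(ltW d5) ?(ltW m0).
have -> : 16 * D%:R ^+ 3 * th ^+ 2 / (a ^+ 2 * (d%:R / 9) * (d%:R / 5) ^+ 2) =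
    9 / (80 * 80) * a * om.
  by rewrite thE omE; field; rewrite !gt_eqF.
rewrite mulrC ler_wpM2l ?(ltW om0)//; lra.
Qed.

(** The rate of two rows together with the one net factor that they pay for:
    [th^3 / (a^4 (d / D)^2)] is of order [om^2 (d / D)^2]. *)
Lemma net_rate_le (D d d2 : nat) (a om th : R) : (0 < d)%N -> (d <= D)%N -> 0 < a ->
  (d <= 2 * d2)%N ->
  om = a * (d%:R / D%:R) -> th = (om / 40) ^+ 2 ->
  16 / th * (32 * (3 * th) ^+ 2 * D%:R / (a ^+ 2 * d2%:R)) ^+ 2 <= (om / 25) ^+ 2.
Proof.
move=> d0 dD a0 dd2 omE thE.
have d0' : 0 < d%:R :> R by rewrite ltr0n.
have D0' : 0 < D%:R :> R by rewrite ltr0n; exact: leq_trans dD.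
have dd2' : d%:R / 2 <= d2%:R :> R.
  by rewrite ler_pdivrMr// -natrM ler_nat mulnC.
have dh : 0 < d%:R / 2 :> R by rewrite divr_gt0.
have d20 := lt_le_trans dh dd2'.
have q0 : 0 < d%:R / D%:R :> R by rewrite divr_gt0.
have q1 : d%:R / D%:R <= 1 :> R by rewrite ler_pdivrMr// mul1r ler_nat.
have om0 : 0 < om by rewrite omE mulr_gt0.
have th0 : 0 < th by rewrite thE exprn_gt0// divr_gt0.
have a20 : 0 < a ^+ 2 by rewrite exprn_gt0.
have n0 : 0 <= 32 * (3 * th) ^+ 2 * D%:R by apply: mulr_ge0 => //; apply: mulr_ge0 => //; exact: sqr_ge0.
apply: (@le_trans _ _ (16 / th * (32 * (3 * th) ^+ 2 * D%:R / (a ^+ 2 * (d%:R / 2))) ^+ 2)).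
  apply: ler_wpM2l; first by rewrite divr_ge0 ?(ltW th0).
  have a2d (e : R) : 0 < e -> 0 <= a ^+ 2 * e by move=> e0; rewrite mulr_ge0 ?sqr_ge0// ltW.
  apply: lerXn2r; rewrite ?nnegrE; [exact: divr_ge0 n0 (a2d _ d20)|exact: divr_ge0 n0 (a2d _ dh)|].
  apply: ler_wpM2l => //; rewrite lef_pV2 ?posrE ?mulr_gt0//.
  by rewrite ler_wpM2l// ltW.
have -> : 16 / th * (32 * (3 * th) ^+ 2 * D%:R / (a ^+ 2 * (d%:R / 2))) ^+ 2 =
    (16 * (24 ^+ 4) / 40 ^+ 6 * om ^+ 2) * (d%:R / D%:R) ^+ 2.
  by rewrite thE omE; field; rewrite !gt_eqF.
have -> : (om / 25) ^+ 2 = (1 / 25 ^+ 2 * om ^+ 2) * 1.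
  by rewrite mulr1 expr_div_n mulrC; congr (_ * _); lra.
apply: ler_pM; rewrite ?sqr_ge0//.
- by rewrite mulr_ge0 ?sqr_ge0// divr_ge0// mulr_ge0 ?sqr_ge0.
- by rewrite ler_wpM2r ?sqr_ge0//; lra.
by rewrite expr_le1// ltW.
Qed.

(** After squaring, [4 k <= n] grants one factor [x] to each [y ^+ 2]. *)
Lemma sqr_le_of_rate (x y z : R) (k n : nat) : 1 <= x -> 0 <= y -> 0 <= z -> (4 * k <= n)%N ->
  x * y ^+ 2 <= z ^+ 2 -> x ^+ (2 * k) * y ^+ n <= z ^+ n.
Proof.
move=> x1 y0 z0 kn h.
have x0 : 0 <= x by exact: le_trans x1.
rewrite -(@ler_pXn2r _ 2)// ?nnegrE ?mulr_ge0 ?exprn_ge0//.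
rewrite exprMn -!exprM.
apply: (@le_trans _ _ (x ^+ n * y ^+ (n * 2))).
  by rewrite ler_wpM2r ?exprn_ge0// ler_weXn2l//; lia.
rewrite ![(n * 2)%N]mulnC !exprM -exprMn lerXn2r// ?nnegrE ?sqr_ge0//.
by rewrite mulr_ge0// sqr_ge0.
Qed.

Lemma half_expX_le (c x : R) (n : nat) : 0 <= x -> x <= 2^-1 -> c <= 2^-1 ^+ 8 -> 0 <= c ->
  c * x ^+ n <= 2^-1 ^+ (n + 5 + 3).
Proof.
move=> x0 x2 c256 c0; rewrite -addnA addnC exprD; apply: ler_pM => //; first by rewrite exprn_ge0.
by rewrite lerXn2r// nnegrE.
Qed.

(** The prefactor [17 / th^2] bounds the number of grid points [lam]. The numbers [m], [d2], [k] are
    about a quarter, a half and an eighth of [d]; the lower bound on [d] keeps the rounding losses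
    within [d <= 5 m] and [d <= 9 k]. *)
Lemma failure_bound (D d m d2 k : nat) (a om th : R) : (167 <= d)%N -> (d <= D)%N -> 0 < a -> a <= 15^-1 ->
  om = a * (d%:R / D%:R) -> th = (om / 40) ^+ 2 ->
  m = (d %/ 4)%N -> d2 = (d - 2 * m)%N -> k = (d2 %/ 4)%N ->
  17 / th ^+ 2 *
   (D%:R * (16 * D%:R ^+ 3 * th ^+ 2 / (a ^+ 2 * k%:R * m%:R ^+ 2)) ^+ m +
    (16 / th) ^+ (2 * k) * (32 * (3 * th) ^+ 2 * D%:R / (a ^+ 2 * d2%:R)) ^+ d2) <=
  2^-1 ^+ (m + 2).
Proof.
move=> d167 dD a0 a15 omE thE mE d2E kE.
have d0 : (0 < d)%N by exact: leq_trans d167.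
have D0 : (0 < D)%N by exact: leq_trans dD.
have dm5 : (d <= 5 * m)%N by lia.
have dk9 : (d <= 9 * k)%N by lia.
have dd2 : (d <= 2 * d2)%N by lia.
have kd2 : (4 * k <= d2)%N by lia.
have m5 : (5 <= m)%N by lia.
have md2 : (2 * m <= d2)%N by lia.
have d0' : 0 < d%:R :> R by rewrite ltr0n.
have D0' : 0 < D%:R :> R by rewrite ltr0n.
have q0 : 0 < d%:R / D%:R :> R by rewrite divr_gt0.
have q1 : d%:R / D%:R <= 1 :> R by rewrite ler_pdivrMr// mul1r ler_nat.
have om0 : 0 < om by rewrite omE mulr_gt0.
have om15 : om <= 15^-1.
  by rewrite omE -[15^-1]mulr1; apply: ler_pM => //; exact: ltW.
have th0 : 0 < th by rewrite thE exprn_gt0// divr_gt0.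
have h1 := @column_rate_le D d k m a om th d0 D0 a0 a15 dk9 dm5 omE thE.
have h2 := @net_rate_le D d d2 a om th d0 dD a0 dd2 omE thE.
set x1 := _ / (_ * k%:R * _) in h1 *; set x2 := _ / (a ^+ 2 * d2%:R) in h2 *.
have x10 : 0 <= x1.
  apply: divr_ge0; last by apply: mulr_ge0; rewrite ?sqr_ge0// mulr_ge0 ?sqr_ge0.
  by apply: mulr_ge0; rewrite ?sqr_ge0// mulr_ge0// exprn_ge0.
have x20 : 0 <= x2 by rewrite divr_ge0 ?mulr_ge0 ?sqr_ge0// ltW.
have o25 : 0 <= om / 25 by rewrite divr_ge0// ltW.
have th1 : 1 <= 16 / th.
  by rewrite ler_pdivlMr// mul1r thE; nra.
have h3 := sqr_le_of_rate th1 x20 o25 kd2 h2.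
have h4 : (om / 25) ^+ d2 <= (om / 25) ^+ (2 * m).
  by rewrite ler_wiXn2l//; lra.
(* The union over columns costs [D], which [m] alone does not control; but [D om = a d] is at most
   [m / 3], so [D] is traded for [1 / om]. *)
have Dle : D%:R <= 2 ^+ m / om.
  rewrite ler_pdivlMr// (_ : D%:R * om = a * d%:R); last by rewrite omE; field; rewrite gt_eqF.
  apply: (@le_trans _ _ (15^-1 * (5 * m)%:R)).
    by apply: ler_pM => //; rewrite ?ler_nat ?(ltW a0).
  have : m%:R <= 2 ^+ m :> R by rewrite -natrX ler_nat ltnW// ltn_expl.
  rewrite natrM; have := ler0n R m; lra.
have K0 : 0 <= 17 / th ^+ 2 by rewrite divr_ge0 ?sqr_ge0.
apply: (@le_trans _ _ (17 / th ^+ 2 * (2 ^+ m / om * (om / (100 * 100)) ^+ m + (om / 25) ^+ (2 * m)))).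
  apply: ler_wpM2l => //; apply: lerD; last exact: le_trans h3 h4.
  apply: ler_pM => //; rewrite ?exprn_ge0// lerXn2r ?nnegrE//.
  by rewrite divr_ge0// ltW.
(* Five powers of [om] are set aside: four cancel [1 / th^2], one cancels the [1 / om] in the bound
   of [D]. *)
have [n mn] : exists n, m = (n + 5)%N by exists (m - 5)%N; rewrite subnK.
rewrite mn mulrDr.
have -> : 2^-1 ^+ (n + 5 + 2) = 2^-1 ^+ (n + 5 + 3) + 2^-1 ^+ (n + 5 + 3) :> R.
  by rewrite !addn3 !addn2 [in RHS]exprS; lra.
apply: lerD.
  have -> : 17 / th ^+ 2 * (2 ^+ (n + 5) / om * (om / (100 * 100)) ^+ (n + 5)) =
      17 * 40 ^+ 4 / (50 * 100) ^+ 5 * (om / (50 * 100)) ^+ n.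
    have -> : 2 ^+ (n + 5) / om * (om / (100 * 100)) ^+ (n + 5) = (om / (50 * 100)) ^+ n * (om / (50 * 100)) ^+ 5 / om.
      rewrite mulrAC -exprMn -exprD; congr (_ ^+ _ / _).
      by rewrite mulrCA; congr (_ * _); lra.
    by rewrite thE; move: (_ ^+ n) => z; field; rewrite gt_eqF.
  by apply: half_expX_le; lra.
have -> : 17 / th ^+ 2 * (om / 25) ^+ (2 * (n + 5)) =
    17 * 40 ^+ 4 * om ^+ 6 / 25 ^+ 10 * ((om / 25) ^+ 2) ^+ n.
  rewrite exprM exprD; move: (_ ^+ n) => z; rewrite thE; field; rewrite gt_eqF//.
have o6 : om ^+ 6 <= 1 by rewrite exprn_ile1//; lra.
have o60 : 0 <= om ^+ 6 by rewrite exprn_ge0// ltW.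
apply: half_expX_le; [exact: sqr_ge0|by nra|by lra|by lra].
Qed.

End failure_bound.

(** * Bounds for the deviations and for the deterministic part *)

Lemma sigma_min_le_max (R : realType) (D : nat) (s : 'I_D -> 'I_D -> R) : (0 < D)%N ->
  (forall i j, 0 < s i j) ->
  0 < sigma_min s /\ forall i j, sigma_min s <= s i j <= sigma_max s.
Proof.
move=> D0 s0; pose p0 : 'I_D * 'I_D := (Ordinal D0, Ordinal D0).
have sub i j : [set s p.1 p.2 | p in [set: 'I_D * 'I_D]] (s i j) by exists (i, j).
split.
  case: (@Order.TotalTheory.arg_minP _ _ _ p0 xpredT (fun p : 'I_D * 'I_D => s p.1 p.2)) => // p _ hp.
  apply: lt_le_trans (s0 p.1 p.2) _; apply: lb_le_inf; first by exists (s p0.1 p0.2).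
  by move=> _ [q _ <-]; exact: hp.
move=> i j; apply/andP; split.
  by apply: (ge_inf _ (sub i j)); exists 0 => _ [q _ <-]; exact: ltW.
apply: (ub_le_sup _ (sub i j)); exists (\sum_p s p.1 p.2) => _ [q _ <-].
by rewrite (bigD1 q)//= lerDl; apply: sumr_ge0 => p _; exact: ltW.
Qed.

Section opnorm.
Context {R : realType} {D : nat}.
Local Notation C := R[i].

Definition n2r (v : 'cV[R]_D) : R := \sum_i (v i 0) ^+ 2.

Lemma n2r_ge0 v : 0 <= n2r v.
Proof. by apply: sumr_ge0 => i _; exact: sqr_ge0. Qed.

Lemma opnorm_sqr_le (A : 'M[R]_D) (v : 'cV[R]_D) :
  0 <= opnorm A /\ n2r (A *m v) <= opnorm A ^+ 2 * n2r v.
Proof.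
have CS u : n2r (A *m u) <= (\sum_i \sum_j A i j ^+ 2) * n2r u.
  rewrite /n2r mulr_suml; apply: ler_sum => i _; rewrite mxE.
  have := @nsq_sum_le R _ (fun j => Complex (A i j) 0 : C) (fun j => Complex (u j 0) 0).
  under eq_bigr do rewrite CompM; rewrite -Comp_sum nsq_real.
  have e (f : 'I_D -> R) : \sum_j nsq (Complex (f j) 0) = \sum_j f j ^+ 2.
    by apply: eq_bigr => j _; rewrite nsq_real.
  by rewrite (e (fun j => A i j)) (e (fun j => u j 0)).
(* A supremum says something only about a bounded set; the Frobenius norm is a bound. *)
have bounded : has_ubound [set Num.sqrt (\sum_(i < D) ((A *m v) i 0) ^+ 2) |
        v in [set v : 'cV[R]_D | \sum_(i < D) (v i 0) ^+ 2 <= 1]].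
  exists (Num.sqrt (\sum_i \sum_j A i j ^+ 2)) => _ [u /= u1 <-].
  apply: ler_wsqrtr; apply: le_trans (CS u) _.
  by rewrite ler_piMr//; apply: sumr_ge0 => i _; apply: sumr_ge0 => j _; exact: sqr_ge0.
have le_op u : n2r u <= 1 -> Num.sqrt (n2r (A *m u)) <= opnorm A.
  by move=> u1; apply: (ub_le_sup bounded); exists u.
have op0 : 0 <= opnorm A.
  by apply: le_trans (le_op 0 _); rewrite ?sqrtr_ge0// /n2r big1// => i _; rewrite mxE expr0n.
split => //.
have [v0|v0] := eqVneq (n2r v) 0.
  by rewrite v0 mulr0; have := CS v; rewrite v0 mulr0.
have vgt : 0 < n2r v by rewrite lt_neqAle eq_sym v0 n2r_ge0.
have n2rZ a u : n2r (a *: u) = a ^+ 2 * n2r u.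
  by rewrite /n2r mulr_sumr; apply: eq_bigr => i _; rewrite mxE exprMn.
pose k := (Num.sqrt (n2r v))^-1.
have k2 : k ^+ 2 = (n2r v)^-1 by rewrite /k exprVn sqr_sqrtr// ltW.
have := le_op (k *: v); rewrite -scalemxAr !n2rZ k2 mulVf// => /(_ (lexx _)) h.
have : Num.sqrt ((n2r v)^-1 * n2r (A *m v)) ^+ 2 <= opnorm A ^+ 2.
  by rewrite lerXn2r// nnegrE sqrtr_ge0.
rewrite sqr_sqrtr; last by rewrite mulr_ge0 ?n2r_ge0// invr_ge0 ltW.
by rewrite mulrC ler_pdivrMr.
Qed.

(** The squared norm doubles once when the squares of a difference and a sum are split, and once
    because both real matrices act on both parts of [v]; hence the factor 2 on the norm. *)
Lemma nv_le_C_H0 (H0 : 'M[C]_D) (v : 'cV[C]_D) : (0 < D)%N ->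
  0 <= C_H0 H0 /\ nv (H0 *m v) <= 2 * (C_H0 H0 * Num.sqrt D%:R) * nv v.
Proof.
move=> D0.
pose A := map_mx (@complex.Re R) H0; pose B := map_mx (@complex.Im R) H0.
pose a := map_mx (@complex.Re R) v; pose b := map_mx (@complex.Im R) v.
pose K := Num.max (opnorm A) (opnorm B).
have sD : 0 < Num.sqrt D%:R :> R by rewrite sqrtr_gt0 ltr0n.
have [A0 _] := opnorm_sqr_le A a; have [B0 _] := opnorm_sqr_le B a.
have K0 : 0 <= K by rewrite le_max A0.
have CE : C_H0 H0 * Num.sqrt D%:R = K by rewrite /C_H0 mulrAC mulVf ?mul1r// gt_eqF.
have AK u : n2r (A *m u) <= K ^+ 2 * n2r u.
  apply: le_trans (proj2 (opnorm_sqr_le A u)) _; rewrite ler_wpM2r ?n2r_ge0//.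
  by rewrite lerXn2r ?nnegrE// le_max lexx.
have BK u : n2r (B *m u) <= K ^+ 2 * n2r u.
  apply: le_trans (proj2 (opnorm_sqr_le B u)) _; rewrite ler_wpM2r ?n2r_ge0//.
  by rewrite lerXn2r ?nnegrE// le_max lexx orbT.
split; first by rewrite /C_H0 mulr_ge0 ?invr_ge0 ?sqrtr_ge0.
rewrite CE; have K20 : 0 <= 2 * K by rewrite mulr_ge0.
rewrite -(@ler_pXn2r _ 2)// ?nnegrE ?nv_ge0 ?mulr_ge0 ?nv_ge0// exprMn !sqr_nv.
have vE : n2 v = n2r a + n2r b.
  by rewrite /n2 /n2r -big_split; apply: eq_bigr => i _; rewrite !mxE.
have re i : complex.Re ((H0 *m v) i 0) = (A *m a) i 0 - (B *m b) i 0.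
  rewrite !mxE Re_sum -sumrB; apply: eq_bigr => j _; rewrite !mxE.
  by case: (H0 i j) => ? ?; case: (v j 0).
have im i : complex.Im ((H0 *m v) i 0) = (A *m b) i 0 + (B *m a) i 0.
  rewrite !mxE Im_sum -big_split; apply: eq_bigr => j _; rewrite !mxE.
  by case: (H0 i j) => ? ?; case: (v j 0).
apply: (@le_trans _ _ (2 * (n2r (A *m a) + n2r (B *m b) + (n2r (A *m b) + n2r (B *m a))))).
  rewrite /n2 /n2r -!big_split mulr_sumr; apply: ler_sum => i _; rewrite /nsq re im /=.
  move: ((A *m a) i 0) ((B *m b) i 0) ((A *m b) i 0) ((B *m a) i 0) => p q r s.
  have := sqr_ge0 (p + q); have := sqr_ge0 (r - s); rewrite !expr2; lra.
have := AK a; have := AK b; have := BK a; have := BK b; rewrite vE exprMn.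
move: (n2r _) (n2r _) (n2r _) (n2r _) (n2r _) (n2r _) (K ^+ 2) => *; lra.
Qed.

End opnorm.

Lemma half_exp_le_eps (R : realType) (eps : R) (d m : nat) : 0 < eps ->
  4 * `|log2 (eps / Num.sqrt 2)| < d%:R -> (d <= 4 * m)%N -> 2^-1 ^+ m <= eps.
Proof.
move=> e0 h dm.
have s2 : 0 < Num.sqrt 2 :> R by rewrite sqrtr_gt0.
have s1 : 1 <= Num.sqrt 2 :> R by rewrite -[leLHS]sqrtr1 ler_wsqrtr// ler1n.
have es0 : 0 < eps / Num.sqrt 2 by rewrite divr_gt0.
have ln2 : 0 < ln 2 :> R by rewrite ln_gt0// ltr1n.
apply: (@le_trans _ _ (eps / Num.sqrt 2)); last first.
  by rewrite ler_pdivrMr// ler_peMr// ltW.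
have m0 : 0 < 2^-1 ^+ m :> R by rewrite exprn_gt0// invr_gt0.
rewrite -ler_ln ?posrE// lnXn ?invr_gt0// lnV ?posrE//.
have : `|log2 (eps / Num.sqrt 2)| < m%:R.
  rewrite -(@ltr_pM2l _ 4)//; apply: lt_le_trans h _.
  by rewrite -natrM ler_nat.
rewrite /log2 normrM [ `|(ln 2)^-1|]gtr0_norm ?invr_gt0// ltr_pdivrMr// => h2.
have := ler_norm (- ln (eps / Num.sqrt 2)); rewrite normrN mulNrn -[ln 2 *+ m]mulr_natl. lra.
Qed.

(** Rounding [a] down, starting at [- rad], keeps [lam] between [- rad] and [a]; the bound on [lam]
    serves to control the norm of [H - lam]. *)
Lemma real_grid (R : realType) (rad s : R) : 0 < rad -> 0 < s ->
  exists L : seq R, (size L)%:R <= 2 * rad / s + 1 /\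
    forall a, `|a| <= rad -> exists2 lam, lam \in L & `|a - lam| <= s /\ `|lam| <= rad.
Proof.
move=> rad0 s0; pose N := Num.truncn (2 * rad / s).
exists [seq - rad + k%:R * s | k <- iota 0 N.+1]; split.
  by rewrite size_map size_iota -natr1 lerD2r truncn_le divr_ge0 ?(ltW s0)// mulr_ge0// (ltW rad0).
move=> a ha; have /andP[a1 a2] : - rad <= a <= rad by rewrite -ler_norml.
have ar0 : 0 <= (a + rad) / s by rewrite divr_ge0 ?(ltW s0)//; lra.
pose k := Num.truncn ((a + rad) / s).
have k1 : k%:R * s <= a + rad by rewrite -ler_pdivlMr// truncn_le.
have k2 : a + rad < (k%:R + 1) * s by rewrite -ltr_pdivrMr// natr1 truncnS_gt.
have ks : 0 <= k%:R * s by rewrite mulr_ge0// ltW.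
exists (- rad + k%:R * s).
  apply/mapP; exists k => //; rewrite mem_iota /= add0n ltnS; apply: le_truncn.
  by rewrite ler_pM2r ?invr_gt0//; lra.
split; rewrite ler_norml; apply/andP; split; lra.
Qed.

(** * Eigenvectors with little weight on a block *)

Section eigenvectors.
Context {R : realType} {D : nat}.
Local Notation C := R[i].

Lemma hermitian_eigenvalue_real (H : 'M[C]_D) (e : C) (v : 'cV[C]_D) (rad : R) :
  H ^t* = H -> v != 0 -> H *m v = e *: v -> (forall u, nv (H *m u) <= rad * nv u) ->
  exists2 a : R, e = Complex a 0 & `|a| <= rad.
Proof.
move=> Hh v0 Hv Hrad.
have nv0 : 0 < n2 v by rewrite lt_neqAle eq_sym n2_eq0 v0 n2_ge0.
have E1 : (v ^t* *m (H *m v)) 0 0 = e * Complex (n2 v) 0.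
  by rewrite Hv -scalemxAr mxE n2E.
have E2 : ((H *m v) ^t* *m v) 0 0 = e^* * Complex (n2 v) 0.
  by rewrite Hv linearZ map_mxZ -scalemxAl mxE n2E.
have E3 : e * Complex (n2 v) 0 = e^* * Complex (n2 v) 0.
  by rewrite -E1 -E2 trmx_mul map_mxM Hh mulmxA.
have ee : complex.Im e = 0.
  move: E3; rewrite conjCE; case: (e) => a b /= [_].
  rewrite !mulr0 !add0r mulNr => h; have : b * n2 v = 0 by lra.
  by move/eqP; rewrite mulf_eq0 (gt_eqF nv0) orbF => /eqP.
have eE : e = Complex (complex.Re e) 0 by rewrite -ee; case: (e).
exists (complex.Re e) => //.
have := Hrad v; rewrite Hv eE nvZ_real ler_pM2r//.
by rewrite lt_neqAle nv_ge0 andbT eq_sym; apply: contraTneq nv0 => nve; rewrite -sqr_nv nve expr0n ltxx.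
Qed.

Lemma singular_gap (rad beta eta al lm p v q hp : R) : 0 < rad -> 0 < beta -> 0 <= p ->
  al <= beta / 8 -> lm <= rad -> eta <= 2^-1 -> beta / 8 + 2 * rad * eta < beta / 2 ->
  p < eta * v -> v <= p + q -> hp <= rad * p -> 0 < v ->
  al * v + (hp + lm * p) < beta * q.
Proof.
move=> rad0 beta0 p0 al8 lmr eta2 hb pv vq hpr v0.
have h5 : lm * p <= rad * p by rewrite ler_wpM2r.
have h6 : al * v <= beta / 8 * v by rewrite ler_wpM2r// ltW.
have h7 : rad * p <= rad * (eta * v) by rewrite ler_wpM2l ?(ltW rad0)// ltW.
have h8 : (beta / 8 + 2 * rad * eta) * v < beta / 2 * v by rewrite ltr_pM2r.
have h9 : eta * v <= 2^-1 * v by rewrite ler_wpM2r// ltW.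
have h10 : beta * (2^-1 * v) <= beta * q.
  by rewrite ler_wpM2l ?(ltW beta0)//; lra.
lra.
Qed.

(** With [p] and [q] the parts of [v] on and off [Q], [(H - lam) q = (a - lam) v - (H - lam) p]. The
    grid makes the first term small, the shortness of [p] the second, and [q] carries at least half
    of the norm of [v]. *)
Lemma singular_of_eigvec (H : 'M[C]_D) (Q : {pred 'I_D}) (rad beta eta : R) (L : seq R)
    (e : C) (v : 'cV[C]_D) :
  H ^t* = H -> (forall u, nv (H *m u) <= rad * nv u) -> 0 < rad -> 0 < beta ->
  eta <= 2^-1 -> beta / 8 + 2 * rad * eta < beta / 2 ->
  (forall a, `|a| <= rad -> exists2 lam, lam \in L & `|a - lam| <= beta / 8 /\ `|lam| <= rad) ->
  H *m v = e *: v -> nv (coordproj Q *m v) < eta * nv v ->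
  exists2 lam, lam \in L & exists u : 'cV[C]_D,
    nv ((H - (Complex lam 0)%:M) *m coordproj [predC Q] *m u) <
    beta * nv (coordproj [predC Q] *m u).
Proof.
move=> Hh Hrad rad0 beta0 eta2 hb netL Hv hQ.
have v0 : v != 0.
  apply: contraTneq hQ => ->; rewrite mulmx0 -leNgt.
  have -> : nv (0 : 'cV[C]_D) = 0 by rewrite /nv n20 sqrtr0.
  by rewrite mulr0.
have [a eE arad] := hermitian_eigenvalue_real Hh v0 Hv Hrad.
have [lam lamL [alam lamr]] := netL a arad.
exists lam => //; exists v.
have split_v : v = coordproj Q *m v + coordproj [predC Q] *m v.
  apply/colP => r; rewrite [RHS]mxE !mul_coordproj inE.
  by case: (r \in Q); rewrite /= ?mul1r ?mul0r ?addr0 ?add0r.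
have nvv : 0 < nv v.
  rewrite lt_neqAle nv_ge0 andbT eq_sym; apply: contraNneq v0 => nve.
  by rewrite -n2_eq0 -sqr_nv nve expr0n.
have E : (H - (Complex lam 0)%:M) *m coordproj [predC Q] *m v =
    Complex (a - lam) 0 *: v - (H *m (coordproj Q *m v) - Complex lam 0 *: (coordproj Q *m v)).
  rewrite -mulmxA.
  have -> : coordproj [predC Q] *m v = v - coordproj Q *m v.
    by rewrite {2}split_v addrAC subrr add0r.
  move: (coordproj Q *m v) => p.
  have -> : Complex (a - lam) 0 = Complex a 0 - Complex lam 0 :> C by rewrite CompN CompD.
  rewrite mulmxBl mul_scalar_mx mulmxBr Hv eE scalerBr scalerBl.
  rewrite !opprB addrACA [RHS]addrACA; congr (_ + _); exact: addrC.
rewrite E; set p := coordproj Q *m v in hQ *.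
have h1 : nv v <= nv p + nv (coordproj [predC Q] *m v) by rewrite {1}split_v nvD_le.
have h2 := nvB_le (Complex (a - lam) 0 *: v) (H *m p - Complex lam 0 *: p).
have h3 := nvB_le (H *m p) (Complex lam 0 *: p).
rewrite !nvZ_real in h2 h3.
have h4 := Hrad p.
apply: le_lt_trans h2 (le_lt_trans (lerD (lexx _) h3) _).
have [pv0 qv0] := (nv_ge0 p, nv_ge0 v).
exact: singular_gap rad0 beta0 pv0 alam lamr eta2 hb hQ h1 h4 nvv.
Qed.

End eigenvectors.

(** * Measurability and conclusion *)

Section measurable_M.
Context {R : realType}.
Local Notation C := R[i].

(** The traces are sums of squared norms, so the coefficient is real and its comparison in [R[i]]
    becomes one in [R]. *)
Lemma M_mnE n (H : 'M[C]_n) m (d : 'I_m -> nat) (mu nu : 'I_m) :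
  M_mn d H mu nu = Complex ((d mu)%:R^-1 *
    complex.Re (\sum_(e <- eigvals H) \tr (macro_proj R n d mu *m eigenproj H e *m
      macro_proj R n d nu *m eigenproj H e))) 0.
Proof.
rewrite /M_mn /M_B Comp_natV !macro_projE; set S := \sum_(_ <- _) _.
have -> : S = Complex (complex.Re S) 0.
  rewrite /S; under eq_bigr => e _ do rewrite (mxtrace_sandwich _ _ (orthoproj_eigenproj H e)).
  by rewrite -Comp_sum.
by rewrite CompM.
Qed.

Context {dT : measure_display} {T : measurableType dT}.

Lemma measurable_inv_gt0 (f : T -> R) : measurable_fun setT f -> (forall x, 0 < f x) ->
  measurable_fun setT (fun x => (f x)^-1).
Proof.
move=> mf f0; under eq_fun => x do rewrite -powR_inv1 ?(ltW (f0 x))//.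
exact: (measurableT_comp (@measurable_powR R (-1)) mf).
Qed.

Lemma mxmeasurable_dephase n (H : T -> 'M[C]_n) (B : 'M[C]_n) k : mxmeasurable H ->
  mxmeasurable (fun x => dephase (H x) B k).
Proof.
move=> mH; elim: k => [|k IH] /=; first exact: mxmeasurable_cst.
have comm (F : T -> 'M[C]_n) : mxmeasurable F -> mxmeasurable (fun x => H x *m F x - F x *m H x).
  by move=> mF; apply: mxmeasurableB; exact: mxmeasurableM.
apply: mxmeasurableB => //; apply: mxmeasurableZ; last by apply: (comm); exact: (comm).
apply: cmeasurable_real; apply: measurable_inv_gt0; last by move=> x; exact: commutator_bound_gt0.
apply: measurable_funD => //; apply: measurable_funM => //.
by apply: measurable_sum => i; apply: measurable_sum => j; exact: measurable_nsq.
Qed.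

Lemma measurable_M_mn_ge n (H : T -> 'M[C]_n) m (d : 'I_m -> nat) (mu nu : 'I_m) (b : R) :
  mxmeasurable H -> (forall x, (H x) ^t* = H x) ->
  measurable [set x | (Complex b 0 <= M_mn d (H x) mu nu)%R].
Proof.
move=> mH Hh; set f := fun x => (d mu)%:R^-1 *
    complex.Re (\sum_(e <- eigvals (H x)) \tr (macro_proj R n d mu *m eigenproj (H x) e *m
      macro_proj R n d nu *m eigenproj (H x) e)).
have mf : measurable_fun setT f.
  apply: measurable_funM => //.
  apply: (@measurable_fun_cvg _ _ _ _ (fun k x =>
    complex.Re (\tr (macro_proj R n d mu *m dephase (H x) (macro_proj R n d nu) k)))).
    move=> k; have [] // : cmeasurable (fun x => \tr (macro_proj R n d mu *m dephase (H x) (macro_proj R n d nu) k)).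
    apply: mxmeasurable_mxtrace; apply: mxmeasurableM; first exact: mxmeasurable_cst.
    exact: mxmeasurable_dephase.
  by move=> x _; exact: dephase_cvg.
rewrite (_ : [set x | _] = [set x | (b <= f x)%R]); first exact: measurable_set_le.
by apply/seteqP; split => x /=; rewrite M_mnE lecR.
Qed.

End measurable_M.

Lemma sub_block_of_card (D : nat) (Q : {pred 'I_D}) (k : nat) : (k <= #|Q|)%N ->
  exists I2 : {pred 'I_D}, #|I2| = k /\ forall r, r \in I2 -> r \in Q.
Proof.
move=> kQ; pose s : seq 'I_D := take k (enum Q).
exists (fun i : 'I_D => i \in s); split.
  have -> : #|(fun i : 'I_D => i \in s)| = #|s| by apply: eq_card => r; rewrite unfold_in.
  rewrite (card_uniqP _) ?take_uniq ?enum_uniq// size_take -cardE.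
  by case: ltngtP kQ.
by move=> r; rewrite unfold_in => /mem_take; rewrite mem_enum.
Qed.

Lemma block_arith (d m d2 k : nat) : (167 <= d)%N -> m = (d %/ 4)%N -> d2 = (d - 2 * m)%N ->
  k = (d2 %/ 4)%N ->
  [/\ (0 < m)%N, (0 < d2)%N, (0 < k)%N, (2 * m + d2 = d)%N & (m + 2 <= d)%N].
Proof. move=> *; split; lia. Qed.

Lemma half_gap (R : realType) (z rad eta : R) : 0 < z * rad -> rad * eta <= rad * (z / 8) ->
  z * rad / 8 + 2 * rad * eta < z * rad / 2.
Proof. by lra. Qed.

(** [eps < 2^-1] turns [a / 50] into [a / 100], and [100^4] exceeds [8 * 40^4]; this is what fixes
    the constant in [c_minus]. *)
Lemma gap_constant_le (R : realType) (eps a q : R) : 0 < eps -> eps < 2^-1 -> 0 < a ->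
  0 < q -> q <= 1 ->
  (eps * (a / 50)) ^+ 4 * q ^+ 8 <= ((a * q / 40) ^+ 2) ^+ 2 / 8.
Proof.
move=> e0 e2 a0 q0 q1.
apply: (@le_trans _ _ ((a / 100) ^+ 4 * q ^+ 4)).
  apply: ler_pM; rewrite ?exprn_ge0 ?(ltW q0)// ?mulr_ge0 ?(ltW e0) ?(ltW a0)//.
    rewrite lerXn2r ?nnegrE ?mulr_ge0 ?(ltW e0) ?(ltW a0)//.
    apply: (@le_trans _ _ (2^-1 * (a / 50))); first by rewrite ler_wpM2r ?(ltW e2)// divr_ge0// ltW.
    lra.
  by rewrite ler_wiXn2l ?(ltW q0).
have aq0 : 0 <= (a * q) ^+ 4 by rewrite exprn_ge0// mulr_ge0// ltW.
have -> : (a / 100) ^+ 4 * q ^+ 4 = (a * q) ^+ 4 * (1 / 100 ^+ 4) by field.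
have -> : ((a * q / 40) ^+ 2) ^+ 2 / 8 = (a * q) ^+ 4 * (1 / (8 * 40 ^+ 4)) by field.
by rewrite ler_wpM2l//; lra.
Qed.

Lemma sqrt_expX16 (R : realType) (s q : R) : 0 <= s ->
  (Num.sqrt s * q) ^+ 16 = (s ^+ 4 * q ^+ 8) ^+ 2.
Proof.
move=> s0; rewrite exprMn (exprM (Num.sqrt s) 2 8) sqr_sqrtr// [RHS]exprMn.
by rewrite -!exprM.
Qed.

Section main.
Context {R : realType} {D : nat}.
Local Notation C := R[i].
Local Notation I := (('I_D * 'I_D) * bool)%type.
Local Notation state := (state R I).
Context {dO : measure_display} {Omega : measurableType dO} {P : probability Omega R}
  (X : I -> {RV P >-> R}) (sigma : 'I_D -> 'I_D -> R) (H0 : 'M[C]_D).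
Hypothesis indX : mutually_independent X.
Hypothesis sigma_gt0 : forall i j, 0 < sigma i j.
Hypothesis normalX : forall i j (b : bool), is_normal0 (X (i, j, b)) (sigma i j / Num.sqrt 2).
Hypothesis H0_herm : is_hermitian H0.

Local Notation hamiltonian := (hamiltonian H0).

(* [a] is the ratio of the smallest deviation to the norm bound
   [rho * sqrt D] of the Hamiltonian. *)
Lemma eigenvectors_spread (Q : {pred 'I_D}) (rho a om th eta : R) (m : nat) :
  (167 <= #|Q|)%N -> rho = 15 * sigma_max sigma + 2 * C_H0 H0 ->
  a = sigma_min sigma / rho -> om = a * (#|Q|%:R / D%:R) -> th = (om / 40) ^+ 2 ->
  0 <= eta -> eta <= th ^+ 2 / 8 -> m = (#|Q| %/ 4)%N ->
  exists B : set state, [/\ measurable B,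
    (P ((fun w => (X^~ w : state)) @^-1` B) <= (2^-1 ^+ m.+1)%:E)%E &
    forall x, ~ B x -> forall (e : C) (v : 'cV[C]_D),
      hamiltonian x *m v = e *: v -> eta * nv v <= nv (coordproj Q *m v)].
Proof.
move=> Q167 rhoE aE omE thE eta0 eta8 mE.
have QD : (#|Q| <= D)%N by rewrite -[leqRHS]card_ord max_card.
have D0 : (0 < D)%N by exact: leq_trans (leq_trans _ Q167) QD.
have [sm0 sml] := sigma_min_le_max D0 sigma_gt0.
set sm := sigma_min sigma in sm0 sml aE *; set sp := sigma_max sigma in sml rhoE *.
have smp : sm <= sp by have /andP[] := sml (Ordinal D0) (Ordinal D0); exact: le_trans.
have sp0 : 0 < sp by exact: lt_le_trans smp.
have [C0 _] := nv_le_C_H0 H0 0 D0.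
have rho0 : 0 < rho by rewrite rhoE; lra.
have a0 : 0 < a by rewrite aE divr_gt0.
have a15 : a <= 15^-1 by rewrite aE ler_pdivrMr// rhoE; lra.
have smE : sm = a * rho by rewrite aE divfK// gt_eqF.
have D0' : 0 < D%:R :> R by rewrite ltr0n.
have Q0' : 0 < #|Q|%:R :> R by rewrite ltr0n; exact: leq_trans Q167.
have q0 : 0 < #|Q|%:R / D%:R :> R by rewrite divr_gt0.
have q1 : #|Q|%:R / D%:R <= 1 :> R by rewrite ler_pdivrMr// mul1r ler_nat.
have om0 : 0 < om by rewrite omE mulr_gt0.
have om1 : om <= 1.
  by rewrite omE -[1]mulr1; apply: ler_pM; rewrite ?(ltW a0) ?(ltW q0)//; lra.
have th0 : 0 < th by rewrite thE exprn_gt0// divr_gt0.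
have th4 : th <= 4^-1.
  rewrite thE; apply: (@le_trans _ _ (2^-1 ^+ 2)); last by rewrite expr2; lra.
  by rewrite lerXn2r ?nnegrE ?divr_ge0 ?(ltW om0)//; lra.
have sD0 : 0 < Num.sqrt D%:R :> R by rewrite sqrtr_gt0.
have sD2 : Num.sqrt D%:R ^+ 2 = D%:R :> R by rewrite sqr_sqrtr// ltW.
pose rad := rho * Num.sqrt D%:R.
have rad0 : 0 < rad by rewrite mulr_gt0.
(* Singular values below [kap] count as small. The further factor [th] in [beta] forces all but a
   mass [th^2] of the tested vector into the small directions. *)
pose kap := th * rad.
have kap0 : 0 < kap by rewrite mulr_gt0.
have kaprad : kap <= rad.
  by rewrite -[leRHS]mul1r ler_wpM2r ?(ltW rad0)//; lra.
pose beta := th * kap.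
have beta0 : 0 < beta by rewrite mulr_gt0.
have sps i j : sigma i j <= sp by have /andP[] := sml i j.
have sms i j : sm <= sigma i j by have /andP[] := sml i j.
have [G [mG PG Gnorm]] := norm_event indX sigma_gt0 normalX sp0 sps D0.
have Grad x : G x -> forall v, nv (hamiltonian x *m v) <= rad * nv v.
  move=> Gx v; rewrite /hamiltonian mulmxDl; apply: le_trans (nvD_le _ _) _.
  have [_ h0] := nv_le_C_H0 H0 v D0.
  apply: le_trans (lerD h0 (Gnorm x Gx v)) _.
  rewrite -mulrDl ler_wpM2r ?nv_ge0// /rad rhoE le_eqVlt; apply/orP; left; apply/eqP.
  by ring.
pose d2 := (#|Q| - 2 * m)%N; pose k := (d2 %/ 4)%N.
have [m0 d20 k0 md2 m2Q] := block_arith Q167 mE (erefl d2) (erefl k).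
have d2Q : (d2 <= #|Q|)%N by rewrite -md2 leq_addl.
have [I2 [cI2 I2Q]] := sub_block_of_card d2Q.
pose J := [predC Q].
have I2J r : r \in I2 -> r \notin J by move=> /I2Q rQ; rewrite !inE rQ.
have I20 : (0 < #|I2|)%N by rewrite cI2.
have cardD : (2 * m + #|J| + #|I2| <= D)%N.
  by rewrite cI2 addnAC md2 -[leqRHS]card_ord -(cardC Q).
have k0' : 0 < k%:R :> R by rewrite ltr0n.
(* The square is twice the bound of [small_column], as a column event asks for a strict
   inequality. *)
pose t := Num.sqrt (2 * D%:R * kap ^+ 2 / k%:R).
have t2arg : 0 < 2 * D%:R * kap ^+ 2 / k%:R by rewrite divr_gt0// !mulr_gt0// exprn_gt0.
have t0 : 0 < t by rewrite sqrtr_gt0.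
have t2 : t ^+ 2 = 2 * D%:R * kap ^+ 2 / k%:R by rewrite sqr_sqrtr// ltW.
have hk : kap ^+ 2 * D%:R < t ^+ 2 * k%:R.
  rewrite t2 divfK ?gt_eqF// -mulrA mulrC.
  have : 0 < D%:R * kap ^+ 2 by rewrite mulr_gt0// exprn_gt0.
  lra.
(* The mesh [beta / 8] yields at most [16 / th^2 + 1 <= 17 / th^2] points. *)
have [L [sizeL netL]] := real_grid rad0 (divr_gt0 beta0 (ltr0n R 8)).
pose E lam := singular_event H0 J (Complex lam 0) beta `&` G.
have mX := measurable_RVs X.
have measE lam : measurable (E lam).
  by apply: measurableI => //; apply: measurable_singular_event; exact: ltW.
have mpre (A : set state) : measurable A -> measurable ((fun w => (X^~ w : state)) @^-1` A).
  by move=> mA; rewrite -[X in measurable X]setTI; exact: mX.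
have mU : measurable [set x | exists2 lam, List.In lam L & E lam x].
  by apply: measurable_list_union => lam _; exact: measE.
have rad2 : rad ^+ 2 = rho ^+ 2 * D%:R by rewrite exprMn sD2.
have PE lam : (P ((fun w => (X^~ w : state)) @^-1` E lam) <=
   (D%:R * (16 * D%:R ^+ 3 * th ^+ 2 / (a ^+ 2 * k%:R * m%:R ^+ 2)) ^+ m +
    (16 / th) ^+ (2 * k) * (32 * (3 * th) ^+ 2 * D%:R / (a ^+ 2 * d2%:R)) ^+ d2)%:E)%E.
  have := probability_singular_event indX sigma_gt0 normalX (Complex lam 0) I2J I20 k0 cardD m0
    kap0 kaprad th0 th4 t0 sm0 sms hk mG Grad.
  rewrite cI2; have -> : 8 * D%:R * t ^+ 2 / (sm ^+ 2 * m%:R ^+ 2) =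
      16 * D%:R ^+ 3 * th ^+ 2 / (a ^+ 2 * k%:R * m%:R ^+ 2).
    rewrite t2 /kap exprMn rad2 smE; field.
    by rewrite !gt_eqF ?ltr0n.
  have -> // : 32 * (3 * th * rad) ^+ 2 / (sm ^+ 2 * d2%:R) =
      32 * (3 * th) ^+ 2 * D%:R / (a ^+ 2 * d2%:R).
  rewrite exprMn rad2 smE; field.
  by rewrite !gt_eqF ?ltr0n.
have := @failure_bound R D #|Q| m d2 k a om th Q167 QD a0 a15 omE thE mE erefl erefl.
set c := _ + _ in PE * => hc.
(* Read off from the fact that [c] bounds a probability. *)
have c0 : 0 <= c by have := le_trans (measure_ge0 P _) (PE 0); rewrite lee_fin.
have sizeL' : (size L)%:R <= 17 / th ^+ 2.
  apply: le_trans sizeL _; have -> : 2 * rad / (beta / 8) = 16 / th ^+ 2.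
    by rewrite /beta /kap; field; rewrite !gt_eqF.
  have : 1 <= 1 / th ^+ 2.
    rewrite ler_pdivlMr ?exprn_gt0// mul1r expr_le1 ?(ltW th0)//.
    by apply: le_trans th4 _; rewrite invf_le1// ler1n.
  lra.
have PU : (P [set w | exists2 lam, List.In lam L & ((fun w => (X^~ w : state)) @^-1` E lam) w] <=
    (2^-1 ^+ (m + 2))%:E)%E.
  apply: le_trans (union_bound (fun lam _ => mpre _ (measE lam)) (fun lam _ => PE lam)) _.
  by rewrite lee_fin; apply: le_trans hc; rewrite ler_wpM2r.
exists (~` G `|` [set x | exists2 lam, List.In lam L & E lam x]); split.
- by apply: measurableU => //; exact: measurableC.
- rewrite preimage_setU; apply: le_trans (measureU2 _ (mpre _ (measurableC mG)) (mpre _ mU)) _.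
  (* Half of the budget is for the norm event, whose [2^-D] fits because [m + 2 <= #|Q| <= D]; the
     other half is for the grid. *)
  have -> : 2^-1 ^+ m.+1 = 2^-1 ^+ (m + 2) + 2^-1 ^+ (m + 2) :> R.
    by rewrite addn2 [in RHS]exprS; lra.
  rewrite EFinD; apply: leeD; last exact: PU.
  apply: le_trans PG _; rewrite lee_fin div1r ler_wiXn2l ?invr_ge0 ?invf_le1 ?ler1n//.
  exact: leq_trans QD.
move=> x /not_orP[/contrapT Gx nE] e v Hv; rewrite leNgt; apply/negP => hlt; apply: nE.
have eta2 : eta <= 2^-1.
  apply: le_trans eta8 _; have : th ^+ 2 <= 1; last lra.
  by rewrite expr_le1 ?(ltW th0)//; apply: le_trans th4 _; rewrite invf_le1// ler1n.
have hb : beta / 8 + 2 * rad * eta < beta / 2.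
  have := ler_wpM2l (ltW rad0) eta8; rewrite /beta /kap.
  have : 0 < th ^+ 2 * rad by rewrite mulr_gt0// exprn_gt0.
  rewrite [th * (th * rad)]mulrA -expr2; move: (th ^+ 2) => z; exact: half_gap.
have [lam lamL hlam] := singular_of_eigvec (hamiltonian_herm x H0_herm) (Grad x Gx) rad0 beta0
  eta2 hb netL Hv hlt.
exists lam; first exact/InP.
by split.
Qed.

Lemma probability_M_mn_ge (m : nat) (d : 'I_m -> nat) (mu nu : 'I_m) (eps Cs bound : R) :
  (\sum_(k < m) d k)%N = D -> 0 < eps < 2^-1 ->
  Num.max 166 (4 * `|log2 (eps / Num.sqrt 2)|) < (d mu)%:R ->
  Num.max 166 (4 * `|log2 (eps / Num.sqrt 2)|) < (d nu)%:R ->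
  Cs = 100^-1 * sigma_min sigma / (15 / 2 * sigma_max sigma + C_H0 H0) ->
  bound = (Num.sqrt (eps * Cs) * (maxn (d mu) (d nu))%:R / D%:R) ^+ 16
               * Num.min 1 ((d nu)%:R / (d mu)%:R) ->
  (P [set w | (Complex bound 0%R <= M_mn d (randH H0 X w) mu nu)%R] >= (1 - eps)%:E)%E.
Proof.
move=> sumd /andP[e0 e2] dmu dnu CsE0 boundE0.
pose bg := if (d nu <= d mu)%N then mu else nu.
have dbg : d bg = maxn (d mu) (d nu).
  by rewrite /bg; case: leqP.
have : Num.max 166 (4 * `|log2 (eps / Num.sqrt 2)|) < (d bg)%:R by rewrite /bg; case: ifP.
rewrite gt_max => /andP[]; rewrite ltr_nat => bg167 bglog.
have dmu' : (166 < d mu)%N by move: dmu; rewrite gt_max ltr_nat => /andP[].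
pose Q := [pred i : 'I_D | in_block d bg i].
have cQ : #|Q| = d bg by exact: card_block.
have Q167 : (167 <= #|Q|)%N by rewrite cQ.
pose rho := 15 * sigma_max sigma + 2 * C_H0 H0.
pose a := sigma_min sigma / rho.
pose om := a * (#|Q|%:R / D%:R).
pose th := (om / 40) ^+ 2.
have QD : (#|Q| <= D)%N by rewrite -[leqRHS]card_ord max_card.
have D0 : (0 < D)%N by exact: leq_trans (leq_trans _ Q167) QD.
have [sm0 sml] := sigma_min_le_max D0 sigma_gt0.
have [C0 _] := nv_le_C_H0 H0 0 D0.
have rho0 : 0 < rho.
  have /andP[h1 h2] := sml (Ordinal D0) (Ordinal D0).
  by rewrite /rho; move: (lt_le_trans sm0 (le_trans h1 h2)) C0; lra.
have a0 : 0 < a by rewrite divr_gt0.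
have q0 : 0 < #|Q|%:R / D%:R :> R.
  by rewrite divr_gt0 ?ltr0n//; exact: leq_trans Q167.
have q1 : #|Q|%:R / D%:R <= 1 :> R by rewrite ler_pdivrMr ?ltr0n// mul1r ler_nat.
pose eta := (eps * (a / 50)) ^+ 4 * (#|Q|%:R / D%:R) ^+ 8.
(* The denominator of [C_sigma] is [rho / 2]: since [C_H0] enters it with coefficient 1 and [rho]
   with coefficient 2, [c_plus] is [15 / 2]. *)
have CsE : Cs = a / 50.
  by rewrite CsE0 /a (_ : 15 / 2 * _ + _ = rho / 2); [field; rewrite gt_eqF|rewrite /rho; field].
have ea0 : 0 <= eps * (a / 50) by rewrite mulr_ge0 ?(ltW e0)// divr_ge0// ltW.
have boundE : bound = eta ^+ 2 * Num.min 1 ((d nu)%:R / (d mu)%:R).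
  by rewrite boundE0 -dbg -cQ CsE -[Num.sqrt _ * _ / _]mulrA sqrt_expX16.
have eta0 : 0 <= eta by rewrite mulr_ge0 ?exprn_ge0// ltW.
have eta8 : eta <= th ^+ 2 / 8 by exact: gap_constant_le.
have [B [mB PB Bgood]] := eigenvectors_spread Q167 (erefl rho) (erefl a) (erefl om) (erefl th)
  eta0 eta8 (erefl (#|Q| %/ 4)%N).
set S := [set w | _].
have Hh x : (hamiltonian x) ^t* = hamiltonian x by exact: hamiltonian_herm.
have mX := measurable_RVs X.
have SE : S = (fun w => (X^~ w : state)) @^-1`
    [set x : state | (Complex bound 0%R <= M_mn d (hamiltonian x) mu nu)%R].
  by rewrite /S; apply/seteqP; split => w /=; rewrite randHE.
have mS : measurable S.
  rewrite SE -[X in measurable X]setTI; apply: mX => //.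
  by apply: measurable_M_mn_ge => //; exact: mxmeasurable_hamiltonian.
have mB' : measurable ((fun w => (X^~ w : state)) @^-1` B).
  by rewrite -[X in measurable X]setTI; exact: mX.
have SB : ~` S `<=` (fun w => (X^~ w : state)) @^-1` B.
  move=> w nS; apply: contrapT => nB; apply: nS; rewrite SE /= boundE.
  apply: M_mn_lower => //; [exact: ltn_trans dmu'|exact: sqr_ge0|].
  move=> e v Hv; rewrite -!sqr_nv -exprMn.
  apply: lerXn2r; rewrite ?nnegrE; [by rewrite mulr_ge0 ?nv_ge0|exact: nv_ge0|].
  exact: (Bgood _ nB _ _ Hv).
have PS : (P (~` S) <= eps%:E)%E.
  apply: le_trans (le_measure P _ _ SB) _; rewrite ?inE//; first exact: measurableC.
  apply: le_trans PB _; rewrite lee_fin; apply: half_exp_le_eps bglog _ => //.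
  (* The exponent [m.+1] is what gives [d <= 4 * m.+1] despite the rounding in [m]. *)
  by rewrite -cQ mulnC ltnW// ltn_ceil.
rewrite -(setCK S) probability_setC; last exact: measurableC.
by rewrite EFinB leeB.
Qed.

End main.

Unset Implicit Arguments.

Theorem mainTheorem4 (R : realType) :
  exists c_minus c_plus : R, 0 < c_minus /\ 0 < c_plus /\
  forall (D m : nat) (d : 'I_m -> nat) (mu nu : 'I_m) (eps : R)
    (H0 : 'M[R[i]]_D) (sigma : 'I_D -> 'I_D -> R)
    (dO : measure_display) (Omega : measurableType dO) (P : probability Omega R)
    (X : 'I_D * 'I_D * bool -> {RV P >-> R}),
  (2 <= m)%N ->
  (\sum_(k < m) d k)%N = D ->
  0 < eps < 2^-1 ->
  is_hermitian H0 ->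
  (forall i j, 0 < sigma i j) ->
  (forall i j, sigma i j = sigma j i) ->
  mutually_independent X ->
  (forall i j (b : bool), is_normal0 (X (i, j, b)) (sigma i j / Num.sqrt 2)) ->
  Num.max 166 (4 * `|log2 (eps / Num.sqrt 2)|) < (d mu)%:R ->
  Num.max 166 (4 * `|log2 (eps / Num.sqrt 2)|) < (d nu)%:R ->
  let C_sigma := c_minus * sigma_min sigma /
                 (c_plus * sigma_max sigma + C_H0 H0) in
  let bound := (Num.sqrt (eps * C_sigma) * (maxn (d mu) (d nu))%:R / D%:R) ^+ 16
               * Num.min 1 ((d nu)%:R / (d mu)%:R) in
  (P [set w | (Complex bound 0%R <= M_mn d (randH H0 X w) mu nu)%R] >= (1 - eps)%:E)%E.
Proof.
exists 100^-1, (15 / 2); split; first by rewrite invr_gt0.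
split; first by rewrite divr_gt0.
move=> D m d mu nu eps H0 sigma dO Omega P X _ sumd eps12 H0h sigma_gt0 _ indX normalX dmu dnu.
exact: (probability_M_mn_ge indX sigma_gt0 normalX H0h sumd eps12 dmu dnu (erefl _) (erefl _)).
Qed.
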